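(* Let $M$ be a connected oriented $n$-dimensional Riemannian manifold with a $Spin^r(n)$ structure ($r\ge 2$), with auxiliary rank $r$ oriented Riemannian bundle $F$ endowed with a metric connection $\nabla^F$, and let $m\in\mathbb N$ be such that $S=S(TM)\otimes S(F)^{\otimes m}$ is globally defined. Let $\phi\in\Gamma(S)$ be a non-zero parallel spinor, i.e. $\nabla^\theta_X\phi=0$ for all $X\in\Gamma(TM)$. Then: 1. $\phi$ has non-zero constant length and no zeros. 2. The Ricci endomorphism decomposes as $$\mathrm{Ric}=\frac1{|\phi|^2}\sum_{k<l}\hat\eta^\phi_{kl}\circ\hat\Theta_{kl}=\frac1{|\phi|^2}\sum_{k<l}\hat\Theta_{kl}\circ\hat\eta^\phi_{kl}.$$ 3. The scalar curvature is $$\mathrm R=\frac1{|\phi|^2}\sum_{k<l}\mathrm{tr}(\hat\Theta_{kl}\circ\hat\eta^\phi_{kl})=-\frac1{|\phi|^2}\langle\hat\eta^\phi,\hat\Theta\rangle_1 .$$ 4. If the connection on $F$ is flat, then $M$ is Ricci-flat. 5. If $\eta^\phi_{kl}=0$ for all $1\le k<l\le r$, then $M$ is Ricci-flat.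
   Context: Clifford algebra: $Cl_n$ is generated by an orthonormal basis $e_1,\dots,e_n$ of $\mathbb R^n$ with $e_ie_j+e_je_i=-2\delta_{ij}$; $\Delta_n=\mathbb C^{2^{[n/2]}}$ is the complex spinor space, on which $Cl_n$ acts via $\kappa$ (the isomorphism $Cl_n\otimes\mathbb C\cong\mathrm{End}(\Delta_n)$ for $n$ even; for $n$ odd the isomorphism with $\mathrm{End}(\Delta_n)\oplus\mathrm{End}(\Delta_n)$ followed by the projection to the first summand), with Hermitian product for which Clifford multiplication $x\cdot\phi=\kappa(x)\phi$ by vectors is skew; $X\wedge Y$ acts as $X\cdot Y+\langle X,Y\rangle$. $Spin(n)\subset Cl_n$ has Lie algebra spanned by $e_ie_j$, $i<j$; $\lambda_n:Spin(n)\to SO(n)$ is the double cover, with $\lambda_{n*}(e_ie_j)=2E_{ij}$, $E_{ij}:e_i\mapsto e_j,\ e_j\mapsto -e_i$. $\kappa^m_r$ is the representation of $Spin(r)$ on $\Delta_r^{\otimes m}$, and $\kappa^m_{r*}(f_kf_l)$ is the sum over $a=1,\dots,m$ of Clifford multiplication by $f_kf_l$ in the $a$-th factor. On $\Delta_n\otimes\Delta_r^{\otimes m}$, vectors and forms of $\mathbb R^n$ act on $\Delta_n$ and $\kappa^m_{r*}(f_kf_l)$ acts on $\Delta_r^{\otimes m}$. $Spin^r(n)=(Spin(n)\times Spin(r))/\{\pm(1,1)\}$. A $Spin^r(n)$ structure on $M$ is a principal $SO(r)$-bundle $P_{SO(r)}$ and a principal $Spin^r(n)$-bundle $P$ with a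 2:1 covering $P\to P_{SO(M)}\tilde\times P_{SO(r)}$ (fibered product) equivariant with respect to $\lambda_n\times\lambda_r$. $F$ is the rank $r$ vector bundle associated to $P_{SO(r)}$, and $S=S(TM)\otimes S(F)^{\otimes m}$ is the bundle with fiber $\Delta_n\otimes\Delta_r^{\otimes m}$ associated to $\kappa_n\otimes\kappa_r^m$; it is globally defined if $m$ is odd (structure group $Spin^r(n)$), or if $M$ and $F$ are both Spin (group $Spin(n)\times Spin(r)$, any $m$), or if $M$ is Spin and $m$ is even (group $Spin(n)\times SO(r)$). $\nabla^\theta$ is the covariant derivative on $S$ induced by the Levi-Civita connection and $\nabla^F$. For local orthonormal frames $(e_i)$ of $TM$ and $(f_k)$ of $F$: $\Theta_{kl}(X,Y)=\langle R^F(X,Y)f_k,f_l\rangle$, where $R^F(X,Y)=[\nabla^F_X,\nabla^F_Y]-\nabla^F_{[X,Y]}$; for $k\neq l$, $\eta^\phi_{kl}(X,Y)=\mathrm{Re}\langle X\wedge Y\cdot\kappa^m_{r*}(f_kf_l)\cdot\phi,\phi\rangle$, a local real 2-form. For a 2-form $\xi$, $\hat\xi$ is the skew endomorphism $\hat\xi(X)=(X\lrcorner\xi)^\sharp$, i.e. $\langle\hat\xi(X),Y\rangle=\xi(X,Y)$. $\langle\hat\eta^\phi,\hat\Theta\rangle_1=\sum_{k<l}\mathrm{tr}(\hat\eta^\phi_{kl}(\hat\Theta_{kl})^T)$. $\mathrm{Ric}$ is the Ricci endomorphism (positive on round spheres) and $\mathrm R$ its trace. *)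

(* Defs.v *)
From HB Require Import structures.
From mathcomp Require Import all_boot all_order all_algebra.
From mathcomp Require Import all_classical all_reals all_analysis.
From mathcomp Require Import complex ring.

Set Implicit Arguments.
Unset Strict Implicit.
Unset Printing Implicit Defensive.

Import Order.TTheory GRing.Theory Num.Theory numFieldNormedType.Exports.

Local Open Scope classical_set_scope.
Local Open Scope ring_scope.

(** * The Clifford algebra Cl_n, the spin group and its covering of SO(n)

    Cl_n has the linear basis e_A = e_{i_1} ... e_{i_k}, for
    A = {i_1 < ... < i_k}; an element is its family of coordinates.  One has
    e_A e_B = cl_sign A B e_{A + B} (symmetric difference): each pair
    (a, b) with b < a costs one anticommutation, and each pair with b = a
    contributes e_a^2 = -1. *)

Section Clifford.
Variables (R : realType) (n : nat).
Implicit Types A B C D : {set 'I_n}.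

Definition symdiff A B : {set 'I_n} := (A :\: B) :|: (B :\: A).

Definition cl_sign A B : R :=
  \prod_(a in A) \prod_(b in B) (if (b <= a)%N then -1 else 1).

Definition clifford : Type := {ffun {set 'I_n} -> R}.
HB.instance Definition _ := GRing.Lmodule.on clifford.

Definition cl_basis A : clifford := [ffun B => (B == A)%:R].

Definition cl_mul (x y : clifford) : clifford :=
  [ffun C => \sum_(A : {set 'I_n})
     cl_sign A (symdiff A C) * (x A * y (symdiff A C))].

Lemma in_symdiff A B i : (i \in symdiff A B) = (i \in A) (+) (i \in B).
Proof. by rewrite !inE; case: (i \in A); case: (i \in B). Qed.

Lemma symdiffA A B C : symdiff A (symdiff B C) = symdiff (symdiff A B) C.
Proof. by apply/finset.setP => i; rewrite !in_symdiff addbA. Qed.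

Lemma symdiffK A : involutive (symdiff A).
Proof. by move=> B; apply/finset.setP => i; rewrite !in_symdiff addbA addbb. Qed.

Lemma symdiff0 A : symdiff finset.set0 A = A.
Proof. by apply/finset.setP => i; rewrite in_symdiff finset.in_set0. Qed.

Lemma symdiffv A : symdiff A A = finset.set0.
Proof. by apply/finset.setP => i; rewrite in_symdiff finset.in_set0 addbb. Qed.

Lemma cl_signE A B : cl_sign A B =
  \prod_a \prod_b (if [&& a \in A, b \in B & (b <= a)%N] then -1 else 1).
Proof.
rewrite /cl_sign big_mkcond; apply: eq_bigr => a _.
case: (a \in A) => /=; last by rewrite big1.
by rewrite big_mkcond; apply: eq_bigr => b _; case: (b \in B).
Qed.

Lemma cl_signMl A B C : cl_sign (symdiff A B) C = cl_sign A C * cl_sign B C.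
Proof.
rewrite !cl_signE -big_split; apply: eq_bigr => a _ /=.
rewrite -big_split; apply: eq_bigr => b _ /=; rewrite in_symdiff.
by case: (a \in A); case: (a \in B); case: (b \in C); case: (_ <= _)%N;
   rewrite /= ?mulrNN ?mulr1 ?mul1r.
Qed.

Lemma cl_signMr A B C : cl_sign C (symdiff A B) = cl_sign C A * cl_sign C B.
Proof.
rewrite !cl_signE -big_split; apply: eq_bigr => a _ /=.
rewrite -big_split; apply: eq_bigr => b _ /=; rewrite in_symdiff.
by case: (a \in C); case: (b \in A); case: (b \in B); case: (_ <= _)%N;
   rewrite /= ?mulrNN ?mulr1 ?mul1r.
Qed.

Lemma cl_sign_sq A B : cl_sign A B * cl_sign A B = 1.
Proof. by rewrite -cl_signMl symdiffv /cl_sign big_set0. Qed.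

Lemma cl_mulA : associative cl_mul.
Proof.
move=> x y z; apply/ffunP => D; rewrite !ffunE.
under eq_bigr => A _.
  rewrite ffunE (reindex_inj (inv_inj (symdiffK A))) /= mulr_sumr mulr_sumr.
  over.
rewrite exchange_big /=; apply: eq_bigr => B _.
rewrite ffunE mulr_suml mulr_sumr; apply: eq_bigr => A _.
have eBD : symdiff (symdiff A B) (symdiff A D) = symdiff B D.
  apply/finset.setP => i; rewrite !in_symdiff.
  by case: (i \in A); case: (i \in B); case: (i \in D).
have eAD : symdiff A D = symdiff (symdiff A B) (symdiff B D).
  apply/finset.setP => i; rewrite !in_symdiff.
  by case: (i \in A); case: (i \in B); case: (i \in D).
rewrite eBD {1}eAD cl_signMr cl_signMl.
set s1 := cl_sign A (symdiff A B); set s2 := cl_sign A (symdiff B D).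
set s3 := cl_sign B (symdiff B D).
have -> : s1 * s2 * (x A * (s2 * s3 * (y (symdiff A B) * z (symdiff B D)))) =
  (s2 * s2) * (s3 * (s1 * (x A * y (symdiff A B)) * z (symdiff B D))).
  by ring.
by rewrite cl_sign_sq mul1r.
Qed.

Lemma cl_mul1 : left_id (cl_basis finset.set0) cl_mul.
Proof.
move=> x; apply/ffunP => C; rewrite ffunE (bigD1 finset.set0) //= big1 => [|A nA].
  by rewrite ffunE eqxx symdiff0 /cl_sign big_set0 !mul1r addr0.
by rewrite ffunE (negPf nA) mul0r mulr0.
Qed.

Lemma cl_1mul : right_id (cl_basis finset.set0) cl_mul.
Proof.
move=> x; apply/ffunP => C; rewrite ffunE (bigD1 C) //= big1 => [|A nA].
  rewrite ffunE symdiffv eqxx /cl_sign big1 ?mulr1 ?mul1r ?addr0 //.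
  by move=> a _; rewrite big_set0.
rewrite ffunE; case: eqP => [e|_]; last by rewrite !mulr0.
by case/eqP: nA; rewrite -[C](symdiffK A) e; apply/finset.setP=> i;
   rewrite in_symdiff finset.in_set0 addbF.
Qed.

Lemma cl_mulDl : left_distributive cl_mul +%R.
Proof.
move=> x y z; apply/ffunP => C; rewrite !ffunE -big_split; apply: eq_bigr => A _.
by rewrite ffunE mulrDl mulrDr.
Qed.

Lemma cl_mulDr : right_distributive cl_mul +%R.
Proof.
move=> x y z; apply/ffunP => C; rewrite !ffunE -big_split; apply: eq_bigr => A _.
by rewrite ffunE !mulrDr.
Qed.

Lemma cl_oner_neq0 : cl_basis finset.set0 != 0.
Proof.
by apply/eqP => /ffunP/(_ finset.set0)/eqP; rewrite !ffunE eqxx oner_eq0.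
Qed.

HB.instance Definition _ := GRing.Zmodule_isNzRing.Build clifford
  cl_mulA cl_mul1 cl_1mul cl_mulDl cl_mulDr cl_oner_neq0.

Definition cl_vec (x : 'cV[R]_n) : clifford :=
  \sum_i x i 0 *: cl_basis [set i]%SET.

Lemma cl_basisM A B :
  cl_basis A * cl_basis B = cl_sign A B *: cl_basis (symdiff A B).
Proof.
apply/ffunP => C; rewrite !ffunE (bigD1 A) //= big1 => [|D nD].
  rewrite addr0 !ffunE eqxx mul1r.
  have -> : (symdiff A C == B) = (C == symdiff A B).
    by apply/eqP/eqP => [<-|->]; rewrite symdiffK.
  case: eqP => [->|_]; last by rewrite !mulr0 scaler0.
  by rewrite symdiffK.
by rewrite !ffunE (negPf nD) mul0r mulr0.
Qed.

Lemma cl_generators (i j : 'I_n) :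
  cl_basis [set i]%SET * cl_basis [set j]%SET
    + cl_basis [set j]%SET * cl_basis [set i]%SET
  = (if i == j then - 2 else 0) :> clifford.
Proof.
rewrite !cl_basisM /cl_sign !big_set1.
have [->|nij] := eqVneq i j.
  rewrite leqnn symdiffv scaleN1r -opprD; congr (- _).
have -> : symdiff [set j]%SET [set i]%SET = symdiff [set i]%SET [set j]%SET.
  by apply/finset.setP => k; rewrite !in_symdiff addbC.
rewrite -scalerDl; case: (ltngtP i j) => [_|_|/val_inj e].
- by rewrite subrr scale0r.
- by rewrite addrC subrr scale0r.
- by rewrite e eqxx in nij.
Qed.

Definition spin (g : clifford) : Prop :=
  exists s : seq 'cV[R]_n,
    [/\ ~~ odd (size s), forall x, x \in s -> x^T *m x = 1%:M
      & g = \prod_(x <- s) cl_vec x].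

(* Reversal e_{i_1} ... e_{i_k} |-> e_{i_k} ... e_{i_1}; it is the inverse on
   the spin group, since (x_1 ... x_2l)^-1 = x_2l ... x_1 for unit vectors. *)
Definition cl_rev (x : clifford) : clifford :=
  [ffun A : {set 'I_n} => (-1) ^+ 'C(#|A|, 2) * x A].

(* lambda_n(g) x = g x g^-1; column j holds the coordinates of g e_j g^-1. *)
Definition spin_cover (g : clifford) : 'M[R]_n :=
  \matrix_(i, j) (g * cl_basis [set j]%SET * cl_rev g) [set i]%SET.

End Clifford.

(** * Spinors *)

Section Spinors.
Variable R : realType.

Definition re_scale (V : lmodType R[i]) (a : R) (v : V) : V :=
  real_complex R a *: v.

(* Skew-Hermitian Clifford matrices of size 2^[n/2]: by dimension, the induced
   complex representation of Cl_n is the isomorphism onto End(Delta_n) for n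
   even, and one summand of Cl_n (x) C = End(Delta_n) + End(Delta_n) for n
   odd.  The Hermitian product of C^(2^[n/2]) is the standard one. *)
Definition clifford_rep n (gam : 'I_n -> 'M[R[i]]_(2 ^ n./2)) : Prop :=
  (forall i j, gam i *m gam j + gam j *m gam i
               = (if i == j then - 2 else 0)%:M) /\
  (forall i, map_mx Num.conj (gam i)^T = - gam i).

(* kappa on Cl_n: the product is taken in increasing order of the indices. *)
Definition kappa n (gam : 'I_n -> 'M[R[i]]_(2 ^ n./2)) (x : clifford R n) :
    'M[R[i]]_(2 ^ n./2) :=
  \sum_(A : {set 'I_n}) re_scale (x A) (\big[mulmx/1%:M]_(i in A) gam i).

Definition kappa_vec n (gam : 'I_n -> 'M[R[i]]_(2 ^ n./2)) (x : 'cV[R]_n) :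
    'M[R[i]]_(2 ^ n./2) :=
  \sum_i re_scale (x i 0) (gam i).

(* Delta_n (x) Delta_r^{(x) m}, by coordinates in the product basis. *)
Definition spinor n r m : Type :=
  {ffun 'I_(2 ^ n./2) * {ffun 'I_m -> 'I_(2 ^ r./2)} -> R[i]}.
HB.instance Definition _ n r m := GRing.Lmodule.on (spinor n r m).

Definition herm n r m (psi chi : spinor n r m) : R[i] :=
  \sum_s psi s * Num.conj (chi s).

Definition norm2 n r m (psi : spinor n r m) : R := complex.Re (herm psi psi).

Definition act_base n r m (B : 'M[R[i]]_(2 ^ n./2)) (psi : spinor n r m) :
    spinor n r m :=
  [ffun s => \sum_a B s.1 a * psi (a, s.2)].

Definition act_slot n r m (j : 'I_m) (B : 'M[R[i]]_(2 ^ r./2))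
    (psi : spinor n r m) : spinor n r m :=
  [ffun s : 'I_(2 ^ n./2) * {ffun 'I_m -> 'I_(2 ^ r./2)} => \sum_b B (s.2 j) b *
     psi (s.1, [ffun i => if i == j then b else s.2 i])].

(* B^{(x) m} on Delta_r^{(x) m}. *)
Definition act_slots n r m (B : 'M[R[i]]_(2 ^ r./2)) (psi : spinor n r m) :
    spinor n r m :=
  [ffun s : 'I_(2 ^ n./2) * {ffun 'I_m -> 'I_(2 ^ r./2)} =>
     \sum_(t : {ffun 'I_m -> 'I_(2 ^ r./2)}) (\prod_j B (s.2 j) (t j)) * psi (s.1, t)].

Section Actions.
Variables (n r m : nat).
Variables (gn : 'I_n -> 'M[R[i]]_(2 ^ n./2)) (gr : 'I_r -> 'M[R[i]]_(2 ^ r./2)).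

(* kappa_n (x) kappa_r^m on Spin(n) x Spin(r). *)
Definition spin_act (g : clifford R n * clifford R r) (psi : spinor n r m) :
    spinor n r m :=
  act_base (kappa gn g.1) (act_slots (kappa gr g.2) psi).

Definition clmul (x : 'cV[R]_n) (psi : spinor n r m) : spinor n r m :=
  act_base (kappa_vec gn x) psi.

Definition wedge_mul (x y : 'cV[R]_n) (psi : spinor n r m) : spinor n r m :=
  clmul x (clmul y psi) + re_scale ((x^T *m y) 0 0) psi.

(* kappa^m_{r*}(y z), for orthogonal vectors y and z of R^r. *)
Definition tw_mul (y z : 'cV[R]_r) (psi : spinor n r m) : spinor n r m :=
  \sum_(j < m) act_slot j (kappa_vec gr y *m kappa_vec gr z) psi.

End Actions.
End Spinors.

(** * Smooth manifolds *)

Section Calculus.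
Variables (R : realType) (n : nat).

Fixpoint Ck (k : nat) (U : set 'cV[R]_n) (f : 'cV[R]_n -> R) : Prop :=
  match k with
  | 0 => forall x, U x -> {for x, continuous f}
  | k'.+1 => (forall x, U x -> differentiable f x) /\
             (forall v, Ck k' U (fun x => 'D_v f x))
  end.

Definition smooth_on (U : set 'cV[R]_n) (f : 'cV[R]_n -> R) : Prop :=
  forall k, Ck k U f.

Definition partial (f : 'cV[R]_n -> R) (a : 'I_n) (x : 'cV[R]_n) : R :=
  'D_(delta_mx a 0) f x.

End Calculus.

(* Oriented smooth manifolds of dimension n.  [cparam c] is the inverse of the
   chart [ccoord c] on [ccoord c @` cdom c]; values of both outside their domains
   are irrelevant.  [chart_at p] is a preferred chart at p: it fixes the
   identification of the tangent space at p with R^n. *)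
Record manifold (R : realType) (n : nat) := Manifold {
  man :> topologicalType;
  man_hausdorff : hausdorff_space man;
  man_countable : @second_countable man;
  chart : Type;
  cdom : chart -> set man;
  ccoord : chart -> man -> 'cV[R]_n;
  cparam : chart -> 'cV[R]_n -> man;
  chart_at : man -> chart;
  chart_at_dom : forall p, cdom (chart_at p) p;
  cdom_open : forall c, open (cdom c);
  coord_open : forall c, open (ccoord c @` cdom c);
  coordK : forall c p, cdom c p -> cparam c (ccoord c p) = p;
  coord_continuous : forall c p, cdom c p -> {for p, continuous (ccoord c)};
  param_continuous : forall c x, (ccoord c @` cdom c) x ->
    {for x, continuous (cparam c)};
  transition_smooth : forall c d a,
    smooth_on (ccoord c @` (cdom c `&` cdom d))
      (fun x => ccoord d (cparam c x) a 0);
  transition_oriented : forall c d p, cdom c p -> cdom d p ->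
    0 < \det (\matrix_(a, b)
      partial (fun x => ccoord d (cparam c x) a 0) b (ccoord c p))
}.

Section Manifold.
Variables (R : realType) (n : nat) (M : manifold R n).

Definition smooth_fun (U : set M) (f : M -> R) : Prop :=
  forall c : chart M, smooth_on (ccoord c @` (U `&` cdom c)) (f \o cparam c).

(* Differential at the point p of the transition from the chart c to d. *)
Definition jac (c d : chart M) (p : M) : 'M[R]_n :=
  \matrix_(a, b) partial (fun x => ccoord d (cparam c x) a 0) b (ccoord c p).

(* The differential of f at p, a linear form on T_p M = 'cV_n. *)
Definition dfun (f : M -> R) (p : M) : 'rV[R]_n :=
  \row_a partial (f \o cparam (chart_at p)) a (ccoord (chart_at p) p).

Definition dirder (f : M -> R) (p : M) (v : 'cV[R]_n) : R :=
  (dfun f p *m v) 0 0.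

End Manifold.

(** * Vector bundles

    The fibre at each point is R^k; the bundle is given by its local frames,
    where the columns of [vframe j p] are the values at p of the frame j.  *)

Record vbundle (R : realType) (n : nat) (M : manifold R n) (k : nat) :=
  VBundle {
  vtriv : Type;
  vdom : vtriv -> set M;
  vframe : vtriv -> M -> 'M[R]_k
}.
Arguments vdom {R n M k} _ _.
Arguments vframe {R n M k} _ _ _.

(* The coordinate frame of the chart c, expressed in the preferred charts. *)
Definition tangent (R : realType) (n : nat) (M : manifold R n) :
    vbundle M n :=
  @VBundle R n M n (chart M) (@cdom R n M) (fun c p => jac c (chart_at p) p).

Section Bundles.
Variables (R : realType) (n : nat) (M : manifold R n).

Section Bundle.
Variables (k : nat) (E : vbundle M k).

(* Each fibre R^k carries its standard orientation, and the local frames are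
   positive. *)
Definition oriented_bundle : Prop :=
  [/\ forall j, open (vdom E j),
      forall p, exists j, vdom E j p,
      forall j p, vdom E j p -> 0 < \det (vframe E j p)
    & forall j l a b, smooth_fun (vdom E j `&` vdom E l)
        (fun p => (invmx (vframe E j p) *m vframe E l p) a b)].

Definition smooth_sec (U : set M) (s : M -> 'cV[R]_k) : Prop :=
  forall j a, smooth_fun (U `&` vdom E j)
    (fun p => (invmx (vframe E j p) *m s p) a 0).

Definition inner (g : M -> 'M[R]_k) (p : M) (v w : 'cV[R]_k) : R :=
  (v^T *m g p *m w) 0 0.

Definition bundle_metric (g : M -> 'M[R]_k) : Prop :=
  [/\ forall p, (g p)^T = g p,
      forall p v, v != 0 -> 0 < inner g p v v
    & forall j a b, smooth_fun (vdom E j)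
        (fun p => ((vframe E j p)^T *m g p *m vframe E j p) a b)].

End Bundle.

Section Connections.
Variables (k : nat) (E : vbundle M k).

(* Orthonormal frame over U, its i-th section being the i-th column. *)
Definition orthonormal_frame (g : M -> 'M[R]_k) (U : set M)
    (f : M -> 'M[R]_k) : Prop :=
  (forall i, smooth_sec E U (fun p => col i (f p))) /\
  (forall p, U p -> (f p)^T *m g p *m f p = 1%:M).

(* A covariant derivative maps a section s to a section of Hom(TM, E):
   nabla_v s = D s p *m v for v in T_p M. *)
Definition covder : Type := (M -> 'cV[R]_k) -> M -> 'M[R]_(k, n).

Definition is_connection (D : covder) : Prop :=
  forall U : set M, open U ->
  forall s t, smooth_sec E U s -> smooth_sec E U t ->
  [/\ forall X, smooth_sec (tangent M) U X ->
        smooth_sec E U (fun p => D s p *m X p),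
      (forall p, U p -> s p = t p) -> forall p, U p -> D s p = D t p,
      forall p, U p -> D (fun q => s q + t q) p = D s p + D t p
    & forall f, smooth_fun U f -> forall p, U p ->
        D (fun q => f q *: s q) p = f p *: D s p + s p *m dfun f p].

Definition metric_connection (g : M -> 'M[R]_k) (D : covder) : Prop :=
  is_connection D /\
  forall U : set M, open U ->
  forall s t, smooth_sec E U s -> smooth_sec E U t ->
  forall p, U p -> forall v,
    dirder (fun q => inner g q (s q) (t q)) p v
    = inner g p (D s p *m v) (t p) + inner g p (s p) (D t p *m v).

(* Components of [X, Y] in the preferred chart at p. *)
Definition lie_bracket (X Y : M -> 'cV[R]_n) (p : M) : 'cV[R]_n :=
  let comp Z a q := (invmx (vframe (tangent M) (chart_at p) q) *m Z q) a 0 in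
  \col_a (dirder (comp Y a) p (X p) - dirder (comp X a) p (Y p)).

(* R(X, Y) s = [nabla_X, nabla_Y] s - nabla_[X, Y] s. *)
Definition curv (D : covder) (X Y : M -> 'cV[R]_n) (s : M -> 'cV[R]_k)
    (p : M) : 'cV[R]_k :=
  D (fun q => D s q *m Y q) p *m X p - D (fun q => D s q *m X q) p *m Y p
  - D s p *m lie_bracket X Y p.

Definition flat (D : covder) : Prop :=
  forall U : set M, open U -> forall X Y s,
  smooth_sec (tangent M) U X -> smooth_sec (tangent M) U Y ->
  smooth_sec E U s -> forall p, U p -> curv D X Y s p = 0.

End Connections.

(** * Riemannian geometry of M *)

Section Riemannian.
Variable gM : M -> 'M[R]_n.

Definition levi_civita (D : covder n) : Prop :=
  metric_connection (tangent M) gM D /\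
  forall U : set M, open U ->
  forall X Y, smooth_sec (tangent M) U X -> smooth_sec (tangent M) U Y ->
  forall p, U p -> D Y p *m X p - D X p *m Y p = lie_bracket X Y p.

(* The a-th coordinate field of the preferred chart at p: a local extension of
   the a-th vector of the standard basis of T_p M = R^n. *)
Definition coord_field (p : M) (a : 'I_n) (q : M) : 'cV[R]_n :=
  col a (vframe (tangent M) (chart_at p) q).

(* Bilinear forms on T_p M are given by their matrices in the standard basis;
   [sharp p b] is the endomorphism H with <H v, w> = b(v, w). *)
Definition sharp (p : M) (b : 'M[R]_n) : 'M[R]_n := invmx (gM p) *m b^T.

Lemma sharpP (p : M) (b : 'M[R]_n) (v w : 'cV[R]_n) :
  (gM p)^T = gM p -> gM p \in unitmx ->
  inner gM p (sharp p b *m v) w = (v^T *m b *m w) 0 0.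
Proof.
move=> sg ug; rewrite /inner /sharp !trmx_mul trmxK trmx_inv sg.
by rewrite !mulmxA mulmxKV.
Qed.

(* Transpose with respect to the metric. *)
Definition metric_adjoint (p : M) (H : 'M[R]_n) : 'M[R]_n :=
  invmx (gM p) *m H^T *m gM p.

(* Ric(y, z) = tr (x |-> R(x, y) z). *)
Definition ricci_form (D : covder n) (p : M) : 'M[R]_n :=
  \matrix_(i, j) \sum_a
    curv D (coord_field p a) (coord_field p i) (coord_field p j) p a 0.

Definition Ric (D : covder n) (p : M) : 'M[R]_n := sharp p (ricci_form D p).

Definition scalar_curvature (D : covder n) (p : M) : R := \tr (Ric D p).

End Riemannian.

(* Theta_kl for the local frame f, as a 2-form on T_p M. *)
Definition Theta_form (r : nat) (gF : M -> 'M[R]_r) (DF : covder r)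
    (f : M -> 'M[R]_r) (k l : 'I_r) (p : M) : 'M[R]_n :=
  \matrix_(a, b)
    inner gF p
      (curv DF (coord_field p a) (coord_field p b) (fun q => col k (f q)) p)
      (col l (f p)).

End Bundles.

(** * Spin structures and spinor bundles *)

(* The three structure groups, as quotients of Spin(n) x Spin(r):
   Spin^r(n), Spin(n) x Spin(r), and Spin(n) x SO(r). *)
Inductive spin_kind := SpinTwisted | SpinSpin | SpinSO.

Definition spin_kernel (R : realType) (n r : nat) (c : spin_kind)
    (g : clifford R n * clifford R r) : Prop :=
  match c with
  | SpinTwisted => g = (1, 1) \/ g = (-1, -1)
  | SpinSpin => g = (1, 1)
  | SpinSO => g = (1, 1) \/ g = (1, -1)
  end.

Definition spin2 (R : realType) (n r : nat)
    (g : clifford R n * clifford R r) : Prop := spin g.1 /\ spin g.2.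

Section SpinStructures.
Variables (R : realType) (n r : nat) (M : manifold R n) (gM : M -> 'M[R]_n).
Variables (F : vbundle M r) (gF : M -> 'M[R]_r).

(* A principal bundle P with group G = (Spin(n) x Spin(r)) / spin_kernel c,
   with an equivariant map to the fibred product of the bundles of positive
   orthonormal frames of TM and of F.  A right action of G is an action of
   Spin(n) x Spin(r) with stabilisers [spin_kernel c], and its values on other
   pairs are irrelevant; maps to G are smooth if they lift locally to smooth
   maps to Spin(n) x Spin(r).  The smooth structure of P is given by local
   sections with smooth transition functions.  Equivariance forces the frame
   map to be a covering, 2:1 for Spin^r(n). *)
Record spin_bundle (c : spin_kind) := SpinBundle {
  sp_total :> Type;
  sp_proj : sp_total -> M;
  sp_act : sp_total -> clifford R n * clifford R r -> sp_total;
  sp_act1 : forall u, sp_act u (1, 1) = u;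
  sp_actM : forall u g h, spin2 g -> spin2 h ->
    sp_act (sp_act u g) h = sp_act u (g.1 * h.1, g.2 * h.2);
  sp_orbit : forall u v,
    sp_proj u = sp_proj v <-> exists2 g, spin2 g & v = sp_act u g;
  sp_stabiliser : forall u g, spin2 g -> (sp_act u g = u <-> spin_kernel c g);
  sp_triv : Type;
  sp_dom : sp_triv -> set M;
  sp_sec : sp_triv -> M -> sp_total;
  sp_open : forall j, open (sp_dom j);
  sp_cover : forall p, exists j, sp_dom j p;
  sp_secK : forall j p, sp_dom j p -> sp_proj (sp_sec j p) = p;
  sp_transition : forall j l p, sp_dom j p -> sp_dom l p ->
    exists V : set M, exists g : M -> clifford R n * clifford R r,
    [/\ open V, V p, forall A, smooth_fun V (fun q => (g q).1 A),
        forall B, smooth_fun V (fun q => (g q).2 B)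
      & forall q, V q -> spin2 (g q) /\ sp_sec l q = sp_act (sp_sec j q) (g q)];
  sp_frameM : sp_total -> 'M[R]_n;
  sp_frameF : sp_total -> 'M[R]_r;
  sp_frame_smooth : forall j,
    orthonormal_frame (tangent M) gM (sp_dom j) (sp_frameM \o sp_sec j) /\
    orthonormal_frame F gF (sp_dom j) (sp_frameF \o sp_sec j);
  sp_frame_positive : forall u,
    0 < \det (sp_frameM u) /\ 0 < \det (sp_frameF u);
  sp_frame_equivariant : forall u g, spin2 g ->
    sp_frameM (sp_act u g) = sp_frameM u *m spin_cover g.1 /\
    sp_frameF (sp_act u g) = sp_frameF u *m spin_cover g.2
}.

Arguments sp_dom [c] _ _.

(* The ways in which S(TM) (x) S(F)^{(x) m} is globally defined. *)
Inductive spinor_structure (P : spin_bundle SpinTwisted) (m : nat) : Type :=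
| FromSpinTwisted of odd m
| FromSpinSpin of spin_bundle SpinSpin
| FromSpinSO of ~~ odd m & spin_bundle SpinSO.

Definition spinor_kind P m (S : @spinor_structure P m) : spin_kind :=
  match S with
  | FromSpinTwisted _ => SpinTwisted
  | FromSpinSpin _ => SpinSpin
  | FromSpinSO _ _ => SpinSO
  end.

Definition spinor_bundle P m (S : @spinor_structure P m) :
    spin_bundle (spinor_kind S) :=
  match S with
  | FromSpinTwisted _ => P
  | FromSpinSpin Q => Q
  | FromSpinSO _ Q => Q
  end.

Variables (m : nat).
Variables (gn : 'I_n -> 'M[R[i]]_(2 ^ n./2)) (gr : 'I_r -> 'M[R[i]]_(2 ^ r./2)).
Variables (c : spin_kind) (P : spin_bundle c).

(* Sections of the associated bundle, as equivariant functions on P: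
   phi (u g) = kappa(g)^-1 phi(u). *)
Definition spinor_field (phi : P -> spinor R n r m) : Prop :=
  (forall u g, spin2 g -> phi u = spin_act gn gr g (phi (sp_act u g))) /\
  (forall j s,
    smooth_fun (sp_dom P j) (fun p => complex.Re (phi (sp_sec j p) s)) /\
    smooth_fun (sp_dom P j) (fun p => complex.Im (phi (sp_sec j p) s))).

Definition dspinor (psi : M -> spinor R n r m) (p : M) (v : 'cV[R]_n) :
    spinor R n r m :=
  [ffun s => Complex (dirder (fun q => complex.Re (psi q s)) p v)
                     (dirder (fun q => complex.Im (psi q s)) p v)].

(* omega_ab(v) = <nabla_v e_a, e_b> for the frame e. *)
Definition connection_form k (g : M -> 'M[R]_k) (D : covder M k)
    (e : M -> 'M[R]_k) (a b : 'I_k) (p : M) (v : 'cV[R]_n) : R :=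
  inner g p (D (fun q => col a (e q)) p *m v) (col b (e p)).

(* nabla^theta_v phi at p in the trivialisation j.  The connection form
   sum_{a<b} omega_ab E_ab of TM lifts to 1/2 sum_{a<b} omega_ab e_a e_b, and
   similarly for F. *)
Definition nabla_theta (DM : covder M n) (DF : covder M r)
    (phi : P -> spinor R n r m) (j : sp_triv P) (p : M) (v : 'cV[R]_n) :
    spinor R n r m :=
  let psi := fun q => phi (sp_sec j q) in
  let e := sp_frameM (s := P) \o sp_sec j in
  let f := sp_frameF (s := P) \o sp_sec j in
  dspinor psi p v
  + \sum_(a < n) \sum_(b < n | (a < b)%N)
      re_scale (connection_form gM DM e a b p v / 2)
        (clmul gn (delta_mx a 0) (clmul gn (delta_mx b 0) (psi p)))
  + \sum_(k < r) \sum_(l < r | (k < l)%N)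
      re_scale (connection_form gF DF f k l p v / 2)
        (tw_mul gr (delta_mx k 0) (delta_mx l 0) (psi p)).

Definition parallel (DM : covder M n) (DF : covder M r)
    (phi : P -> spinor R n r m) : Prop :=
  forall j p, sp_dom P j p -> forall v, nabla_theta DM DF phi j p v = 0.

(* eta_form^phi_kl at p = sp_proj u for the orthonormal frame f of the fibre of F at
   p, as a 2-form on T_p M; the frames of u turn vectors of T_p M and F_p into
   vectors of R^n and R^r. *)
Definition eta_form (phi : P -> spinor R n r m) (u : P) (f : 'M[R]_r)
    (k l : 'I_r) : 'M[R]_n :=
  let vM (a : 'I_n) : 'cV[R]_n := invmx (sp_frameM u) *m delta_mx a 0 in
  let vF (i : 'I_r) : 'cV[R]_r := invmx (sp_frameF u) *m col i f in
  \matrix_(a, b) complex.Re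
    (herm (wedge_mul gn (vM a) (vM b) (tw_mul gr (vF k) (vF l) (phi u)))
          (phi u)).

End SpinStructures.

(* Main.v *)
(** Fix a local section of the spin bundle; it turns a parallel spinor into a
    spinor-valued function psi with d psi = - A psi, where A is the connection
    form written with the matrices (1/4) sum w_ab g_a g_b of the Lie algebra
    of Spin(n) x Spin(r).  Since A is skew-Hermitian, |psi| is locally constant.
    Equality of the mixed second derivatives of psi in a chart says that the
    curvature annihilates psi:
      (1/4) sum_ab <R(X,Y) e_a, e_b> e_a e_b psi
        + (1/4) sum_kl Theta_kl(X,Y) kappa(f_k f_l) psi = 0.
    Take Y = e_y, multiply by e_y and sum over y.  The first Bianchi identity
    reduces the first term to - (1/2) Ric(X) psi, and the real part of the
    Hermitian product with e_z psi gives the decomposition of Ric; its second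
    form is the transpose of the first one, Ric being symmetric and the factors
    skew.  Both sides are invariant under Spin(n) x Spin(r) and under changes of
    the orthonormal frame of F, which gives the identity at every point of the
    spin bundle and for every frame. *)

Require Import Defs.
From HB Require Import structures.
From mathcomp Require Import all_boot all_order all_algebra.
From mathcomp Require Import all_classical all_reals all_analysis.
From mathcomp Require Import complex ring lra.

Set Implicit Arguments.
Unset Strict Implicit.
Unset Printing Implicit Defensive.

Import Order.TTheory GRing.Theory Num.Theory numFieldNormedType.Exports.

Local Open Scope classical_set_scope.
Local Open Scope ring_scope.

(** * Directional derivatives *)

(** Taking the real part is what isolates the Ricci tensor. On one side Re <e_a psi, e_z psi> is
    |psi|^2 if a = z and 0 otherwise. On the other side the twisting operator, the sum of Theta_kl
    kappa(f_k f_l), is skew-Hermitian, so its product with psi has real part 0; hence e_z e_y may be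
    replaced by the wedge of e_z and e_y, and eta^phi appears. A connection is given only as an
    operator on sections. Its curvature is therefore computed along the coordinate fields of one
    chart, which commute, and compared with [spin_mx], a Lie algebra morphism whose commutators
    reproduce the quadratic term of the structure equation. Tensoriality then carries the result to
    orthonormal frames. Most sums run over all ordered pairs of indices with factor 1/4, and not
    over a < b with factor 1/2: full sums can be reindexed freely and are invariant under orthogonal
    changes of frame. The two forms are exchanged only where the spinor connection enters and in the
    final formula. *)

Section Differentiation.
Variables (R : realType) (V : normedModType R).
Implicit Types (f g : V -> R) (U : set V).

(** The remainder for the zero differential vanishes identically near [x]. Locality of
    differentiability follows on writing [g = f + (g - f)]. *)
Lemma differentiable_near0 f x :
  {near x, f =1 cst 0} -> differentiable f x.
Proof.
move=> f0; have fo : f \o shift x = cst (f x) + \0 +o_ 0 id.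
  apply/eqaddoP => e e0; near=> y.
  have -> : (f \o shift x - (cst (f x) + \0)) y = 0.
    rewrite !fctE /= !(nbhs_singleton f0) /= addr0 subr0.
    near: y; have := f0; rewrite (near_shift 0) /= => h0.
    by apply: filterS h0 => z /=; rewrite subr0.
  by rewrite normr0 mulr_ge0 // ltW.
apply/diff_locallyP.
have c0 : continuous (\0 : V -> R) by move=> z; apply: cvg_cst.
by rewrite (@diff_unique _ _ _ f \0 x c0 fo).
Unshelve. all: by end_near. Qed.

Lemma near_eq_differentiable f g x :
  {near x, f =1 g} -> differentiable f x -> differentiable g x.
Proof.
move=> fg df; have -> : g = f + (g - f) by apply/funext => y; rewrite !fctE addrC subrK.
apply: differentiableD => //; apply: differentiable_near0.
by near=> y; rewrite !fctE (near fg y) // subrr.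
Unshelve. all: by end_near. Qed.

Lemma near_open U (Q : V -> Prop) x :
  open U -> U x -> (forall y, U y -> Q y) -> \forall y \near x, Q y.
Proof. by move=> oU Ux UQ; apply: filterS UQ _; apply: open_nbhs_nbhs. Qed.

Lemma MVT_line f x v (s : R) : 0 <= s ->
  (forall t, 0 <= t <= s -> differentiable f (x + t *: v)) ->
  exists2 t, 0 <= t <= s & f (x + s *: v) - f x = s * 'D_v f (x + t *: v).
Proof.
move=> s0 df; pose h t := f (x + t *: v).
pose l t : V := x + t *: v.
have dl t : is_diff t l ( *:%R ^~ v).
  rewrite -[X in is_diff_def _ _ X]add0r.
  exact: (is_diffD (is_diff_cst x t) (is_diff_scalel t v)).
have dh t : 0 <= t <= s -> is_derive t 1 h ('D_v f (x + t *: v)).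
  move=> ts; have dlt : differentiable l t by [].
  have dft := df _ ts.
  have dhl : differentiable (f \o l) t by apply: differentiable_comp.
  apply: DeriveDef; first exact: diff_derivable.
  by rewrite deriveE // diff_comp //= diff_val /= scale1r -deriveE.
have [||t] := @MVT_segment R h (fun t => 'D_v f (x + t *: v)) 0 s s0.
- by move=> t; rewrite in_itv /= => /andP[t0 ts]; apply: dh; rewrite !ltW.
- apply: continuous_in_subspaceT => t; rewrite inE /= in_itv /= => ts.
  by have [/derivable1_diffP/differentiable_continuous] := dh _ ts.
rewrite in_itv /= /h scale0r addr0 subr0 mulrC => ts ->.
by exists t.
Qed.

(** Segments issued from the centre stay inside the ball, so the mean value theorem along them
    applies. *)
Lemma derive_eq0_ball f x e : 0 < e ->
  (forall y, ball x e y -> differentiable f y) ->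
  (forall y v, ball x e y -> 'D_v f y = 0) -> forall y, ball x e y -> f y = f x.
Proof.
move=> e0 df f0 y xy.
have inb t : 0 <= t <= 1 -> ball x e (x + t *: (y - x)).
  move=> /andP[t0 t1]; move: xy; rewrite -!ball_normE /= opprD addNKr normrN normrZ distrC.
  by apply: le_lt_trans; rewrite ger0_norm // ler_piMl.
have [|t /inb tb] := @MVT_line f x (y - x) 1 ler01; first by move=> t /inb/df.
by rewrite scale1r subrKC f0 // mulr0 => /eqP; rewrite subr_eq0 => /eqP.
Qed.

(** With [h y = f (y + s *: w) - f y] the second difference is [h (x + s *: v) - h x]: use the mean
    value theorem for [h] along [v], then for ['D_v f] along [w]. *)
Lemma second_difference f x v w (s : R) : 0 <= s ->
  (forall t t', 0 <= t <= s -> 0 <= t' <= s ->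
     differentiable f (x + t *: v + t' *: w) /\
     differentiable ('D_v f) (x + t *: v + t' *: w)) ->
  exists t t', [/\ 0 <= t <= s, 0 <= t' <= s &
    f (x + s *: v + s *: w) - f (x + s *: v) - f (x + s *: w) + f x
      = s * (s * 'D_w ('D_v f) (x + t *: v + t' *: w))].
Proof.
move=> s0 df; have ss : 0 <= s <= s by apply/andP; split.
have z0 : 0 <= (0 : R) <= s by apply/andP; split.
pose h y := f (y + s *: w) - f y.
have hE : h = (f \o shift (s *: w)) - f by [].
have dsh y : is_diff y (shift (s *: w) : V -> V) id.
  rewrite -[X in is_diff_def _ _ X]addr0.
  exact: (is_diffD (is_diff_id y) (is_diff_cst (s *: w) y)).
have dd y : differentiable f (y + s *: w) -> differentiable f y ->
   differentiable h y /\ 'D_v h y = 'D_v f (y + s *: w) - 'D_v f y.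
  move=> d1 d2; have d3 : differentiable (f \o shift (s *: w)) y.
    by apply: differentiable_comp.
  split; first by rewrite hE; apply: differentiableB.
  rewrite hE deriveB; [|exact: diff_derivable..].
  by rewrite deriveE // diff_comp // diff_val /= -deriveE.
have dft t : 0 <= t <= s -> differentiable f (x + t *: v).
  by move=> ht; rewrite -[_ + _]addr0 -[0](scale0r w); apply: (df _ _ ht z0).1.
have [|t ts] := @MVT_line h x v s s0.
  by move=> t ts; apply: (dd _ (df _ _ ts ss).1 (dft _ ts)).1.
have [|t' ts'] := @MVT_line ('D_v f) (x + t *: v) w s s0.
  by move=> t' ts'; exact: (df _ _ ts ts').2.
rewrite (dd _ (df _ _ ts ss).1 (dft _ ts)).2 => -> hh; exists t, t'; split => //.
by rewrite -hh /h; ring.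
Qed.

Let dist_le (A B a b e : R) : `|A - a| < e / 2 -> `|B - b| < e / 2 -> a = b ->
  `|A - B| <= e.
Proof.
move=> h1 + e12; rewrite -e12 => h2; rewrite -(subrKA a) [e]splitr.
by apply: le_trans (ler_normD _ _) _; rewrite [`|a - B|]distrC; apply: lerD; apply: ltW.
Qed.

Let eq_of_scaled (s a b X Y Z W : R) : 0 < s -> X - Y - Z + W = s * (s * a) ->
  X - Z - Y + W = s * (s * b) -> a = b.
Proof.
move=> s0 e1 e2; have s00 := lt0r_neq0 s0.
by apply: (mulfI s00); apply: (mulfI s00); rewrite -e1 -e2 addrAC; ring.
Qed.

(** Schwarz's theorem. The second difference is symmetric in [v] and [w], so one mixed derivative at
    some point near [x] equals the other one at another such point; continuity at [x] concludes. *)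
Lemma derive_comm U f v w x : open U -> U x ->
  (forall y, U y -> differentiable f y) ->
  (forall y, U y -> differentiable ('D_v f) y) ->
  (forall y, U y -> differentiable ('D_w f) y) ->
  {for x, continuous ('D_w ('D_v f))} -> {for x, continuous ('D_v ('D_w f))} ->
  'D_w ('D_v f) x = 'D_v ('D_w f) x.
Proof.
move=> oU Ux df dv dw cvw cwv; apply/eqP; rewrite -subr_eq0 -normr_le0.
apply/ler_addgt0Pl => e e0; rewrite addr0.
have e20 : 0 < e / 2 by rewrite divr_gt0.
have /nbhs_ballP[d d0 hd] : \forall y \near x, [/\ U y,
     `|'D_w ('D_v f) x - 'D_w ('D_v f) y| < e / 2 &
     `|'D_v ('D_w f) x - 'D_v ('D_w f) y| < e / 2].
  have hU : \forall y \near x, U y by exact: open_nbhs_nbhs.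
  move/cvgrPdist_lt: cvw => /(_ _ e20) h1; move/cvgrPdist_lt: cwv => /(_ _ e20) h2.
  near=> y; split.
  - exact: (near hU y).
  - exact: (near h1 y).
  - exact: (near h2 y).
(* The summand 1 keeps [N] positive when [v] and [w] vanish; [s * N < d] confines the whole
   parallelogram to the ball. *)
pose N := `|v| + `|w| + 1.
have N0 : 0 < N by rewrite ltr_wpDl // addr_ge0.
have [s s0 sN] : exists2 s, 0 < s & s * N < d.
  exists (d / 2 / N); first by rewrite !divr_gt0.
  by rewrite divfK ?gt_eqF // gtr_pMr // invf_lt1 // ltr1n.
have inb t t' : 0 <= t <= s -> 0 <= t' <= s -> ball x d (x + t *: v + t' *: w).
  move=> /andP[t0 ts] /andP[t0' ts'].
  rewrite -ball_normE /= -addrA opprD addNKr normrN.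
  apply: le_lt_trans (ler_normD _ _) _; rewrite !normrZ !ger0_norm //.
  apply: le_lt_trans sN.
  rewrite /N !mulrDr mulr1; apply: ler_wpDr; first exact: ltW.
  by apply: lerD; apply: ler_wpM2r.
have [|t [t' [ht ht' e1]]] := @second_difference f x v w s (ltW s0).
  move=> t t' ht ht'; have [Uy _ _] := hd _ (inb _ _ ht ht').
  by split; [apply: df|apply: dv].
have [|u [u' [hu hu' e2]]] := @second_difference f x w v s (ltW s0).
  move=> u u' hu hu'; have := inb _ _ hu' hu; rewrite addrAC => /hd[Uy _ _].
  by split; [apply: df|apply: dw].
rewrite [x + s *: w + s *: v]addrAC in e2.
have [_ h1 _] := hd _ (inb _ _ ht ht').
have := inb _ _ hu' hu; rewrite addrAC => /hd[_ _ h2].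
exact: (dist_le h1 h2 (eq_of_scaled s0 e1 e2)).
Unshelve. all: by end_near. Qed.

End Differentiation.

Lemma near_eq_continuous (V W : topologicalType) (f g : V -> W) x :
  {near x, f =1 g} -> {for x, continuous f} -> {for x, continuous g}.
Proof.
move=> fg cf A; rewrite -(nbhs_singleton fg) => /cf; apply: filterS2 fg.
by move=> y /= ->.
Qed.

(** * Functions of class C^k and their composition *)

Section ContinuouslyDifferentiable.
Variables (R : realType) (n : nat).
Implicit Types (f g : 'cV[R]_n -> R) (U V : set 'cV[R]_n).

Lemma Ck_sub k U V f : U `<=` V -> Ck k V f -> Ck k U f.
Proof.
elim: k f => [|k IH] f UV /=; first by move=> hf x /UV/hf.
by case=> df hf; split => [x /UV/df //|v]; apply: IH.
Qed.

(** Every clause of [Ck] is a condition at a single point, the derivatives being those of the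
    function on the whole space; so a cover by arbitrary sets is enough. *)
Lemma Ck_local k U f : (forall x, U x -> exists2 V, V x & Ck k V f) -> Ck k U f.
Proof.
elim: k f => [|k IH] f /= hf; first by move=> x /hf[V Vx]; apply.
split => [x /hf[V Vx [df _]]|v]; first exact: df.
by apply: IH => x /hf[V Vx [_ hV]]; exists V.
Qed.

Lemma Ck_ext k U f g : open U -> (forall x, U x -> f x = g x) -> Ck k U f -> Ck k U g.
Proof.
move=> oU; elim: k f g => [|k IH] f g fg /=.
  move=> hf x Ux; have fgx : {near x, f =1 g} by exact: near_open oU Ux fg.
  exact: near_eq_continuous fgx (hf x Ux).
case=> df hf; split => [x Ux|v].
  exact: near_eq_differentiable (near_open oU Ux fg) (df x Ux).
apply: IH (hf v) => x Ux; apply: near_eq_derive; exact: near_open oU Ux fg.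
Qed.

Lemma Ck_pred k U f : Ck k.+1 U f -> Ck k U f.
Proof.
elim: k f => [|k IH] f /= [df hf].
  by move=> x /df; apply: differentiable_continuous.
by split => // v; apply: IH.
Qed.

Lemma Ck_cst k U (a : R) : open U -> Ck k U (cst a).
Proof.
move=> oU; elim: k a => [|k IH] a /=; first by move=> x _; apply: cst_continuous.
split => [x _|v]; first exact: differentiable_cst.
by apply: Ck_ext (IH 0) => // x _; rewrite derive_cst.
Qed.

Lemma CkD k U f g : open U -> Ck k U f -> Ck k U g -> Ck k U (f + g).
Proof.
move=> oU; elim: k f g => [|k IH] f g /=.
  by move=> hf hg x Ux; apply: continuousD; [apply: hf|apply: hg].
case=> df hf [dg hg]; split => [x Ux|v].
  by apply: differentiableD; [apply: df|apply: dg].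
apply: Ck_ext (IH _ _ (hf v) (hg v)) => // x Ux.
by rewrite deriveD //; apply: diff_derivable; [apply: df|apply: dg].
Qed.

Lemma CkM k U f g : open U -> Ck k U f -> Ck k U g -> Ck k U (f * g).
Proof.
move=> oU; elim: k f g => [|k IH] f g.
  by move=> hf hg x Ux; apply: continuousM; [apply: hf|apply: hg].
move=> hf hg; split => [x Ux|v].
  by apply: differentiableM; [apply: hf.1|apply: hg.1].
have := CkD oU (IH _ _ (Ck_pred hf) (hg.2 v)) (IH _ _ (Ck_pred hg) (hf.2 v)).
apply: Ck_ext => // x Ux.
by rewrite deriveM //; apply: diff_derivable; [apply: hf.1|apply: hg.1].
Qed.

Lemma Ck_sum k U (I : Type) (s : seq I) (F : I -> 'cV[R]_n -> R) : open U ->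
  (forall i, Ck k U (F i)) -> Ck k U (fun x => \sum_(i <- s) F i x).
Proof.
move=> oU hF; elim: s => [|i s IH].
  by apply: Ck_ext (Ck_cst _ 0 oU) => // x _; rewrite big_nil.
by apply: Ck_ext (CkD oU (hF i) IH) => // x _; rewrite big_cons.
Qed.

Lemma derive_partial f x v : differentiable f x ->
  'D_v f x = \sum_a v a 0 * partial f a x.
Proof.
move=> df; rewrite deriveE // {1}[v]matrix_sum_delta linear_sum /=.
apply: eq_bigr => a _; rewrite big_ord1 linearZ /= /partial deriveE //.
Qed.

End ContinuouslyDifferentiable.

Section Composition.
Variables (R : realType) (n m : nat).
Implicit Types T : 'cV[R]_n -> 'cV[R]_m.

Lemma differentiable_cV T x : (forall a, differentiable (fun y => T y a 0) x) ->
  differentiable T x.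
Proof.
move=> dT; have -> : T = \sum_a (fun y => T y a 0 *: delta_mx a 0).
  apply/funext => y; rewrite fct_sumE {1}[T y]matrix_sum_delta.
  by apply: eq_bigr => a _; rewrite big_ord1.
by apply: differentiable_sum => a; apply: differentiableZl.
Qed.

Lemma derive_cV T x v a : differentiable T x -> 'D_v T x a 0 = 'D_v (fun y => T y a 0) x.
Proof. by move=> dT; rewrite derive_mx ?mxE //; apply: diff_derivable. Qed.

Lemma derive_comp T (f : 'cV[R]_m -> R) x v :
  (forall a, differentiable (fun y => T y a 0) x) -> differentiable f (T x) ->
  'D_v (f \o T) x = \sum_a 'D_v (fun y => T y a 0) x * partial f a (T x).
Proof.
move=> dTa df; have dT := differentiable_cV dTa.
rewrite deriveE; last exact: differentiable_comp.
rewrite diff_comp //= -(deriveE v dT) -(deriveE _ df) (derive_partial _ df).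
by apply: eq_bigr => a _; rewrite derive_cV.
Qed.

End Composition.

(** Induction on [k] through the chain rule: the derivative is a sum of products of a derivative of
    a component of [T] and of [partial f a \o T], to which the induction hypothesis applies. *)
Lemma Ck_comp (R : realType) (n m k : nat) (U : set 'cV[R]_n) (V : set 'cV[R]_m)
    (T : 'cV[R]_n -> 'cV[R]_m) (f : 'cV[R]_m -> R) :
  open U -> (forall x, U x -> V (T x)) -> (forall a, Ck k U (fun y => T y a 0)) ->
  Ck k V f -> Ck k U (f \o T).
Proof.
move=> oU UV; elim: k f => [|k IH] f hT.
  move=> hf x Ux; suff cT : {for x, continuous T}.
    exact: (continuous_comp cT (hf _ (UV _ Ux))).
  move=> A /= /nbhs_ballP[e e0 eA].
  have : \forall y \near x, forall a, ball (T x a 0) e (T y a 0).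
    have hh a : \forall y \near x, ball (T x a 0) e (T y a 0) by apply: (hT a x Ux); apply: nbhsx_ballx.
    exact: (@filter_forall _ _ (fun a y => ball (T x a 0) e (T y a 0)) (nbhs x) _ hh).
  apply: filterS => y hy; apply: eA; split => // i j; rewrite ord1; exact: hy.
move=> hf; split => [x Ux|v].
  apply: differentiable_comp; last exact: hf.1 (UV _ Ux).
  by apply: differentiable_cV => a; apply: (hT a).1.
have hs : Ck k U (fun x => \sum_a 'D_v (fun y => T y a 0) x * partial f a (T x)).
  apply: Ck_sum => // a; apply: CkM => //; first exact: (hT a).2.
  by apply: IH; [move=> b; apply: Ck_pred|apply: hf.2].
apply: Ck_ext hs => // x Ux; rewrite derive_comp //; last exact: hf.1 (UV _ Ux).
by move=> a; apply: (hT a).1.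
Qed.

Section SmoothOn.
Variables (R : realType) (n : nat) (U : set 'cV[R]_n).
Implicit Types f g : 'cV[R]_n -> R.

Lemma smooth_on_differentiable f x : smooth_on U f -> U x -> differentiable f x.
Proof. by move=> hf Ux; apply: (hf 1%N).1. Qed.

Lemma smooth_on_derive f v : smooth_on U f -> smooth_on U ('D_v f).
Proof. by move=> hf k; exact: (hf k.+1).2. Qed.

Lemma smooth_on_derive_comm f v w x : open U -> smooth_on U f -> U x ->
  'D_w ('D_v f) x = 'D_v ('D_w f) x.
Proof.
move=> oU hf Ux; have hd u := smooth_on_derive u hf.
apply: (derive_comm oU Ux).
- by move=> y; apply: smooth_on_differentiable hf.
- by move=> y; apply: smooth_on_differentiable (hd v).
- by move=> y; apply: smooth_on_differentiable (hd w).
- exact: (smooth_on_derive w (hd v) 0 x Ux).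
- exact: (smooth_on_derive v (hd w) 0 x Ux).
Qed.

End SmoothOn.

(** * Calculus on manifolds *)

Section SmoothFunctions.
Variables (R : realType) (n : nat) (M : manifold R n).
Implicit Types (f g : M -> R) (U V : set M) (c d e : chart M) (p q : M).

Lemma cparamP c x : (ccoord c @` cdom c) x ->
  cdom c (cparam c x) /\ ccoord c (cparam c x) = x.
Proof. by case=> p cp <-; rewrite coordK. Qed.

Lemma chart_imageP U c x : (ccoord c @` (U `&` cdom c)) x ->
  [/\ U (cparam c x), cdom c (cparam c x) & ccoord c (cparam c x) = x].
Proof. by case=> p [Up cp] <-; rewrite coordK. Qed.

Lemma chart_image U c p : U p -> cdom c p -> (ccoord c @` (U `&` cdom c)) (ccoord c p).
Proof. by move=> Up cp; exists p. Qed.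

Lemma open_chart_image U c : open U -> open (ccoord c @` (U `&` cdom c)).
Proof.
move=> oU; rewrite openE => x /chart_imageP[Ux cx xE].
have Ix : (ccoord c @` cdom c) x by exists (cparam c x).
have nI : nbhs x (ccoord c @` cdom c) by apply: open_nbhs_nbhs; split => //; apply: coord_open.
have nU : nbhs x (cparam c @^-1` U).
  by apply: (param_continuous Ix); apply: open_nbhs_nbhs.
apply: filterS (filterI nI nU) => y [/cparamP[cy yE] Uy].
by rewrite -yE; apply: chart_image.
Qed.

Lemma smooth_fun_ext U f g : open U -> (forall p, U p -> f p = g p) ->
  smooth_fun U f -> smooth_fun U g.
Proof.
move=> oU fg hf c k; apply: Ck_ext (hf c k); first exact: open_chart_image.
by move=> x /chart_imageP[Ux _ _]; apply: fg.
Qed.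

Lemma smooth_fun_sub U V f : U `<=` V -> smooth_fun V f -> smooth_fun U f.
Proof.
move=> UV hf c k; apply: Ck_sub (hf c k) => x /chart_imageP[Ux cx <-].
by apply: chart_image => //; apply: UV.
Qed.

Lemma smooth_fun_local U f :
  (forall p, U p -> exists2 V, V p & smooth_fun V f) -> smooth_fun U f.
Proof.
move=> hf c k; apply: Ck_local => x /chart_imageP[Ux cx <-].
have [V Vx hV] := hf _ Ux.
by exists (ccoord c @` (V `&` cdom c)); [apply: chart_image|apply: hV].
Qed.

Lemma smooth_fun_cst U (a : R) : open U -> smooth_fun U (fun=> a).
Proof. by move=> oU c k; apply: Ck_cst; apply: open_chart_image. Qed.

Lemma smooth_funD U f g : open U -> smooth_fun U f -> smooth_fun U g ->
  smooth_fun U (fun p => f p + g p).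
Proof.
move=> oU hf hg c k; have oc := @open_chart_image _ c oU.
exact: (CkD oc (hf c k) (hg c k)).
Qed.

Lemma smooth_funM U f g : open U -> smooth_fun U f -> smooth_fun U g ->
  smooth_fun U (fun p => f p * g p).
Proof.
move=> oU hf hg c k; have oc := @open_chart_image _ c oU.
exact: (CkM oc (hf c k) (hg c k)).
Qed.

Lemma smooth_funN U f : open U -> smooth_fun U f -> smooth_fun U (fun p => - f p).
Proof.
move=> oU hf; have := smooth_funM oU (smooth_fun_cst (-1) oU) hf.
by apply: smooth_fun_ext => // p _; rewrite mulN1r.
Qed.

Lemma smooth_fun_sum U (I : Type) (s : seq I) (F : I -> M -> R) : open U ->
  (forall i, smooth_fun U (F i)) -> smooth_fun U (fun p => \sum_(i <- s) F i p).
Proof.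
move=> oU hF c k; have oc := @open_chart_image _ c oU.
exact: (Ck_sum s oc (fun i => hF i c k)).
Qed.

Lemma smooth_fun_differentiable U f c p : smooth_fun U f -> U p -> cdom c p ->
  differentiable (f \o cparam c) (ccoord c p).
Proof. by move=> hf Up cp; apply: smooth_on_differentiable (hf c) (chart_image Up cp). Qed.

Lemma coord_smooth c a : smooth_fun (cdom c) (fun p => ccoord c p a 0).
Proof. by move=> d; rewrite setIC; apply: transition_smooth. Qed.

Lemma partial_ext c f g U i p : open U -> U p -> cdom c p -> (forall q, U q -> f q = g q) ->
  partial (f \o cparam c) i (ccoord c p) = partial (g \o cparam c) i (ccoord c p).
Proof.
move=> oU Up cp fg; apply: near_eq_derive.
apply: near_open (@open_chart_image _ c oU) (chart_image Up cp) _ => x /chart_imageP[Ux _ _].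
exact: fg.
Qed.

(** Near the point [f \o cparam c] factors through the chart [d] by the transition map, whose
    differential is [jac c d p]. *)
Lemma partial_chain U f c d p b : open U -> smooth_fun U f -> U p -> cdom c p -> cdom d p ->
  partial (f \o cparam c) b (ccoord c p) =
  \sum_a partial (f \o cparam d) a (ccoord d p) * jac c d p a b.
Proof.
move=> oU hf Up cp dp; pose T x := ccoord d (cparam c x).
have oW : open (U `&` cdom d) by apply: openI => //; apply: cdom_open.
have -> : partial (f \o cparam c) b (ccoord c p) =
          partial ((f \o cparam d) \o T) b (ccoord c p).
  apply: near_eq_derive.
  apply: near_open (@open_chart_image _ c oW) (chart_image (conj Up dp) cp) _.
  by move=> x /chart_imageP[[_ dx] _ _]; rewrite /T /= coordK.
rewrite /partial derive_comp.
- by apply: eq_bigr => a _; rewrite mxE /T coordK // mulrC.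
- by move=> a; exact: (smooth_fun_differentiable (@coord_smooth d a) dp cp).
- by rewrite /T coordK //; exact: (smooth_fun_differentiable hf Up dp).
Qed.

Lemma jacM c d e p : cdom c p -> cdom d p -> cdom e p ->
  jac c e p = jac d e p *m jac c d p.
Proof.
move=> cp dp ep; apply/matrixP => a b; rewrite !mxE.
have := partial_chain b (@cdom_open _ _ _ e) (@coord_smooth e a) ep cp dp.
by rewrite /comp => ->; apply: eq_bigr => i _; rewrite !mxE.
Qed.

Lemma jac_id c p : cdom c p -> jac c c p = 1%:M.
Proof.
move=> cp; apply/matrixP => a b; rewrite !mxE.
have -> : partial (fun x => ccoord c (cparam c x) a 0) b (ccoord c p) =
          partial (fun x : 'cV[R]_n => x a 0) b (ccoord c p).
  apply: near_eq_derive.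
  have oI := @coord_open _ _ M c.
  have Ip : (ccoord c @` cdom c) (ccoord c p) by exists p.
  by apply: near_open oI Ip _ => x /cparamP[_ ->].
have [did _] := is_diff_id (ccoord c p).
rewrite /partial -(@derive_cV _ _ _ id) //.
by rewrite derive_id mxE eqxx andbT eq_sym.
Qed.

Lemma jac_unit c d p : cdom c p -> cdom d p -> jac c d p \in unitmx.
Proof.
move=> cp dp; rewrite unitmxE unitfE; apply: lt0r_neq0.
exact: (transition_oriented cp dp).
Qed.

Lemma invmx_jac c d p : cdom c p -> cdom d p -> invmx (jac c d p) = jac d c p.
Proof.
move=> cp dp; rewrite -[RHS](mulmxK (jac_unit cp dp)) -jacM // jac_id // mul1mx //.
Qed.

(** Indexed by the points of [M] and not by those of the chart image, so that it is again a function
    on [M] and can be iterated. *)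
Definition coord_der c i f p : R := partial (f \o cparam c) i (ccoord c p).

(** Column [i] of this Jacobian is the i-th coordinate vector of [c] read in the preferred chart,
    which identifies the tangent space with R^n. *)
Lemma dirder_jac U f c i p : open U -> smooth_fun U f -> U p -> cdom c p ->
  dirder f p (col i (jac c (chart_at p) p)) = coord_der c i f p.
Proof.
move=> oU hf Up cp; rewrite /coord_der.
rewrite (partial_chain i oU hf Up cp (chart_at_dom p)).
by rewrite /dirder mxE; apply: eq_bigr => a _; rewrite !mxE.
Qed.

Lemma smooth_pullback U c (g : 'cV[R]_n -> R) : open U ->
  smooth_on (ccoord c @` (U `&` cdom c)) g ->
  smooth_fun (U `&` cdom c) (g \o ccoord c).
Proof.
move=> oU hg d k.
have oW : open (U `&` cdom c) by apply: openI => //; apply: cdom_open.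
apply: (@Ck_comp _ _ _ k _ _ (fun x => ccoord c (cparam d x)) _
          (@open_chart_image _ d oW) _ _ (hg k)).
  by move=> x /chart_imageP[[Ux cx] _ _]; apply: chart_image.
move=> a; apply: Ck_sub (@coord_smooth c a d k) => x /chart_imageP[[Ux cx] dx <-].
exact: chart_image.
Qed.

Lemma coord_der_smooth U c i f : open U -> smooth_fun U f ->
  smooth_fun (U `&` cdom c) (coord_der c i f).
Proof. by move=> oU hf; apply: smooth_pullback => //; apply: smooth_on_derive. Qed.

(** Schwarz's theorem moved to [M]: on the chart image [coord_der c l f \o cparam c] is an ordinary
    partial derivative. *)
Lemma coord_der_comm U c i j f p : open U -> smooth_fun U f -> U p -> cdom c p ->
  coord_der c i (coord_der c j f) p = coord_der c j (coord_der c i f) p.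
Proof.
move=> oU hf Up cp.
have F k l : coord_der c k (coord_der c l f) p =
    partial (partial (f \o cparam c) l) k (ccoord c p).
  apply: near_eq_derive.
  apply: near_open (@open_chart_image _ c oU) (chart_image Up cp) _.
  by move=> x /chart_imageP[_ _ xE]; rewrite /coord_der /= xE.
rewrite !F; exact: (smooth_on_derive_comm _ _ (@open_chart_image _ c oU) (hf c) (chart_image Up cp)).
Qed.

End SmoothFunctions.

Section CoordinateDerivatives.
Variables (R : realType) (n : nat) (M : manifold R n) (c : chart M).
Variables (U : set M) (oU : open U).
Implicit Types (f g : M -> R) (p : M) (i : 'I_n).

Lemma coord_der_ext f g i p : U p -> cdom c p -> (forall q, U q -> f q = g q) ->
  coord_der c i f p = coord_der c i g p.
Proof. by move=> Up cp fg; apply: partial_ext fg. Qed.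

Lemma coord_der_cst a i p : coord_der c i (fun=> a) p = 0.
Proof. exact: derive_cst. Qed.

Lemma coord_derD f g i p : U p -> cdom c p -> smooth_fun U f -> smooth_fun U g ->
  coord_der c i (fun q => f q + g q) p = coord_der c i f p + coord_der c i g p.
Proof.
move=> Up cp hf hg; have df := smooth_fun_differentiable hf Up cp.
have dg := smooth_fun_differentiable hg Up cp.
exact: (deriveD (diff_derivable df) (diff_derivable dg)).
Qed.

Lemma coord_derN f i p : U p -> cdom c p -> smooth_fun U f ->
  coord_der c i (fun q => - f q) p = - coord_der c i f p.
Proof.
by move=> Up cp hf; apply: deriveN (diff_derivable (smooth_fun_differentiable hf Up cp)).
Qed.

Lemma coord_derM f g i p : U p -> cdom c p -> smooth_fun U f -> smooth_fun U g ->
  coord_der c i (fun q => f q * g q) p =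
  f p * coord_der c i g p + g p * coord_der c i f p.
Proof.
move=> Up cp hf hg; have df := smooth_fun_differentiable hf Up cp.
have dg := smooth_fun_differentiable hg Up cp.
have := deriveM (diff_derivable df) (diff_derivable dg).
by rewrite /coord_der /partial => ->; rewrite /= coordK.
Qed.

Lemma coord_der_sum (I : Type) (s : seq I) (F : I -> M -> R) i p : U p -> cdom c p ->
  (forall j, smooth_fun U (F j)) ->
  coord_der c i (fun q => \sum_(j <- s) F j q) p = \sum_(j <- s) coord_der c i (F j) p.
Proof.
move=> Up cp hF; elim: s => [|j s IH].
  rewrite big_nil; apply: etrans (coord_der_cst 0 i p).
  by apply: coord_der_ext => // q _; rewrite big_nil.
rewrite big_cons -IH -coord_derD //; last exact: smooth_fun_sum.
by apply: coord_der_ext => // q _; rewrite big_cons.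
Qed.

End CoordinateDerivatives.

Section CoordinateFields.
Variables (R : realType) (n : nat) (M : manifold R n) (p0 : M).
Let c := chart_at p0.
Implicit Types (f : M -> R) (U : set M).

Lemma coord_field_at i : coord_field p0 i p0 = delta_mx i 0.
Proof.
rewrite /coord_field /= jac_id; last exact: chart_at_dom.
by apply/matrixP => a b; rewrite !mxE ord1 eqxx andbT.
Qed.

Lemma dirder_coord_field U f i q : open U -> smooth_fun U f -> U q -> cdom c q ->
  dirder f q (coord_field p0 i q) = coord_der c i f q.
Proof. by move=> oU hf Uq cq; apply: dirder_jac hf Uq cq. Qed.

Lemma coord_field_tangent d i q : cdom c q -> cdom d q ->
  invmx (jac d (chart_at q) q) *m coord_field p0 i q = col i (jac c d q).
Proof.
move=> cq dq; have qq := chart_at_dom q.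
by rewrite invmx_jac // /coord_field /= !colE mulmxA -jacM.
Qed.

Lemma coord_field_smooth U i : open U -> U `<=` cdom c ->
  smooth_sec (tangent M) U (coord_field p0 i).
Proof.
move=> oU Uc d a /=; have oW := openI oU (@cdom_open _ _ M d).
have := @coord_der_smooth _ _ M _ c i _ (@cdom_open _ _ M d) (coord_smooth d a).
have sub : U `&` cdom d `<=` cdom d `&` cdom c by move=> q [/Uc].
move=> /(smooth_fun_sub sub); apply: smooth_fun_ext => // q [Uq dq].
by rewrite coord_field_tangent //; last exact: Uc; rewrite !mxE.
Qed.

(** In another chart [d] the components of these fields are derivatives along [c] of the coordinates
    of [d], so each component of the bracket is a difference of two mixed second derivatives. *)
Lemma lie_bracket_coord_fields i j q : cdom c q ->
  lie_bracket (coord_field p0 i) (coord_field p0 j) q = 0.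
Proof.
move=> cq; apply/matrixP => a b; rewrite !mxE /=.
pose d := chart_at q; have dq : cdom d q := chart_at_dom q.
have oc := @cdom_open _ _ M c; have od := @cdom_open _ _ M d.
have oW : open (cdom d `&` cdom c) by apply: openI.
have Wq : (cdom d `&` cdom c) q by [].
pose x q := ccoord d q a 0.
have E k l : dirder (fun q0 =>
     (invmx (jac d (chart_at q0) q0) *m coord_field p0 k q0) a 0) q (coord_field p0 l q)
     = coord_der c l (coord_der c k x) q.
  have hs := @coord_der_smooth _ _ M _ c k _ od (coord_smooth d a).
  rewrite -(dirder_coord_field l oW hs Wq cq) /dirder; congr ((_ *m _) 0 0).
  apply/rowP => e; rewrite !mxE; apply: (partial_ext _ oW) => // q' [dq' cq'].
  by rewrite coord_field_tangent // !mxE.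
rewrite !E (coord_der_comm j i od (coord_smooth d a)) // subrr //.
Qed.

End CoordinateFields.

(** * Vector bundles *)

Section Sections.
Variables (R : realType) (n : nat) (M : manifold R n) (k : nat) (E : vbundle M k).
Implicit Types (U W : set M) (s t : M -> 'cV[R]_k) (f : M -> R).

(** The common ground of [tangent M] and [F]: invertible local frames, in which a section is
    determined by its components. *)
Definition framed_bundle : Prop :=
  [/\ forall j, open (vdom E j), forall p, exists j, vdom E j p
    & forall j p, vdom E j p -> vframe E j p \in unitmx].

Hypothesis hE : framed_bundle.
Variables (g : M -> 'M[R]_k) (hg : bundle_metric E g).

Lemma smooth_sec_sub U W s : U `<=` W -> smooth_sec E W s -> smooth_sec E U s.
Proof.
move=> UW hs j a; apply: smooth_fun_sub (hs j a) => q [Uq jq]; split => //; exact: UW.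
Qed.

Lemma smooth_secD U s t : open U -> smooth_sec E U s -> smooth_sec E U t ->
  smooth_sec E U (fun q => s q + t q).
Proof.
move=> oU hs ht j a; have oW : open (U `&` vdom E j) by apply: openI => //; case: hE.
apply: smooth_fun_ext (smooth_funD oW (hs j a) (ht j a)) => // q _.
by rewrite mulmxDr [RHS]mxE.
Qed.

Lemma smooth_secZ U f s : open U -> smooth_fun U f -> smooth_sec E U s ->
  smooth_sec E U (fun q => f q *: s q).
Proof.
move=> oU hf hs j a; have oW : open (U `&` vdom E j) by apply: openI => //; case: hE.
have hf' : smooth_fun (U `&` vdom E j) f by apply: smooth_fun_sub hf => q [].
apply: smooth_fun_ext (smooth_funM oW hf' (hs j a)) => // q _.
by rewrite -scalemxAr [RHS]mxE.
Qed.

Lemma smooth_sec0 U : open U -> smooth_sec E U (fun=> 0).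
Proof.
move=> oU j a; have oW : open (U `&` vdom E j) by apply: openI => //; case: hE.
by apply: smooth_fun_ext (smooth_fun_cst 0 oW) => // q _; rewrite mulmx0 mxE.
Qed.

Lemma smooth_sec_sum U (I : Type) (r : seq I) (F : I -> M -> 'cV[R]_k) : open U ->
  (forall i, smooth_sec E U (F i)) -> smooth_sec E U (fun q => \sum_(i <- r) F i q).
Proof.
move=> oU hF; elim: r => [|i r IH] j a; have oW : open (U `&` vdom E j).
- by apply: openI => //; case: hE.
- by apply: smooth_fun_ext (smooth_sec0 oU j a) => // q _; rewrite big_nil.
- by apply: openI => //; case: hE.
- by apply: smooth_fun_ext (smooth_secD oU (hF i) IH j a) => // q _; rewrite big_cons.
Qed.

Lemma inner_smooth U s t : open U -> smooth_sec E U s -> smooth_sec E U t ->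
  smooth_fun U (fun q => inner g q (s q) (t q)).
Proof.
move=> oU hs ht; apply: smooth_fun_local => p Up.
case: hE => [oE covE invE]; have [j jp] := covE p.
have oW : open (U `&` vdom E j) by apply: openI.
exists (U `&` vdom E j) => //.
pose V q := vframe E j q.
have : smooth_fun (U `&` vdom E j) (fun q => \sum_b (\sum_a
   (invmx (V q) *m s q) a 0 * ((V q)^T *m g q *m V q) a b) * (invmx (V q) *m t q) b 0).
  apply: smooth_fun_sum => // b; apply: smooth_funM => //.
  apply: smooth_fun_sum => // a; apply: smooth_funM => //.
  by case: hg => _ _ /(_ j a b); apply: smooth_fun_sub => q [].
apply: smooth_fun_ext => // q [_ jq]; have uV := invE _ _ jq.
have -> : inner g q (s q) (t q) =
   ((invmx (V q) *m s q)^T *m ((V q)^T *m g q *m V q) *m (invmx (V q) *m t q)) 0 0.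
  rewrite /inner trmx_mul !mulmxA trmx_inv; congr ((_ *m _) 0 0).
  by rewrite mulmxK // mulmxKV // unitmx_tr.
rewrite mxE; apply: eq_bigr => b _; rewrite [(_ *m (_ *m g q *m V q)) 0 b]mxE; congr (_ * _).
by apply: eq_bigr => a _; rewrite [(_^T) 0 a]mxE.
Qed.

Lemma innerDl q v w x : inner g q (v + w) x = inner g q v x + inner g q w x.
Proof. by rewrite /inner linearD /= !mulmxDl mxE. Qed.

Lemma innerZl q a v w : inner g q (a *: v) w = a * inner g q v w.
Proof. by rewrite /inner linearZ /= -!scalemxAl mxE. Qed.

Lemma innerZr q a v w : inner g q v (a *: w) = a * inner g q v w.
Proof. by rewrite /inner -scalemxAr mxE. Qed.

Lemma innerBl q v w x : inner g q (v - w) x = inner g q v x - inner g q w x.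
Proof. by rewrite innerDl -[- w]scaleN1r innerZl mulN1r. Qed.

Lemma inner_sumr q v (I : Type) (r : seq I) (F : I -> 'cV[R]_k) :
  inner g q v (\sum_(i <- r) F i) = \sum_(i <- r) inner g q v (F i).
Proof. by rewrite /inner mulmx_sumr summxE. Qed.

Lemma innerC q v w : inner g q v w = inner g q w v.
Proof.
case: hg => sg _ _; rewrite /inner -{2}(sg q).
have -> : w^T *m (g q)^T *m v = (v^T *m g q *m w)^T by rewrite !trmx_mul trmxK mulmxA.
by rewrite [RHS]mxE.
Qed.

Lemma inner_suml q w (I : Type) (r : seq I) (F : I -> 'cV[R]_k) :
  inner g q (\sum_(i <- r) F i) w = \sum_(i <- r) inner g q (F i) w.
Proof. by rewrite innerC inner_sumr; apply: eq_bigr => i _; rewrite innerC. Qed.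

Section Frame.
Variables (W : set M) (oW : open W) (e : M -> 'M[R]_k).
Hypothesis he : orthonormal_frame E g W e.

Lemma frame_inner q a b : W q -> inner g q (col a (e q)) (col b (e q)) = (a == b)%:R.
Proof.
case: he => _ ge Wq; rewrite /inner tr_col (colE b) mulmxA -!row_mul ge //.
by rewrite -colE !mxE.
Qed.

(** For square matrices [e^T g e = 1] gives [e e^T g = 1], and the latter is the expansion
    formula. *)
Lemma frame_coordinates q v : W q ->
  v = \sum_b inner g q v (col b (e q)) *: col b (e q).
Proof.
case: he => _ ge Wq; have := mulmx1C (ge _ Wq); rewrite mulmxA => eg.
rewrite -{1}[v]mul1mx -eg -!mulmxA.
apply/matrixP => i j; rewrite mxE summxE; apply: eq_bigr => b _.
rewrite [RHS]mxE [col b _ i j]mxE mulrC; congr (_ * _).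
by rewrite innerC /inner tr_col ord1 -mulmxA -row_mul [RHS]mxE.
Qed.

End Frame.

Lemma frame_sub U W e : U `<=` W -> orthonormal_frame E g W e -> orthonormal_frame E g U e.
Proof.
move=> UW [he ge]; split => [i|p /UW/ge //].
exact: smooth_sec_sub UW (he i).
Qed.

End Sections.

Lemma framed_tangent (R : realType) (n : nat) (M : manifold R n) :
  framed_bundle (tangent M).
Proof.
split; first exact: cdom_open.
- by move=> p; exists (chart_at p); apply: chart_at_dom.
- by move=> j p jp; apply: jac_unit => //; apply: chart_at_dom.
Qed.

Lemma framed_oriented (R : realType) (n : nat) (M : manifold R n) k (E : vbundle M k) :
  oriented_bundle E -> framed_bundle E.
Proof.
by case=> oE cE dE _; split => // j p jp; rewrite unitmxE unitfE gt_eqF // dE.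
Qed.

(** * Connections in coordinates *)

Section CoordinateConnection.
Variables (R : realType) (n : nat) (M : manifold R n) (k : nat) (E : vbundle M k).
Hypothesis hE : framed_bundle E.
Variables (D : covder M k) (hD : is_connection E D) (p0 : M).
Let c := chart_at p0.
Variables (W : set M) (oW : open W) (Wc : W `<=` cdom c).
Implicit Types (s t : M -> 'cV[R]_k) (f : M -> R) (i j : 'I_n) (q : M).

(** Only the coordinate fields of the preferred chart at [p0] serve as directions: they commute, so
    the curvature becomes the plain commutator [coord_curv]. *)
Definition nab i s q : 'cV[R]_k := D s q *m coord_field p0 i q.

Definition coord_curv i j s q : 'cV[R]_k := nab i (nab j s) q - nab j (nab i s) q.

Lemma curv_coord_fields i j s q : cdom c q ->
  curv D (coord_field p0 i) (coord_field p0 j) s q = coord_curv i j s q.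
Proof. by move=> cq; rewrite /curv lie_bracket_coord_fields // mulmx0 subr0. Qed.

Lemma nab_smooth i s : smooth_sec E W s -> smooth_sec E W (nab i s).
Proof.
by move=> hs; case: (hD oW hs hs) => + _ _ _; apply; apply: coord_field_smooth.
Qed.

Lemma nab_ext i s t q : smooth_sec E W s -> smooth_sec E W t ->
  (forall q, W q -> s q = t q) -> W q -> nab i s q = nab i t q.
Proof. by move=> hs ht st Wq; rewrite /nab; case: (hD oW hs ht) => _ /(_ st q Wq) -> _ _. Qed.

Lemma nabD i s t q : smooth_sec E W s -> smooth_sec E W t -> W q ->
  nab i (fun q => s q + t q) q = nab i s q + nab i t q.
Proof. by move=> hs ht Wq; rewrite /nab; case: (hD oW hs ht) => _ _ -> // _; rewrite mulmxDl. Qed.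

Lemma nabZ i f s q : smooth_fun W f -> smooth_sec E W s -> W q ->
  nab i (fun q => f q *: s q) q = f q *: nab i s q + coord_der c i f q *: s q.
Proof.
move=> hf hs Wq; rewrite /nab; case: (hD oW hs hs) => _ _ _ -> //.
rewrite mulmxDl -scalemxAl -mulmxA; congr (_ + _).
rewrite -(dirder_coord_field i oW hf Wq (Wc Wq)) /dirder.
by rewrite {1}[dfun f q *m _]mx11_scalar mul_mx_scalar.
Qed.

(** By additivity the value equals its own double. *)
Lemma nab0 i q : W q -> nab i (fun=> 0) q = 0.
Proof.
move=> Wq; have h0 := smooth_sec0 hE oW.
have := nabD i h0 h0 Wq; rewrite -[X in X = _ -> _](nab_ext i h0) //.
- by move/eqP; rewrite -subr_eq subrr => /eqP <-.
- exact: smooth_secD.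
- by move=> q' _; rewrite addr0.
Qed.

Lemma nab_sum i (I : Type) (r : seq I) (F : I -> M -> 'cV[R]_k) q :
  (forall a, smooth_sec E W (F a)) -> W q ->
  nab i (fun q => \sum_(a <- r) F a q) q = \sum_(a <- r) nab i (F a) q.
Proof.
move=> hF Wq; elim: r => [|a r IH].
  rewrite big_nil; apply: etrans (nab0 i Wq); apply: nab_ext => //.
  - exact: smooth_sec_sum.
  - exact: smooth_sec0.
  - by move=> q' _; rewrite big_nil.
rewrite big_cons -IH -nabD //; last exact: smooth_sec_sum.
apply: nab_ext => //; first exact: smooth_sec_sum.
  by apply: smooth_secD => //; apply: smooth_sec_sum.
by move=> q' _; rewrite big_cons.
Qed.

Lemma coord_curv_ext i j s t q : smooth_sec E W s -> smooth_sec E W t ->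
  (forall q, W q -> s q = t q) -> W q -> coord_curv i j s q = coord_curv i j t q.
Proof.
by move=> hs ht st Wq; congr (_ - _); apply: nab_ext => //;
   try exact: nab_smooth; move=> q' Wq'; apply: nab_ext.
Qed.

Lemma coord_curvN i j s q : coord_curv j i s q = - coord_curv i j s q.
Proof. by rewrite /coord_curv opprB. Qed.

(** The terms with first derivatives of [f] are symmetric in [i] and [j], and so are, by Schwarz,
    those with second derivatives; both disappear from the commutator. *)
Lemma coord_curvZ i j f s q : smooth_fun W f -> smooth_sec E W s -> W q ->
  coord_curv i j (fun q => f q *: s q) q = f q *: coord_curv i j s q.
Proof.
move=> hf hs Wq.
have hdf a : smooth_fun W (coord_der c a f).
  by apply: smooth_fun_sub (coord_der_smooth c a oW hf) => q' Wq'; split => //; apply: Wc.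
have hN a := nab_smooth a hs.
have nn a b : nab a (nab b (fun q => f q *: s q)) q =
  f q *: nab a (nab b s) q + coord_der c a f q *: nab b s q
  + (coord_der c b f q *: nab a s q + coord_der c a (coord_der c b f) q *: s q).
  rewrite -!nabZ // -nabD //; try exact: smooth_secZ.
  apply: nab_ext => //; first by apply: nab_smooth; apply: smooth_secZ.
    by apply: smooth_secD => //; apply: smooth_secZ.
  by move=> q' Wq'; rewrite nabZ.
rewrite /coord_curv !nn (coord_der_comm j i oW hf Wq (Wc Wq)).
move: (coord_der _ _ _ _) (coord_der _ _ _ _) (coord_der _ _ _ _) => x y z.
by apply/matrixP => a b; rewrite !mxE; ring.
Qed.

Lemma coord_curv_sum i j (I : Type) (r : seq I) (F : I -> M -> 'cV[R]_k) q :
  (forall a, smooth_sec E W (F a)) -> W q ->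
  coord_curv i j (fun q => \sum_(a <- r) F a q) q = \sum_(a <- r) coord_curv i j (F a) q.
Proof.
move=> hF Wq.
have nn a b : nab a (nab b (fun q => \sum_(x <- r) F x q)) q =
              \sum_(x <- r) nab a (nab b (F x)) q.
  rewrite -nab_sum //; last by move=> x; apply: nab_smooth.
  apply: nab_ext => //; first by apply: nab_smooth; apply: smooth_sec_sum.
    by apply: smooth_sec_sum => // x; apply: nab_smooth.
  by move=> q' Wq'; rewrite nab_sum.
by rewrite /coord_curv !nn -sumrB.
Qed.

Section Metric.
Variables (g : M -> 'M[R]_k) (hg : bundle_metric E g).
Hypothesis hmet : metric_connection E g D.

Lemma nab_metric i s t q : smooth_sec E W s -> smooth_sec E W t -> W q ->
  coord_der c i (fun q => inner g q (s q) (t q)) q =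
  inner g q (nab i s q) (t q) + inner g q (s q) (nab i t q).
Proof.
move=> hs ht Wq; rewrite -(dirder_coord_field i oW (inner_smooth hE hg oW hs ht) Wq (Wc Wq)).
by case: hmet => _ /(_ W oW s t hs ht q Wq); apply.
Qed.

Variables (e : M -> 'M[R]_k) (he : orthonormal_frame E g W e).

Definition conn_coef i a b q : R := inner g q (nab i (fun q => col a (e q)) q) (col b (e q)).

Let he1 a : smooth_sec E W (fun q => col a (e q)). Proof. by case: he. Qed.

Lemma conn_coef_smooth i a b : smooth_fun W (conn_coef i a b).
Proof. by apply: (inner_smooth hE hg oW) => //; apply: nab_smooth. Qed.

(** Differentiate the inner products of the frame, which are constant. *)
Lemma conn_coef_skew i a b q : W q -> conn_coef i b a q = - conn_coef i a b q.
Proof.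
move=> Wq; apply/eqP; rewrite -addr_eq0 addrC; apply/eqP.
rewrite {2}/conn_coef [inner g q _ (col a _)](innerC hg).
rewrite -(nab_metric i (he1 a) (he1 b) Wq).
apply: etrans (coord_der_cst c (a == b)%:R i q).
by apply: (coord_der_ext oW i Wq (Wc Wq)) => q' Wq'; apply: (frame_inner he).
Qed.

Lemma nab_frame i a q : W q ->
  nab i (fun q => col a (e q)) q = \sum_b conn_coef i a b q *: col b (e q).
Proof. by move=> Wq; apply: (frame_coordinates hg he). Qed.

(** Cartan's structure equation on two coordinate fields; as they commute, the exterior derivative
    of the connection form has only two terms. *)
Lemma curvature_form i j a b q : W q ->
  inner g q (coord_curv i j (fun q => col a (e q)) q) (col b (e q)) =
  coord_der c i (conn_coef j a b) q - coord_der c j (conn_coef i a b) q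
  + \sum_d (conn_coef j a d q * conn_coef i d b q - conn_coef i a d q * conn_coef j d b q).
Proof.
move=> Wq.
have nn x y : inner g q (nab x (nab y (fun q => col a (e q))) q) (col b (e q)) =
  coord_der c x (conn_coef y a b) q + \sum_d conn_coef y a d q * conn_coef x d b q.
  rewrite (@nab_ext x _ (fun q => \sum_d conn_coef y a d q *: col d (e q))) //; first last.
  - by move=> q'; apply: nab_frame.
  - by apply: smooth_sec_sum => // d; apply: smooth_secZ => //; apply: conn_coef_smooth.
  - exact: nab_smooth.
  rewrite nab_sum //; last by move=> d; apply: smooth_secZ => //; apply: conn_coef_smooth.
  rewrite (inner_suml hg).
  rewrite (eq_bigr (fun d => conn_coef y a d q * conn_coef x d b q
      + coord_der c x (conn_coef y a d) q * (d == b)%:R)) => [|d _]; last first.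
    by rewrite nabZ ?innerDl ?innerZl ?(frame_inner he) //; apply: conn_coef_smooth.
  rewrite big_split addrC /=; congr (_ + _).
  rewrite (bigD1 b) //= eqxx mulr1 big1 ?addr0 // => d db.
  by rewrite (negPf db) mulr0.
by rewrite innerBl !nn sumrB opprD addrACA.
Qed.

(** Skewness of the connection coefficients passes to their derivatives and, in the structure
    equation, to the quadratic term. *)
Lemma curvature_form_skew i j a b q : W q ->
  inner g q (coord_curv i j (fun q => col b (e q)) q) (col a (e q)) =
  - inner g q (coord_curv i j (fun q => col a (e q)) q) (col b (e q)).
Proof.
move=> Wq; rewrite !curvature_form //.
have dN x y : coord_der c x (conn_coef y b a) q = - coord_der c x (conn_coef y a b) q.
  rewrite -(coord_derN x Wq (Wc Wq) (conn_coef_smooth y a b)).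
  by apply: (coord_der_ext oW x Wq (Wc Wq)) => q'; apply: conn_coef_skew.
have oppE (x y u v : R) : v = - u -> - x - - y + v = - (x - y + u) by move=> ->; ring.
rewrite (dN i j) (dN j i); apply: oppE.
rewrite -sumrN; apply: eq_bigr => d _.
rewrite (conn_coef_skew i d b Wq) (conn_coef_skew j d b Wq).
rewrite (conn_coef_skew i a d Wq) (conn_coef_skew j a d Wq); ring.
Qed.

(* Any section is a combination of the frame, so the curvature at q only
   depends on the value of the section at q. *)
Lemma coord_curv_tensor i j s q : smooth_sec E W s -> W q ->
  coord_curv i j s q = \sum_a inner g q (s q) (col a (e q)) *:
     coord_curv i j (fun q => col a (e q)) q.
Proof.
move=> hs Wq.
have hi a : smooth_fun W (fun q => inner g q (s q) (col a (e q))).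
  exact: (inner_smooth hE hg oW hs (he1 a)).
rewrite (@coord_curv_ext _ _ _
  (fun q => \sum_a inner g q (s q) (col a (e q)) *: col a (e q))) //.
- rewrite coord_curv_sum //; last by move=> a; apply: smooth_secZ.
  by apply: eq_bigr => a _; rewrite coord_curvZ.
- by apply: smooth_sec_sum => // a; apply: smooth_secZ.
- by move=> q' Wq'; apply: (frame_coordinates hg he).
Qed.

End Metric.
End CoordinateConnection.

(** The classical argument: four cyclic identities, one for each choice of the last index, are
    combined linearly; the listed skew relations identify the terms that differ by
    transpositions. *)
Lemma curvature_pair_symmetry (R : realFieldType) (I : Type) (f : I -> I -> I -> I -> R) :
  (forall x y z w, f y x z w = - f x y z w) -> (forall x y z w, f x y w z = - f x y z w) ->
  (forall x y z w, f x y z w + f y z x w + f z x y w = 0) ->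
  forall x y z w, f x y z w = f z w x y.
Proof.
move=> s1 s2 b x y z w.
have := b x y z w; have := b y z w x; have := b z w x y; have := b w x y z.
have := (s1 z x y w, s1 x w y z, s2 y z x w, s2 x y z w, s2 z w x y, s2 y w z x, s2 w x y z).
have := (s1 y w z x, s1 w y z x, s2 w y z x, s1 w x z y, s2 z x y w, s1 w z x y, s1 x w z y).
have := (s2 w z x y, s1 x z w y, s2 x z w y, s2 x w z y, s2 w x z y, s1 w x y z, s2 x w y z, s2 w y x z).
move=> [[[[[[[a1 a2] a3] a4] a5] a6] a7] a8] [[[[[[c1 c2] c3] c4] c5] c6] c7].
move=> [[[[[[d1 d2] d3] d4] d5] d6] d7]; lra.
Qed.

(** * Symmetries of the Riemann tensor, and the Ricci form in an orthonormal frame *)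

Section LeviCivita.
Variables (R : realType) (n : nat) (M : manifold R n).
Variables (g : M -> 'M[R]_n) (hg : bundle_metric (tangent M) g).
Variables (D : covder M n) (hLC : levi_civita g D) (p0 : M).
Let c := chart_at p0.
Variables (W : set M) (oW : open W) (Wc : W `<=` cdom c) (Wp : W p0).
Variables (e : M -> 'M[R]_n) (he : orthonormal_frame (tangent M) g W e).

Let hD : is_connection (tangent M) D. Proof. by case: hLC => -[]. Qed.
Let hm : metric_connection (tangent M) g D. Proof. by case: hLC. Qed.
Let hT : framed_bundle (tangent M). Proof. exact: framed_tangent. Qed.
Let hX i : smooth_sec (tangent M) W (coord_field p0 i).
Proof. exact: coord_field_smooth. Qed.
Let he1 a : smooth_sec (tangent M) W (fun q => col a (e q)). Proof. by case: he. Qed.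

Lemma nab_torsion_free i j q : W q ->
  nab D p0 i (coord_field p0 j) q = nab D p0 j (coord_field p0 i) q.
Proof.
move=> Wq; case: hLC => _ /(_ W oW _ _ (hX i) (hX j) q Wq).
rewrite lie_bracket_coord_fields; last exact: Wc.
by move/eqP; rewrite subr_eq0 => /eqP.
Qed.

(** Commuting coordinate fields and vanishing torsion make [nab y X_z] symmetric in [y] and [z], so
    the six second derivatives cancel in pairs. *)
Lemma bianchi_coord i j l : coord_curv D p0 i j (coord_field p0 l) p0
  + coord_curv D p0 j l (coord_field p0 i) p0
  + coord_curv D p0 l i (coord_field p0 j) p0 = 0.
Proof.
have nn x y z : nab D p0 x (nab D p0 y (coord_field p0 z)) p0 =
                nab D p0 x (nab D p0 z (coord_field p0 y)) p0.
  apply: (@nab_ext _ _ _ _ _ _ hD p0 W oW x _ _ p0 _ _ _ Wp) => //; try exact: nab_smooth.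
  by move=> q Wq; apply: nab_torsion_free.
rewrite /coord_curv (nn i j l) (nn j l i) (nn l i j).
by apply/matrixP => a b; rewrite !mxE; ring.
Qed.

(** This is <R(e_x, e_y) e_a, e_b> at [p0]: there the coordinate fields are the standard basis, so
    column [x] of [e p0] holds the coordinates of e_x. *)
Definition frame_curv x y a b : R := \sum_i \sum_j e p0 i x * e p0 j y *
  inner g p0 (coord_curv D p0 i j (fun q => col a (e q)) p0) (col b (e p0)).

Lemma frame_curv_skew12 x y a b : frame_curv y x a b = - frame_curv x y a b.
Proof.
rewrite /frame_curv exchange_big -sumrN; apply: eq_bigr => i _.
rewrite -sumrN; apply: eq_bigr => j _.
by rewrite coord_curvN -scaleN1r innerZl; ring.
Qed.

Lemma frame_curv_skew34 x y a b : frame_curv x y b a = - frame_curv x y a b.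
Proof.
rewrite /frame_curv -sumrN; apply: eq_bigr => i _.
rewrite -sumrN; apply: eq_bigr => j _.
by rewrite (curvature_form_skew hT hD oW Wc hg hm he) // mulrN.
Qed.

(** Bianchi's identity is known for coordinate fields and skewness for the frame. Tensoriality in
    the section links the two: both sides are expanded in the frame. *)
Lemma coord_curv_frame i j a : coord_curv D p0 i j (fun q => col a (e q)) p0 =
  \sum_l e p0 l a *: coord_curv D p0 i j (coord_field p0 l) p0.
Proof.
rewrite (coord_curv_tensor hT hD oW Wc hg he _ _ (he1 a) Wp).
under [RHS]eq_bigr => l _.
  rewrite (coord_curv_tensor hT hD oW Wc hg he _ _ (hX l) Wp) scaler_sumr.
  under eq_bigr => b _ do rewrite scalerA -innerZl.
  over.
rewrite exchange_big; apply: eq_bigr => b _ /=; rewrite -scaler_suml; congr (_ *: _).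
rewrite -(inner_suml hg) ; congr (inner _ _ _ _).
apply/matrixP => i' z; rewrite summxE (bigD1 i') //= big1 => [|l li].
  by rewrite coord_field_at !mxE ord1 !eqxx mulr1 addr0.
by rewrite coord_field_at !mxE eq_sym (negPf li) mulr0.
Qed.

Lemma frame_curv_bianchi x y z b :
  frame_curv x y z b + frame_curv y z x b + frame_curv z x y b = 0.
Proof.
pose K i j l := inner g p0 (coord_curv D p0 i j (coord_field p0 l) p0) (col b (e p0)).
have E u v w : frame_curv u v w b =
    \sum_i \sum_j \sum_l e p0 i u * e p0 j v * e p0 l w * K i j l.
  apply: eq_bigr => i _; apply: eq_bigr => j _.
  rewrite coord_curv_frame (inner_suml hg) mulr_sumr; apply: eq_bigr => l _.
  by rewrite innerZl mulrA.
have E2 : frame_curv y z x b =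
    \sum_i \sum_j \sum_l e p0 i x * e p0 j y * e p0 l z * K j l i.
  rewrite E; under eq_bigr => i _ do rewrite exchange_big /=.
  rewrite exchange_big; apply: eq_bigr => i _; apply: eq_bigr => j _.
  by apply: eq_bigr => l _; ring.
have E3 : frame_curv z x y b =
    \sum_i \sum_j \sum_l e p0 i x * e p0 j y * e p0 l z * K l i j.
  rewrite E exchange_big; apply: eq_bigr => i _; rewrite exchange_big.
  by apply: eq_bigr => j _; apply: eq_bigr => l _; ring.
rewrite E2 E3 E -!big_split big1 // => i _; rewrite -!big_split big1 // => j _.
rewrite -!big_split big1 // => l _ /=.
rewrite -!mulrDr /K -!innerDl bianchi_coord -(scale0r 0) innerZl; ring.
Qed.

Lemma frame_curv_pair x y a b : frame_curv x y a b = frame_curv a b x y.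
Proof.
apply: (curvature_pair_symmetry frame_curv_skew12 frame_curv_skew34).
exact: frame_curv_bianchi.
Qed.

(** The trace defining [ricci_form] is taken in the coordinate basis; expanding the curvature vector
    in the frame turns it into a trace over the frame. *)
Lemma ricci_frame y z :
  ((e p0)^T *m ricci_form D p0 *m e p0) y z = \sum_x frame_curv x y z x.
Proof.
have cp := chart_at_dom p0.
have R1 i : \sum_j ricci_form D p0 i j * e p0 j z =
    \sum_a (coord_curv D p0 a i (fun q => col z (e q)) p0) a 0.
  under eq_bigr => j _ do rewrite mxE mulr_suml.
  rewrite exchange_big; apply: eq_bigr => a _; rewrite coord_curv_frame summxE.
  by apply: eq_bigr => j _; rewrite curv_coord_fields // mulrC [RHS]mxE.
have -> : ((e p0)^T *m ricci_form D p0 *m e p0) y z =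
    \sum_i e p0 i y * \sum_a (coord_curv D p0 a i (fun q => col z (e q)) p0) a 0.
  rewrite -mulmxA mxE; apply: eq_bigr => i _; rewrite mxE; congr (_ * _).
  by rewrite -R1 mxE.
under [RHS]eq_bigr => x _ do rewrite /frame_curv exchange_big.
rewrite exchange_big; apply: eq_bigr => i _ /=; rewrite mulr_sumr.
rewrite exchange_big; apply: eq_bigr => a _ /=.
set v := coord_curv _ _ _ _ _ _.
rewrite {1}(frame_coordinates hg he v Wp) summxE mulr_sumr.
by apply: eq_bigr => x _; rewrite mxE [col _ _ _ _]mxE; ring.
Qed.

Lemma ricci_frame_sym :
  ((e p0)^T *m ricci_form D p0 *m e p0)^T = (e p0)^T *m ricci_form D p0 *m e p0.
Proof.
apply/matrixP => y z; rewrite mxE !ricci_frame; apply: eq_bigr => x _.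
by rewrite frame_curv_pair frame_curv_skew12 frame_curv_skew34 opprK.
Qed.

End LeviCivita.

(** * Clifford matrices *)

Lemma sum_lt_sym (V : zmodType) n (F : 'I_n -> 'I_n -> V) :
  (forall a b, F b a = F a b) -> (forall a, F a a = 0) ->
  \sum_(a < n) \sum_(b < n) F a b = (\sum_(a < n) \sum_(b < n | (a < b)%N) F a b) *+ 2.
Proof.
move=> sF F0; rewrite mulr2n.
rewrite [X in _ = _ + X](exchange_big_dep predT) //= -big_split; apply: eq_bigr => a _ /=.
rewrite (bigID (fun b : 'I_n => (a < b)%N)) /=; congr (_ + _).
rewrite (bigID (pred1 a)) /= [X in X + _](_ : _ = 0) ?add0r.
  apply: eq_big => [b|b _]; last by rewrite sF.
  by rewrite -leqNgt ltn_neqAle andbC.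
by rewrite big1 // => b /andP[_ /eqP ->].
Qed.

Section CliffordMatrices.
Variables (C : numFieldType) (N n : nat) (gam : 'I_n -> 'M[C]_N).
Hypothesis gamC : forall a b,
  gam a *m gam b + gam b *m gam a = (if a == b then - 2 else 0)%:M.
Implicit Types (w v : 'I_n -> 'I_n -> C).

Local Notation del a b := (if a == b then - 2 else 0 : C).

Definition skew w := forall a b, w b a = - w a b.

Lemma gam_swap a b : gam a *m gam b = (del a b)%:M - gam b *m gam a.
Proof. by rewrite -gamC addrK. Qed.

Lemma gam_comm3 a b c : gam a *m gam b *m gam c =
  del b c *: gam a - del a c *: gam b + gam c *m (gam a *m gam b).
Proof.
rewrite -mulmxA (gam_swap b c) mulmxBr mul_mx_scalar -!addrA; congr (_ + _).
by rewrite [gam a *m (gam c *m _)]mulmxA (gam_swap a c) mulmxBl mul_scalar_mx opprB mulmxA addrC.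
Qed.

Lemma sum_del (V : lmodType C) c (F : 'I_n -> V) : \sum_a del a c *: F a = (- 2) *: F c.
Proof.
rewrite (bigD1 c) //= eqxx big1 ?addr0 // => a /negPf ->; exact: scale0r.
Qed.

(** The image of the skew matrix [w] in the spin representation. The factor 1/4 is the 1/2 of the
    spin connection, halved again because each pair is summed in both orders. *)
Definition spin_mx w : 'M[C]_N := \sum_a \sum_b (w a b / 4) *: (gam a *m gam b).

Lemma spin_mxD w v : spin_mx (fun a b => w a b + v a b) = spin_mx w + spin_mx v.
Proof.
rewrite -big_split; apply: eq_bigr => a _; rewrite -big_split; apply: eq_bigr => b _ /=.
by rewrite mulrDl scalerDl.
Qed.

Lemma spin_mxZ x w : spin_mx (fun a b => x * w a b) = x *: spin_mx w.
Proof.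
rewrite scaler_sumr; apply: eq_bigr => a _; rewrite scaler_sumr; apply: eq_bigr => b _ /=.
by rewrite scalerA mulrA.
Qed.

(** The covering of SO(n) at Lie algebra level: commutators with [spin_mx w] act on vectors through
    [w] itself. This is what normalises the factor 1/4. *)
Lemma spin_mx_gam w c : skew w ->
  spin_mx w *m gam c - gam c *m spin_mx w = \sum_b w c b *: gam b.
Proof.
move=> sw; rewrite mulmx_suml mulmx_sumr -sumrB.
have E a : (\sum_b (w a b / 4) *: (gam a *m gam b)) *m gam c -
   gam c *m (\sum_b (w a b / 4) *: (gam a *m gam b)) =
   (- 2 * (w a c / 4)) *: gam a - \sum_b del a c *: ((w a b / 4) *: gam b).
  rewrite mulmx_suml mulmx_sumr -sumrB.
  rewrite -scalerA -(sum_del c (fun b => (w a b / 4) *: gam a)) -sumrB.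
  apply: eq_bigr => b _; rewrite -scalemxAl -scalemxAr gam_comm3 -scalerBr addrK.
  by rewrite scalerBr !scalerA ![_ / 4 * _]mulrC.
under eq_bigr => a _ do rewrite E.
rewrite sumrB exchange_big /=.
under [X in _ - X]eq_bigr => b _ do rewrite sum_del scalerA.
rewrite -sumrB; apply: eq_bigr => b _; rewrite -scalerBl (sw c b); congr (_ *: _).
by field.
Qed.

(** The commutator with [spin_mx w] is a derivation, known on the generators. The order [v w - w v]
    of the result is that of the quadratic term in [curvature_form]. *)
Lemma spin_mx_comm w v : skew w -> skew v ->
  spin_mx w *m spin_mx v - spin_mx v *m spin_mx w =
  spin_mx (fun a b => \sum_d (v a d * w d b - w a d * v d b)).
Proof.
move=> sw sv.
have E c d : spin_mx w *m (gam c *m gam d) - (gam c *m gam d) *m spin_mx w =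
   \sum_b (w c b *: (gam b *m gam d)) + \sum_b w d b *: (gam c *m gam b).
  have -> : \sum_b (w c b *: (gam b *m gam d)) =
            (spin_mx w *m gam c - gam c *m spin_mx w) *m gam d.
    by rewrite spin_mx_gam // mulmx_suml; apply: eq_bigr => b _; rewrite -scalemxAl.
  have -> : \sum_b (w d b *: (gam c *m gam b)) =
            gam c *m (spin_mx w *m gam d - gam d *m spin_mx w).
    by rewrite spin_mx_gam // mulmx_sumr; apply: eq_bigr => b _; rewrite -scalemxAr.
  by rewrite mulmxBl mulmxBr !mulmxA addrA subrK.
have -> : spin_mx w *m spin_mx v - spin_mx v *m spin_mx w = \sum_c \sum_d (v c d / 4) *:
   (\sum_b (w c b *: (gam b *m gam d)) + \sum_b w d b *: (gam c *m gam b)).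
  move: (spin_mx w) E => A E; rewrite [spin_mx v]/spin_mx mulmx_suml mulmx_sumr -sumrB; apply: eq_bigr => c _.
  rewrite mulmx_suml mulmx_sumr -sumrB; apply: eq_bigr => d _.
  by rewrite -scalemxAl -scalemxAr -scalerBr E.
have T1 : \sum_c \sum_d (v c d / 4) *: \sum_b (w c b *: (gam b *m gam d)) =
          \sum_a \sum_b (\sum_d v d b / 4 * w d a) *: (gam a *m gam b).
  under eq_bigr => c _.
    under eq_bigr => d _ do rewrite scaler_sumr.
    rewrite exchange_big /=; over.
  rewrite exchange_big; apply: eq_bigr => a _; rewrite exchange_big; apply: eq_bigr => b _ /=.
  by rewrite scaler_suml; apply: eq_bigr => d _; rewrite scalerA.
have T2 : \sum_c \sum_d (v c d / 4) *: \sum_b (w d b *: (gam c *m gam b)) =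
          \sum_a \sum_b (\sum_d v a d / 4 * w d b) *: (gam a *m gam b).
  apply: eq_bigr => c _; under eq_bigr => d _ do rewrite scaler_sumr.
  rewrite exchange_big; apply: eq_bigr => b _ /=; rewrite scaler_suml.
  by apply: eq_bigr => d _; rewrite scalerA.
under eq_bigr => c _ do (under eq_bigr => d _ do rewrite scalerDr; rewrite big_split).
rewrite big_split /= T1 T2 -big_split; apply: eq_bigr => a _ /=.
rewrite -big_split; apply: eq_bigr => b _ /=; rewrite -scalerDl; congr (_ *: _).
rewrite -big_split mulr_suml; apply: eq_bigr => d _ /=; rewrite (sw a d); ring.
Qed.

Lemma sum_rot (V : zmodType) (F : 'I_n -> 'I_n -> 'I_n -> V) :
  \sum_a \sum_b \sum_c F a b c = \sum_a \sum_b \sum_c F c a b.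
Proof.
by rewrite [RHS](eq_bigr _ (fun a _ => exchange_big _ _ _ _ _ _)) [RHS]exchange_big.
Qed.

(** Let [S] be the left-hand side and [rho] the sum on the right. Relabelling cyclically, the
    vanishing cyclic sum of [T] says that [S] and its two variants with cyclically permuted factors
    add up to 0. Restoring the order of the factors turns this into [3 S - 6 rho = 0]. *)
Lemma cubic_contraction (T : 'I_n -> 'I_n -> 'I_n -> C) :
  (forall a b c, T a c b = - T a b c) ->
  (forall a b c, T a b c + T b c a + T c a b = 0) ->
  \sum_a \sum_b \sum_c T a b c *: (gam a *m (gam b *m gam c)) =
  2 *: \sum_b (\sum_a T a b a) *: gam b.
Proof.
move=> sT cT; pose G a b c := gam a *m (gam b *m gam c).
pose tri (F : 'I_n -> 'I_n -> 'I_n -> 'M[C]_N) := \sum_a \sum_b \sum_c F a b c.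
rewrite -[LHS]/(tri (fun a b c => T a b c *: G a b c)).
set S := tri _; set rho := \sum_b _.
have E a b c : T a b c *: G b c a + T a b c *: G c a b = T a b c *: G a b c *+ 2
    + del c a *: (T a b c *: gam b) - del b a *: (T a b c *: gam c)
    - del b c *: (T a b c *: gam a) + del c a *: (T a b c *: gam b).
  have := gam_comm3 a b c; have := gam_comm3 b c a.
  rewrite -!mulmxA -/(G b c a) -/(G a b c) -/(G c a b) => -> e2.
  have -> : G c a b = G a b c - (del b c *: gam a - del a c *: gam b).
    by rewrite e2 addrC addKr.
  rewrite [a == c]eq_sym.
  by apply/matrixP => i j; rewrite !mxE; ring.
have T0 a b : T a b b = 0.
  by apply/eqP; have /eqP := sT a b b; rewrite -subr_eq0 opprK -mulr2n mulrn_eq0.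
have d1 : tri (fun a b c => del c a *: (T a b c *: gam b)) = (- 2) *: rho.
  rewrite /tri; under eq_bigr => a _ do under eq_bigr => b _ do rewrite sum_del.
  rewrite exchange_big scaler_sumr; apply: eq_bigr => b _.
  by rewrite -scaler_sumr -scaler_suml.
have d2 : tri (fun a b c => del b a *: (T a b c *: gam c)) = 2 *: rho.
  rewrite /tri; under eq_bigr => a _.
    rewrite exchange_big; under eq_bigr => c _ do rewrite sum_del sT !scaleNr scalerN opprK.
    over.
  rewrite exchange_big scaler_sumr; apply: eq_bigr => b _.
  by rewrite -scaler_sumr -scaler_suml.
have d3 : tri (fun a b c => del b c *: (T a b c *: gam a)) = 0.
  rewrite /tri big1 // => a _; rewrite exchange_big big1 // => c _.
  by rewrite sum_del T0 scale0r scaler0.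
have triD F F' : tri F + tri F' = tri (fun a b c => F a b c + F' a b c).
  by rewrite -big_split; apply: eq_bigr => a _; rewrite -big_split;
     apply: eq_bigr => b _; rewrite -big_split.
have triN F : - tri F = tri (fun a b c => - F a b c).
  by rewrite -sumrN; apply: eq_bigr => a _; rewrite -sumrN; apply: eq_bigr => b _;
     rewrite -sumrN.
have r0 : S + tri (fun a b c => T a b c *: G b c a + T a b c *: G c a b) = 0.
  rewrite -triD /tri [X in _ + (X + _)]sum_rot [X in _ + (_ + X)]sum_rot.
  rewrite [X in _ + (_ + X)]sum_rot -3!/(tri _) !triD.
  rewrite /tri big1 // => a _; rewrite big1 // => b _; rewrite big1 // => c _.
  by rewrite -!scalerDl [T c a b + _]addrC addrA cT scale0r.
have r1 : tri (fun a b c => T a b c *: G b c a + T a b c *: G c a b) =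
   S + S + (- 2) *: rho - 2 *: rho - 0 + (- 2) *: rho.
  rewrite -d1 -d2 -d3 /S !triN !triD /tri.
  apply: eq_bigr => a _; apply: eq_bigr => b _; apply: eq_bigr => c _.
  by rewrite E mulr2n.
have n3 : (3 : C) != 0 by rewrite pnatr_eq0.
rewrite r1 in r0; apply: (scalerI n3); move: (S) (rho) r0 => A B e.
apply/matrixP => i j; have := congr1 (fun Z : 'M[C]_N => Z i j) e; rewrite !mxE => h.
have -> : 3 * A i j = A i j + (A i j + A i j + - 2 * B i j - 2 * B i j - 0 + - 2 * B i j)
   + 3 * (2 * B i j) by ring.
by rewrite h add0r.
Qed.

End CliffordMatrices.

(** * Spinors *)

Section SpinorOperators.
Variables (R : realType) (n r m : nat).
Local Notation C := R[i].
Local Notation slots := {ffun 'I_m -> 'I_(2 ^ r./2)}.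
Implicit Types (psi chi : spinor R n r m) (A B : 'M[C]_(2 ^ n./2)) (P Q : 'M[C]_(2 ^ r./2)).
Implicit Types (Bs Cs : 'I_m -> 'M[C]_(2 ^ r./2)).

Lemma act_base_linear_l psi : linear (fun A => act_base A psi).
Proof.
move=> a A B; apply/ffunP => s; rewrite !ffunE /= scaler_sumr -big_split.
by apply: eq_bigr => b _ /=; rewrite !mxE mulrDl scalerAl.
Qed.

Lemma act_base_linear_r A : linear (act_base A : spinor R n r m -> _).
Proof.
move=> a psi chi; apply/ffunP => s; rewrite !ffunE /= scaler_sumr -big_split.
by apply: eq_bigr => b _ /=; rewrite !ffunE mulrDr; congr (_ + _); apply: mulrCA.
Qed.

Lemma act_baseM A B psi : act_base A (act_base B psi) = act_base (A *m B) psi.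
Proof.
apply/ffunP => s; rewrite !ffunE.
under eq_bigr => a _ do rewrite ffunE mulr_sumr.
rewrite exchange_big; apply: eq_bigr => b _ /=; rewrite mxE mulr_suml.
by apply: eq_bigr => a _; rewrite mulrA.
Qed.

Lemma act_base_scalar a psi : act_base a%:M psi = a *: psi.
Proof.
apply/ffunP => -[s t]; rewrite !ffunE /= (bigD1 s) //= big1 => [|b /negPf bs].
  by rewrite mxE eqxx addr0.
by rewrite mxE eq_sym bs mul0r.
Qed.

Lemma act_slot_linear_l j psi : linear (fun P => act_slot j P psi).
Proof.
move=> a A B; apply/ffunP => s; rewrite !ffunE /= scaler_sumr -big_split.
by apply: eq_bigr => b _ /=; rewrite !mxE mulrDl scalerAl.
Qed.

(** A tensor product of possibly different matrices. [act_slot] (identity in the other slots) and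
    [act_slots] (constant family) are both instances, so products, adjoints and commutation are
    proved once. *)
Definition act_tensor Bs psi : spinor R n r m :=
  [ffun s : 'I_(2 ^ n./2) * slots => \sum_(t : slots) (\prod_j Bs j (s.2 j) (t j)) * psi (s.1, t)].

(** The identity factors force the summation index to agree with [s.2] outside slot [j]; grouping
    the indices by their value at [j] leaves one term in each group. *)
Lemma act_slotE j P psi :
  act_slot j P psi = act_tensor (fun i => if i == j then P else 1%:M) psi.
Proof.
apply/ffunP => -[s t]; rewrite !ffunE /=.
rewrite (partition_big (fun u : slots => u j) predT) //=; apply: eq_bigr => b _.
pose u0 : slots := [ffun i => if i == j then b else t i].
rewrite (bigD1 u0) /=; last by rewrite ffunE eqxx.
rewrite [X in _ + X]big1 => [|u /andP[/eqP ub /eqP uu0]].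
  rewrite addr0 (bigD1 j) //= eqxx ffunE eqxx big1 ?mulr1 // => i /negPf ij.
  by rewrite ij ffunE ij mxE eqxx.
have [i /andP[ij tu]] : exists i, (i != j) && (t i != u i).
  apply/existsP; apply: contra_notT uu0; rewrite negb_exists => /forallP h.
  apply/ffunP => i; rewrite ffunE; case: eqP => [->//|/eqP ij].
  by have := h i; rewrite ij /= negbK => /eqP ->.
by rewrite (bigD1 i) //= (negPf ij) mxE (negPf tu) !mul0r.
Qed.

Lemma act_tensor_linear Bs : linear (act_tensor Bs).
Proof.
move=> a psi chi; apply/ffunP => s; rewrite !ffunE /= scaler_sumr -big_split.
by apply: eq_bigr => b _ /=; rewrite !ffunE mulrDr; congr (_ + _); apply: mulrCA.
Qed.

(** A product over the slots of sums over one index expands into a sum over all intermediate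
    multi-indices. *)
Lemma act_tensorM Bs Cs psi :
  act_tensor Bs (act_tensor Cs psi) = act_tensor (fun j => Bs j *m Cs j) psi.
Proof.
apply/ffunP => s; rewrite !ffunE.
under eq_bigr => t _ do rewrite ffunE mulr_sumr.
rewrite exchange_big; apply: eq_bigr => u _ /=.
rewrite (eq_bigr (fun j => \sum_b Bs j (s.2 j) b * Cs j b (u j))) => [|j _]; last first.
  by rewrite mxE.
rewrite bigA_distr_bigA mulr_suml; apply: eq_bigr => t _.
by rewrite mulrA big_split.
Qed.

Lemma eq_act_tensor Bs Cs psi : (forall j, Bs j = Cs j) ->
  act_tensor Bs psi = act_tensor Cs psi.
Proof.
move=> BC; apply/ffunP => s; rewrite !ffunE; apply: eq_bigr => t _; congr (_ * _).
by apply: eq_bigr => j _; rewrite BC.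
Qed.

Lemma act_tensor1 psi : act_tensor (fun=> 1%:M) psi = psi.
Proof.
apply/ffunP => -[s t]; rewrite ffunE /= (bigD1 t) //= !big1 => [|u /eqP ut|j _].
- by rewrite mul1r addr0.
- have [j tu] : exists j, t j != u j.
    apply/existsP; apply: contra_notT ut; rewrite negb_exists => /forallP h.
    by apply/ffunP => j; have := h j; rewrite negbK => /eqP.
  by rewrite (bigD1 j) //= mxE (negPf tu) !mul0r.
- by rewrite mxE eqxx.
Qed.

Lemma act_base_tensor A Bs psi :
  act_base A (act_tensor Bs psi) = act_tensor Bs (act_base A psi).
Proof.
apply/ffunP => s; rewrite !ffunE /=.
under eq_bigr => a _ do rewrite ffunE mulr_sumr.
under [RHS]eq_bigr => t _ do rewrite ffunE mulr_sumr.
by rewrite exchange_big; apply: eq_bigr => t _; apply: eq_bigr => a _ /=; rewrite mulrCA.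
Qed.

Lemma act_slot_linear_r j P : linear (act_slot j P : spinor R n r m -> _).
Proof. by move=> a psi chi; rewrite !act_slotE act_tensor_linear. Qed.

Lemma act_slotM j P Q psi : act_slot j P (act_slot j Q psi) = act_slot j (P *m Q) psi.
Proof.
rewrite !act_slotE act_tensorM; apply: eq_act_tensor => i.
by case: eqP; rewrite ?mul1mx.
Qed.

Lemma act_slot_comm i j P Q psi : i != j ->
  act_slot i P (act_slot j Q psi) = act_slot j Q (act_slot i P psi).
Proof.
move=> ij; rewrite !act_slotE !act_tensorM; apply: eq_act_tensor => l.
by have [->|_] := eqVneq l i; rewrite ?(negPf ij) ?mul1mx ?mulmx1.
Qed.

Lemma act_base_slot A j P psi :
  act_base A (act_slot j P psi) = act_slot j P (act_base A psi).
Proof. by rewrite !act_slotE act_base_tensor. Qed.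

(** Both sides are tensor products of matrices that agree slot by slot. This carries the
    equivariance of Clifford multiplication over to the tensor power. *)
Lemma act_slots_slot P Q Q' j psi : P *m Q = Q' *m P ->
  act_slots P (act_slot j Q psi) = act_slot j Q' (act_slots P psi).
Proof.
move=> PQ; rewrite !act_slotE -[act_slots P _]/(act_tensor (fun=> P) _).
rewrite -[act_slots P psi]/(act_tensor (fun=> P) psi) !act_tensorM.
by apply: eq_act_tensor => i; case: eqP; rewrite ?PQ ?mulmx1 ?mul1mx.
Qed.

Definition adj N (A : 'M[C]_N) : 'M[C]_N := map_mx Num.conj A^T.

Lemma adj_mul N (A B : 'M[C]_N) : adj (A *m B) = adj B *m adj A.
Proof. by rewrite /adj trmx_mul map_mxM. Qed.

Lemma herm_pair psi chi :
  herm psi chi = \sum_a \sum_(t : slots) psi (a, t) * Num.conj (chi (a, t)).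
Proof. by rewrite pair_bigA; apply: eq_bigr => -[]. Qed.

Lemma herm_base A psi chi : herm (act_base A psi) chi = herm psi (act_base (adj A) chi).
Proof.
rewrite !herm_pair exchange_big [RHS]exchange_big; apply: eq_bigr => t _ /=.
under eq_bigr => s _ do rewrite ffunE mulr_suml.
under [RHS]eq_bigr => s _ do rewrite ffunE rmorph_sum mulr_sumr.
rewrite exchange_big; apply: eq_bigr => a _; apply: eq_bigr => s _ /=.
by rewrite !mxE rmorphM /= conjCK mulrAC mulrC mulrA.
Qed.

Lemma herm_tensor Bs psi chi :
  herm (act_tensor Bs psi) chi = herm psi (act_tensor (fun j => adj (Bs j)) chi).
Proof.
rewrite !herm_pair; apply: eq_bigr => s _.
under eq_bigr => t _ do rewrite ffunE mulr_suml.
under [RHS]eq_bigr => t _ do rewrite ffunE rmorph_sum mulr_sumr.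
rewrite exchange_big; apply: eq_bigr => t _; apply: eq_bigr => u _ /=.
rewrite rmorphM rmorph_prod /=.
rewrite [in RHS](eq_bigr (fun j => Bs j (u j) (t j))) => [|j _]; last first.
  by rewrite !mxE conjCK.
by rewrite mulrAC mulrC mulrA.
Qed.

Lemma adj1 N : adj (1%:M : 'M[C]_N) = 1%:M.
Proof. by rewrite /adj trmx1 map_mx1. Qed.

Lemma herm_slot j P psi chi : herm (act_slot j P psi) chi = herm psi (act_slot j (adj P) chi).
Proof.
rewrite !act_slotE herm_tensor; congr (herm _ _); apply: eq_act_tensor => i.
by case: eqP; rewrite ?adj1.
Qed.

Lemma herm_linear chi : scalar (fun psi => herm psi chi).
Proof.
move=> a psi1 psi2; rewrite /herm mulr_sumr -big_split; apply: eq_bigr => s _ /=.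
by rewrite !ffunE mulrDl mulrA.
Qed.

Lemma hermC psi chi : herm chi psi = Num.conj (herm psi chi).
Proof.
by rewrite /herm rmorph_sum; apply: eq_bigr => s _; rewrite rmorphM /= conjCK mulrC.
Qed.

End SpinorOperators.

(** * Derivatives of spinors *)

Section LinearMaps.
Variables (K : pzRingType) (U V : lmodType K) (f : U -> V).
Hypothesis lf : linear f.

(** Bundles a bare proof of linearity, so that the general facts on linear maps apply to operators
    such as [act_base A] or [twist P]. *)
Let fL : {linear U -> V} := HB.pack f (GRing.isLinear.Build _ _ _ _ _ lf).

Lemma lin0 : f 0 = 0. Proof. exact: (linear0 fL). Qed.
Lemma linD x y : f (x + y) = f x + f y. Proof. exact: (linearD fL). Qed.
Lemma linB x y : f (x - y) = f x - f y. Proof. exact: (linearB fL). Qed.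
Lemma linN x : f (- x) = - f x. Proof. exact: (linearN fL). Qed.
Lemma linZ a x : f (a *: x) = a *: f x.
Proof. by rewrite -[a *: x]addr0 lf lin0 addr0. Qed.
Lemma lin_sum (I : Type) (s : seq I) (P : pred I) (F : I -> U) :
  f (\sum_(i <- s | P i) F i) = \sum_(i <- s | P i) f (F i).
Proof. exact: (linear_sum fL). Qed.

End LinearMaps.

Section Twist.
Variables (R : realType) (n r m : nat).
Local Notation C := R[i].
Implicit Types (psi chi : spinor R n r m) (A : 'M[C]_(2 ^ n./2)) (P Q : 'M[C]_(2 ^ r./2)).

(** The Lie algebra action on the tensor power, by the Leibniz rule; [tw_mul] is the case of a
    Clifford product of two vectors. *)
Definition twist P psi : spinor R n r m := \sum_(j < m) act_slot j P psi.

Lemma twist_linear_l psi : linear (fun P => twist P psi).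
Proof.
move=> a P Q; rewrite /twist scaler_sumr -big_split; apply: eq_bigr => j _.
exact: act_slot_linear_l.
Qed.

Lemma twist_linear_r P : linear (twist P).
Proof.
move=> a psi chi; rewrite /twist scaler_sumr -big_split; apply: eq_bigr => j _.
exact: act_slot_linear_r.
Qed.

Lemma act_base_twist A P psi : act_base A (twist P psi) = twist P (act_base A psi).
Proof.
rewrite (lin_sum (@act_base_linear_r _ _ _ _ A)); apply: eq_bigr => j _.
exact: act_base_slot.
Qed.

(** Operators in different slots commute, so only the terms with both operators in the same slot
    survive. *)
Lemma twist_comm P Q psi :
  twist P (twist Q psi) - twist Q (twist P psi) = twist (P *m Q - Q *m P) psi.
Proof.
have E (X Y : 'M[C]_(2 ^ r./2)) : twist X (twist Y psi) = \sum_i act_slot i (X *m Y) psi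
    + \sum_i \sum_(j | j != i) act_slot i X (act_slot j Y psi).
  rewrite -big_split; apply: eq_bigr => i _ /=.
  by rewrite (lin_sum (@act_slot_linear_r _ _ _ _ i X)) (bigD1 i) //= act_slotM.
have E2 : \sum_i \sum_(j | j != i) act_slot i P (act_slot j Q psi) =
          \sum_i \sum_(j | j != i) act_slot i Q (act_slot j P psi).
  rewrite (exchange_big_dep predT) //=; apply: eq_bigr => i _.
  apply: eq_big => [j|j ij]; first by rewrite eq_sym.
  by apply: act_slot_comm; rewrite eq_sym.
rewrite !E E2 opprD addrACA subrr addr0 -sumrB; apply: eq_bigr => j _.
by rewrite (linB (@act_slot_linear_l _ _ _ _ j psi)).
Qed.

Lemma herm_twist P psi chi : herm (twist P psi) chi = herm psi (twist (adj P) chi).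
Proof.
have hs (I : Type) (s : seq I) (F : I -> spinor R n r m) x :
  herm (\sum_(i <- s) F i) x = \sum_(i <- s) herm (F i) x.
  exact: (lin_sum (V := C^o) (@herm_linear _ _ _ _ x)).
rewrite hs hermC hs rmorph_sum; apply: eq_bigr => j _ /=.
by rewrite -hermC herm_slot.
Qed.

Definition conn_act A P psi := act_base A psi + twist P psi.

Lemma conn_act_linear A P : linear (conn_act A P).
Proof.
move=> a psi chi; rewrite /conn_act (@act_base_linear_r _ _ _ _ A) (@twist_linear_r P).
by rewrite scalerDr addrACA.
Qed.

Lemma conn_act_opp A P psi : conn_act A P (- psi) = - conn_act A P psi.
Proof. exact: linN (conn_act_linear A P) psi. Qed.

Lemma conn_actD A A' P P' psi :
  conn_act (A + A') (P + P') psi = conn_act A P psi + conn_act A' P' psi.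
Proof.
rewrite /conn_act (linD (@act_base_linear_l _ _ _ _ psi)) (linD (@twist_linear_l psi)).
by rewrite addrACA.
Qed.

Lemma conn_actN A P psi : conn_act (- A) (- P) psi = - conn_act A P psi.
Proof.
rewrite /conn_act (linN (@act_base_linear_l _ _ _ _ psi)) (linN (@twist_linear_l psi)).
by rewrite opprD.
Qed.

(** The two matrices act on different tensor factors and the cross terms cancel: [conn_act]
    represents the direct sum of two matrix Lie algebras. *)
Lemma conn_act_comm A A' P P' psi :
  conn_act A P (conn_act A' P' psi) - conn_act A' P' (conn_act A P psi) =
  conn_act (A *m A' - A' *m A) (P *m P' - P' *m P) psi.
Proof.
rewrite /conn_act -twist_comm (linB (@act_base_linear_l _ _ _ _ psi)).
rewrite !(linD (@act_base_linear_r _ _ _ _ _)) !(linD (@twist_linear_r _)).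
rewrite !act_baseM !act_base_twist.
by apply/ffunP => s; rewrite !ffunE; ring.
Qed.

End Twist.

Section ComplexDerivatives.
Variables (R : realType) (n : nat) (M : manifold R n) (c : chart M).
Variables (W : set M) (oW : open W) (Wc : W `<=` cdom c).
Local Notation C := R[i].
Implicit Types (h k : M -> C) (i j : 'I_n) (q : M).

Definition csmooth h : Prop :=
  smooth_fun W (fun q => complex.Re (h q)) /\ smooth_fun W (fun q => complex.Im (h q)).

Definition cder i h q : C :=
  Complex (coord_der c i (fun q => complex.Re (h q)) q)
          (coord_der c i (fun q => complex.Im (h q)) q).

Lemma cder_ext i h k q : W q -> (forall q, W q -> h q = k q) -> cder i h q = cder i k q.
Proof.
by move=> Wq hk; congr Complex; apply: (coord_der_ext oW i Wq (Wc Wq)) => q' Wq';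
   rewrite hk.
Qed.

Lemma csmooth_ext h k : (forall q, W q -> h q = k q) -> csmooth h -> csmooth k.
Proof.
by move=> hk [h1 h2]; split; [apply: smooth_fun_ext h1 => // q Wq|
  apply: smooth_fun_ext h2 => // q Wq]; rewrite hk.
Qed.

Lemma csmoothD h k : csmooth h -> csmooth k -> csmooth (fun q => h q + k q).
Proof.
move=> [h1 h2] [k1 k2]; split.
  by apply: smooth_fun_ext (smooth_funD oW h1 k1) => // q _; case: (h q); case: (k q).
by apply: smooth_fun_ext (smooth_funD oW h2 k2) => // q _; case: (h q); case: (k q).
Qed.

Lemma csmoothM h k : csmooth h -> csmooth k -> csmooth (fun q => h q * k q).
Proof.
move=> [h1 h2] [k1 k2]; split.
  apply: smooth_fun_ext (smooth_funD oW (smooth_funM oW h1 k1)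
    (smooth_funN oW (smooth_funM oW h2 k2))) => // q _.
  by case: (h q); case: (k q).
apply: smooth_fun_ext (smooth_funD oW (smooth_funM oW h1 k2) (smooth_funM oW h2 k1)) => // q _.
by case: (h q); case: (k q) => *; rewrite /= mulrC.
Qed.

Lemma csmooth_cst a : csmooth (fun=> a).
Proof. by split; apply: smooth_fun_cst. Qed.

Lemma csmooth_real (x : M -> R) : smooth_fun W x -> csmooth (fun q => real_complex R (x q)).
Proof. by move=> hx; split => //=; apply: smooth_fun_cst. Qed.

Lemma csmooth_sum (I : Type) (s : seq I) (F : I -> M -> C) :
  (forall a, csmooth (F a)) -> csmooth (fun q => \sum_(a <- s) F a q).
Proof.
move=> hF; elim: s => [|a s IH].
  by apply: csmooth_ext (csmooth_cst 0) => q _; rewrite big_nil.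
by apply: csmooth_ext (csmoothD (hF a) IH) => q _; rewrite big_cons.
Qed.

Lemma cderD i h k q : csmooth h -> csmooth k -> W q ->
  cder i (fun q => h q + k q) q = cder i h q + cder i k q.
Proof.
move=> [h1 h2] [k1 k2] Wq; have cq := Wc Wq; rewrite /cder.
rewrite (@coord_der_ext _ _ _ _ _ oW (fun q => complex.Re (h q + k q))
  (fun q => complex.Re (h q) + complex.Re (k q)) i q Wq cq) //; last first.
  by move=> q' _; case: (h q'); case: (k q').
rewrite (@coord_der_ext _ _ _ _ _ oW (fun q => complex.Im (h q + k q))
  (fun q => complex.Im (h q) + complex.Im (k q)) i q Wq cq) //; last first.
  by move=> q' _; case: (h q'); case: (k q').
by rewrite (coord_derD i Wq cq h1 k1) (coord_derD i Wq cq h2 k2).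
Qed.

Let leibnizE (x1 x2 y1 y2 a1 a2 b1 b2 : R) :
  Complex (x1 * b1 + y1 * a1 - (x2 * b2 + y2 * a2)) (x1 * b2 + y2 * a1 + (x2 * b1 + y1 * a2)) =
  Complex x1 x2 * Complex b1 b2 + Complex y1 y2 * Complex a1 a2.
Proof. by apply/eqP; rewrite eq_complex /=; apply/andP; split; apply/eqP; ring. Qed.

Lemma cderM i h k q : csmooth h -> csmooth k -> W q ->
  cder i (fun q => h q * k q) q = h q * cder i k q + k q * cder i h q.
Proof.
move=> [h1 h2] [k1 k2] Wq; have cq := Wc Wq; rewrite /cder.
have h1k1 := smooth_funM oW h1 k1; have h2k2 := smooth_funM oW h2 k2.
have h1k2 := smooth_funM oW h1 k2; have h2k1 := smooth_funM oW h2 k1.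
rewrite (@coord_der_ext _ _ _ _ _ oW (fun q => complex.Re (h q * k q))
  (fun q => complex.Re (h q) * complex.Re (k q)
               + - (complex.Im (h q) * complex.Im (k q))) i q Wq cq) //; last first.
  by move=> q' _; case: (h q'); case: (k q').
rewrite (@coord_der_ext _ _ _ _ _ oW (fun q => complex.Im (h q * k q))
  (fun q => complex.Re (h q) * complex.Im (k q)
               + complex.Im (h q) * complex.Re (k q)) i q Wq cq) //; last first.
  by move=> q' _; case: (h q'); case: (k q') => *; rewrite /= mulrC.
rewrite (coord_derD i Wq cq h1k1 (smooth_funN oW h2k2)) (coord_derD i Wq cq h1k2 h2k1).
rewrite (coord_derN i Wq cq h2k2) !(coord_derM i Wq cq) // leibnizE.
by case: (h q); case: (k q).
Qed.

Lemma cder_cst i a q : cder i (fun=> a) q = 0.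
Proof. by rewrite /cder !coord_der_cst. Qed.

Lemma cder_real i x q : cder i (fun q => real_complex R (x q)) q = real_complex R (coord_der c i x q).
Proof. by rewrite /cder /= coord_der_cst. Qed.

Lemma cder_sum i (I : Type) (s : seq I) (F : I -> M -> C) q :
  (forall a, csmooth (F a)) -> W q ->
  cder i (fun q => \sum_(a <- s) F a q) q = \sum_(a <- s) cder i (F a) q.
Proof.
move=> hF Wq; elim: s => [|a s IH].
  rewrite big_nil; apply: etrans (cder_cst i 0 q); apply: cder_ext => // q' _.
  by rewrite big_nil.
rewrite big_cons -IH -cderD //; last exact: csmooth_sum.
by apply: cder_ext => // q' _; rewrite big_cons.
Qed.

Lemma cder_comm i j h q : csmooth h -> W q ->
  cder i (cder j h) q = cder j (cder i h) q.
Proof.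
move=> [h1 h2] Wq; have e1 := coord_der_comm i j oW h1 Wq (Wc Wq).
have e2 := coord_der_comm i j oW h2 Wq (Wc Wq).
rewrite /cder /=. exact: (f_equal2 (@Complex R) e1 e2).
Qed.

Lemma cder_spin_mx N d (gam : 'I_d -> 'M[C]_N) (w : 'I_d -> 'I_d -> M -> R) i q a b :
  (forall x y, smooth_fun W (w x y)) -> W q ->
  csmooth (fun q => spin_mx gam (fun x y => real_complex R (w x y q)) a b) /\
  cder i (fun q => spin_mx gam (fun x y => real_complex R (w x y q)) a b) q =
  spin_mx gam (fun x y => real_complex R (coord_der c i (w x y) q)) a b.
Proof.
move=> hw Wq.
pose F x y q := real_complex R (w x y q) * (4^-1 * (gam x *m gam y) a b).
have hF x y : csmooth (F x y).
  by apply: csmoothM; [apply: csmooth_real|apply: csmooth_cst].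
have E u : spin_mx gam u a b = \sum_x \sum_y u x y * (4^-1 * (gam x *m gam y) a b).
  rewrite /spin_mx summxE; apply: eq_bigr => x _; rewrite summxE.
  by apply: eq_bigr => y _; rewrite mxE mulrA.
have hFF x : csmooth (fun q => \sum_y F x y q) by apply: csmooth_sum.
split; first by apply: csmooth_ext (csmooth_sum _ hFF) => q' _; rewrite E.
rewrite [RHS]E; transitivity (cder i (fun q => \sum_x \sum_y F x y q) q).
  by apply: cder_ext => // q' _; rewrite E.
rewrite cder_sum //; apply: eq_bigr => x _; rewrite cder_sum //; apply: eq_bigr => y _.
rewrite cderM //; [|exact: csmooth_real|exact: csmooth_cst].
by rewrite cder_cst mulr0 add0r cder_real mulrC.
Qed.

Variables (r m : nat).
Implicit Types psi : M -> spinor R n r m.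

Definition spinor_smooth psi : Prop := forall s, csmooth (fun q => psi q s).

Definition spinor_der i psi q : spinor R n r m := [ffun s => cder i (fun q => psi q s) q].

Lemma spinor_derE i psi q s : spinor_der i psi q s = cder i (fun q => psi q s) q.
Proof. by rewrite ffunE. Qed.

Lemma spinor_der_ext i psi psi' q : W q -> (forall q, W q -> psi q = psi' q) ->
  spinor_der i psi q = spinor_der i psi' q.
Proof.
move=> Wq pp; apply/ffunP => s; rewrite [LHS]spinor_derE [RHS]spinor_derE.
by apply: cder_ext => // q' /pp ->.
Qed.

Lemma spinor_der_comm i j psi q : spinor_smooth psi -> W q ->
  spinor_der i (spinor_der j psi) q = spinor_der j (spinor_der i psi) q.
Proof.
move=> hp Wq; apply/ffunP => s; rewrite [LHS]spinor_derE [RHS]spinor_derE.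
have e x : (fun q => spinor_der x psi q s) = cder x (fun q => psi q s).
  by apply/funext => q'; rewrite spinor_derE.
by rewrite (e i) (e j); apply: cder_comm.
Qed.

Lemma spinor_der_base i (B : M -> 'M[C]_(2 ^ n./2)) psi q :
  (forall a b, csmooth (fun q => B q a b)) -> spinor_smooth psi -> W q ->
  spinor_smooth (fun q => act_base (B q) (psi q)) /\
  spinor_der i (fun q => act_base (B q) (psi q)) q =
  act_base (\matrix_(a, b) cder i (fun q => B q a b) q) (psi q) + act_base (B q) (spinor_der i psi q).
Proof.
move=> hB hp Wq; split.
  move=> s; have hs := csmooth_sum (index_enum _) (fun a => csmoothM (hB s.1 a) (hp (a, s.2))).
  by apply: csmooth_ext hs => q' _; rewrite ffunE.
apply/ffunP => s; rewrite [LHS]spinor_derE [RHS]ffunE ![act_base _ _ s]ffunE.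
transitivity (cder i (fun q => \sum_a B q s.1 a * psi q (a, s.2)) q).
  by apply: cder_ext => // q' _; rewrite ffunE.
rewrite cder_sum //; last by move=> a; apply: csmoothM.
rewrite -big_split; apply: eq_bigr => a _ /=.
by rewrite cderM // mxE spinor_derE addrC [psi q _ * _]mulrC.
Qed.

Lemma spinor_der_twist i (B : M -> 'M[C]_(2 ^ r./2)) psi q :
  (forall a b, csmooth (fun q => B q a b)) -> spinor_smooth psi -> W q ->
  spinor_smooth (fun q => twist (B q) (psi q)) /\
  spinor_der i (fun q => twist (B q) (psi q)) q =
  twist (\matrix_(a, b) cder i (fun q => B q a b) q) (psi q) + twist (B q) (spinor_der i psi q).
Proof.
move=> hB hp Wq.
pose F (s : 'I_(2 ^ n./2) * {ffun 'I_m -> 'I_(2 ^ r./2)}) (l : 'I_m) b q :=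
  B q (s.2 l) b * psi q (s.1, [ffun x => if x == l then b else s.2 x]).
have E q' s : twist (B q') (psi q') s = \sum_l \sum_b F s l b q'.
  by rewrite sum_ffunE; apply: eq_bigr => l _; rewrite ffunE.
have hF s l b : csmooth (F s l b) by apply: csmoothM.
have hFF s l : csmooth (fun q => \sum_b F s l b q) by apply: csmooth_sum.
split; first by move=> s; apply: csmooth_ext (csmooth_sum _ (hFF s)) => q' _; rewrite E.
apply/ffunP => s; rewrite [LHS]spinor_derE [RHS]ffunE.
transitivity (cder i (fun q => \sum_l \sum_b F s l b q) q).
  by apply: cder_ext => // q' _; rewrite E.
rewrite !sum_ffunE -big_split cder_sum //; apply: eq_bigr => l _ /=.
rewrite ![act_slot _ _ _ s]ffunE -big_split cder_sum //; apply: eq_bigr => b _ /=.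
by rewrite cderM // mxE spinor_derE addrC [psi q _ * _]mulrC.
Qed.

End ComplexDerivatives.

(** * The curvature annihilates a parallel spinor *)

Section ParallelSpinors.
Variables (R : realType) (n r m : nat) (M : manifold R n) (gM : M -> 'M[R]_n).
Variables (F : vbundle M r) (gF : M -> 'M[R]_r).
Hypotheses (hgM : bundle_metric (tangent M) gM) (hgF : bundle_metric F gF).
Variables (gn : 'I_n -> 'M[R[i]]_(2 ^ n./2)) (gr : 'I_r -> 'M[R[i]]_(2 ^ r./2)).
Hypotheses (hgn : clifford_rep gn) (hgr : clifford_rep gr).
Variables (LC : covder M n) (DF : covder M r).
Hypotheses (hLC : metric_connection (tangent M) gM LC) (hDF : metric_connection F gF DF).
Hypothesis hF : framed_bundle F.
Variables (kd : spin_kind) (P : spin_bundle gM F gF kd) (phi : P -> spinor R n r m).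
Hypotheses (hphi : spinor_field gn gr phi) (hpar : parallel gn gr LC DF phi).
Local Notation C := R[i].

Lemma kappa_vec_delta d (g : 'I_d -> 'M[C]_(2 ^ d./2)) i :
  kappa_vec g (delta_mx i 0) = g i.
Proof.
rewrite /kappa_vec (bigD1 i) //= big1 => [|j ji].
  by rewrite addr0 mxE !eqxx /re_scale scale1r.
by rewrite mxE (negPf ji) /re_scale scale0r.
Qed.

(** Matches the sum over [a < b] with factor 1/2 in [nabla_theta]: [w] and the products of distinct
    generators are both skew, and the diagonal drops out since [w a a = 0]. *)
Lemma spin_mx_lt d N (g : 'I_d -> 'M[C]_N) (w : 'I_d -> 'I_d -> R) :
  (forall a b, g a *m g b + g b *m g a = (if a == b then - 2 else 0)%:M) ->
  (forall a b, w b a = - w a b) ->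
  spin_mx g (fun a b => real_complex R (w a b)) =
  \sum_(a < d) \sum_(b < d | (a < b)%N) re_scale (w a b / 2) (g a *m g b).
Proof.
move=> hg sw; have w0 a : w a a = 0.
  by apply/eqP; have /eqP := sw a a; rewrite -subr_eq0 opprK -mulr2n mulrn_eq0.
rewrite /spin_mx sum_lt_sym.
- rewrite -sumrMnl; apply: eq_bigr => a _; rewrite -sumrMnl; apply: eq_bigr => b _.
  rewrite /re_scale scalerMnl rmorphM fmorphV; congr (_ *: _).
  by rewrite /= -mulr_natr (rmorph_nat (real_complex R) 2); field.
- move=> a b; have [->//|ab] := eqVneq a b.
  rewrite (sw a b) rmorphN mulNr scaleNr -scalerN; congr (_ *: _); apply/eqP.
  rewrite eq_sym -addr_eq0 hg (negPf ab); apply/eqP.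
  by apply/matrixP => x y; rewrite !mxE mul0rn.
- by move=> a; rewrite w0 rmorph0 mul0r scale0r.
Qed.

Let real_complex_curv d (x y : R) (u v w z : 'I_d -> R) :
  real_complex R (x - y + \sum_k (u k * v k - w k * z k)) =
  real_complex R x + -1 * real_complex R y
  + \sum_k (real_complex R (u k) * real_complex R (v k)
           - real_complex R (w k) * real_complex R (z k)).
Proof.
rewrite rmorphD rmorphB rmorph_sum mulN1r; congr (_ + _).
by apply: eq_bigr => k _; rewrite rmorphB !rmorphM.
Qed.

Section Trivialisation.
Variables (j : sp_triv P) (p0 : M).
Hypothesis jp0 : sp_dom j p0.
Let c := chart_at p0.
Let W := sp_dom j `&` cdom c.
Let oW : open W. Proof. by apply: openI; [exact: (@sp_open _ _ _ _ _ _ _ _ P j)|exact: cdom_open]. Qed.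
Let Wc : W `<=` cdom c. Proof. by move=> q []. Qed.
Let Wp : W p0. Proof. by split => //; apply: chart_at_dom. Qed.
Let e := sp_frameM (s := P) \o sp_sec (s := P) j.
Let f := sp_frameF (s := P) \o sp_sec (s := P) j.
Let psi q := phi (sp_sec j q).
Let he : orthonormal_frame (tangent M) gM W e.
Proof. by apply: frame_sub (sp_frame_smooth j).1 => q []. Qed.
Let hf : orthonormal_frame F gF W f.
Proof. by apply: frame_sub (sp_frame_smooth j).2 => q []. Qed.
Let hT := framed_tangent M.
Let hcM : is_connection (tangent M) LC. Proof. by case: hLC. Qed.
Let hcF : is_connection F DF. Proof. by case: hDF. Qed.

Let om i a b := conn_coef LC p0 gM e i a b.
Let th i a b := conn_coef DF p0 gF f i a b.
Let AM i q := spin_mx gn (fun a b => real_complex R (om i a b q)).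
Let AF i q := spin_mx gr (fun a b => real_complex R (th i a b q)).

Let hom i a b : smooth_fun W (om i a b).
Proof. exact: (conn_coef_smooth hT hcM oW Wc hgM he i a b). Qed.
Let hth i a b : smooth_fun W (th i a b).
Proof. exact: (conn_coef_smooth hF hcF oW Wc hgF hf i a b). Qed.

Lemma parallel_smooth : spinor_smooth W psi.
Proof.
move=> s; case: hphi => _ /(_ j s)[h1 h2].
by split; [apply: smooth_fun_sub h1|apply: smooth_fun_sub h2] => q [].
Qed.

(** The parallel equation evaluated on the i-th coordinate field, where the connection forms become
    [conn_coef]. *)
Lemma parallel_der i q : W q ->
  spinor_der c i psi q = - conn_act (AM i q) (AF i q) (psi q).
Proof.
move=> Wq; apply/eqP; rewrite -addr_eq0; apply/eqP.
have jq : sp_dom j q by case: Wq.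
have som a b : om i b a q = - om i a b q by apply: (conn_coef_skew hT oW Wc hgM hLC he).
have sth a b : th i b a q = - th i a b q by apply: (conn_coef_skew hF oW Wc hgF hDF hf).
rewrite -(hpar jq (coord_field p0 i q)) /nabla_theta -addrA; congr (_ + _).
  apply/ffunP => s; rewrite spinor_derE [RHS]ffunE.
  have [h1 h2] := parallel_smooth s.
  by rewrite (dirder_coord_field i oW h1 Wq (Wc Wq)) (dirder_coord_field i oW h2 Wq (Wc Wq)).
rewrite /conn_act /AM /AF !spin_mx_lt //; try by [case: hgn|case: hgr]; congr (_ + _).
  rewrite (lin_sum (@act_base_linear_l _ _ _ _ (psi q))); apply: eq_bigr => a _.
  rewrite (lin_sum (@act_base_linear_l _ _ _ _ (psi q))); apply: eq_bigr => b _.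
  rewrite (linZ (@act_base_linear_l _ _ _ _ (psi q))) /clmul !kappa_vec_delta act_baseM.
  by [].
rewrite (lin_sum (@twist_linear_l _ _ _ _ (psi q))); apply: eq_bigr => a _.
rewrite (lin_sum (@twist_linear_l _ _ _ _ (psi q))); apply: eq_bigr => b _.
by rewrite (linZ (@twist_linear_l _ _ _ _ (psi q))) /tw_mul !kappa_vec_delta.
Qed.

Lemma spinor_derN i (chi : M -> spinor R n r m) q : spinor_smooth W chi -> W q ->
  spinor_der c i (fun q => - chi q) q = - spinor_der c i chi q.
Proof.
move=> hchi Wq.
(* Negation is treated as the action of the constant matrix -1, whose derivative vanishes. *)
have hB a b : csmooth W (fun q : M => ((- 1)%:M : 'M[C]_(2 ^ n./2)) a b) by apply: csmooth_cst.
have [_ h] := spinor_der_base oW Wc i hB hchi Wq.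
transitivity (spinor_der c i (fun q => act_base (- 1)%:M (chi q)) q).
  by apply: (spinor_der_ext oW Wc) => // q' _; rewrite act_base_scalar scaleN1r.
rewrite h act_base_scalar scaleN1r (_ : \matrix_(_, _) _ = 0) ?(lin0 (@act_base_linear_l _ _ _ _ _)) ?add0r //.
by apply/matrixP => a b; rewrite !mxE cder_cst.
Qed.

Lemma spinor_derD i (chi chi' : M -> spinor R n r m) q :
  spinor_smooth W chi -> spinor_smooth W chi' -> W q ->
  spinor_der c i (fun q => chi q + chi' q) q = spinor_der c i chi q + spinor_der c i chi' q.
Proof.
move=> h h' Wq; apply/ffunP => s; rewrite [LHS]spinor_derE [RHS]ffunE !spinor_derE.
rewrite -(cderD oW Wc i (h s) (h' s) Wq); apply: (cder_ext oW Wc) => // q' _.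
by rewrite ffunE.
Qed.

Let dAM i l := spin_mx gn (fun a b => real_complex R (coord_der c i (om l a b) p0)).
Let dAF i l := spin_mx gr (fun a b => real_complex R (coord_der c i (th l a b) p0)).

(** Differentiate [- A_l psi], then substitute [- A_i psi] for the derivative of [psi]: the
    quadratic term is [A_l A_i psi], with the indices in the order opposite to that of
    differentiation. *)
Lemma parallel_der2 i l : spinor_der c i (spinor_der c l psi) p0 =
  - conn_act (dAM i l) (dAF i l) (psi p0)
  + conn_act (AM l p0) (AF l p0) (conn_act (AM i p0) (AF i p0) (psi p0)).
Proof.
have hM a b : csmooth W (fun q => AM l q a b).
  by case: (@cder_spin_mx _ _ _ c _ oW Wc _ _ gn (om l) i p0 a b (hom l) Wp).
have hA a b : csmooth W (fun q => AF l q a b).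
  by case: (@cder_spin_mx _ _ _ c _ oW Wc _ _ gr (th l) i p0 a b (hth l) Wp).
have hp := parallel_smooth.
have [s1 d1] := spinor_der_base oW Wc i hM hp Wp.
have [s2 d2] := spinor_der_twist oW Wc i hA hp Wp.
rewrite (@spinor_der_ext _ _ _ c _ oW Wc _ _ i _
  (fun q => - (act_base (AM l q) (psi q) + twist (AF l q) (psi q))) p0) //; last first.
  by move=> q Wq; rewrite parallel_der.
rewrite spinor_derN //; last first.
  move=> s; apply: csmooth_ext (csmoothD oW (s1 s) (s2 s)) => // q _.
  by rewrite [RHS]ffunE.
rewrite (spinor_derD i s1 s2 Wp) d1 d2 (parallel_der i Wp).
rewrite (_ : \matrix_(_, _) _ = dAM i l); last first.
  apply/matrixP => a b; rewrite mxE.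
  by case: (@cder_spin_mx _ _ _ c _ oW Wc _ _ gn (om l) i p0 a b (hom l) Wp).
rewrite (_ : \matrix_(_, _) _ = dAF i l); last first.
  apply/matrixP => a b; rewrite mxE.
  by case: (@cder_spin_mx _ _ _ c _ oW Wc _ _ gr (th l) i p0 a b (hth l) Wp).
rewrite addrACA opprD -/(conn_act _ _ _) -/(conn_act (AM l p0) _ _).
by rewrite conn_act_opp opprK.
Qed.

Definition frame_curvM i l a b : R :=
  inner gM p0 (coord_curv LC p0 i l (fun q => col a (e q)) p0) (col b (e p0)).
Definition frame_curvF i l a b : R :=
  inner gF p0 (coord_curv DF p0 i l (fun q => col a (f q)) p0) (col b (f p0)).

(** Symmetry of the second derivatives leaves [d_i A_l - d_l A_i + [A_i, A_l]] annihilating the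
    spinor. By [spin_mx_comm] the bracket is again a [spin_mx], and the total coefficients are those
    of the structure equation. *)
Lemma parallel_curvature i l :
  conn_act (spin_mx gn (fun a b => real_complex R (frame_curvM i l a b)))
           (spin_mx gr (fun a b => real_complex R (frame_curvF i l a b))) (psi p0) = 0.
Proof.
have := spinor_der_comm oW Wc i l parallel_smooth Wp; rewrite !parallel_der2 => h.
have som x a b : om x b a p0 = - om x a b p0 by apply: (conn_coef_skew hT oW Wc hgM hLC he).
have sth x a b : th x b a p0 = - th x a b p0 by apply: (conn_coef_skew hF oW Wc hgF hDF hf).
have EM : spin_mx gn (fun a b => real_complex R (frame_curvM i l a b)) =
    dAM i l - dAM l i + (AM i p0 *m AM l p0 - AM l p0 *m AM i p0).
  rewrite [X in _ + X]spin_mx_comm; last first.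
  - by move=> a b; rewrite som rmorphN.
  - by move=> a b; rewrite som rmorphN.
  - by case: hgn.
  rewrite -[- dAM l i]scaleN1r -spin_mxZ -!spin_mxD; apply: eq_bigr => a _.
  apply: eq_bigr => b _; congr ((_ / 4) *: _).
  have eM := curvature_form hT hcM oW Wc hgM he i l a b Wp.
  exact: etrans (congr1 (real_complex R) eM) (real_complex_curv _ _ _ _ _ _).
have EF : spin_mx gr (fun a b => real_complex R (frame_curvF i l a b)) =
    dAF i l - dAF l i + (AF i p0 *m AF l p0 - AF l p0 *m AF i p0).
  rewrite [X in _ + X]spin_mx_comm; last first.
  - by move=> a b; rewrite sth rmorphN.
  - by move=> a b; rewrite sth rmorphN.
  - by case: hgr.
  rewrite -[- dAF l i]scaleN1r -spin_mxZ -!spin_mxD; apply: eq_bigr => a _.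
  apply: eq_bigr => b _; congr ((_ / 4) *: _).
  have eF := curvature_form hF hcF oW Wc hgF hf i l a b Wp.
  exact: etrans (congr1 (real_complex R) eF) (real_complex_curv _ _ _ _ _ _).
rewrite EM EF conn_actD conn_actD conn_actN -conn_act_comm.
have E (V : zmodType) (x y x' y' : V) : - x + y = - x' + y' -> x - x' + (y' - y) = 0.
  by move=> exy; rewrite [x - x']addrC addrACA -exy [- x + y]addrC -[x - y]opprB subrr.
exact: E h.
Qed.

End Trivialisation.
End ParallelSpinors.

(** * The spin group *)

Section SpinGroup.
Variables (R : realType) (n : nat).
Local Notation C := R[i].
Local Notation N := (2 ^ n./2)%N.
Variables (gam : 'I_n -> 'M[C]_N) (hgam : clifford_rep gam).
Implicit Types (x y : 'cV[R]_n) (A B : {set 'I_n}) (X Y : clifford R n).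
Local Notation kap := (kappa gam).
Local Notation kv := (kappa_vec gam).
Local Notation "x %:RC" := (real_complex R x) (at level 2, format "x %:RC").

Let gamC i j : gam i *m gam j + gam j *m gam i = (if i == j then - 2 else 0)%:M.
Proof. by case: hgam. Qed.

Lemma gam_sq i : gam i *m gam i = (-1)%:M.
Proof.
have /eqP := gamC i i; rewrite eqxx -mulr2n => /eqP h.
apply: (@scalerI _ _ (2 : C)); first by rewrite pnatr_eq0.
by rewrite scaler_nat h scale_scalar_mx mulrN1.
Qed.

Lemma gam_anti i j : i != j -> gam i *m gam j = - (gam j *m gam i).
Proof.
move=> /negPf ij; apply/eqP; rewrite -addr_eq0 gamC ij.
by apply/eqP/matrixP => a b; rewrite !mxE mul0rn.
Qed.

(** Taken over an arbitrary list, so that induction on the list is possible; [gam_sign] is the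
    corresponding part of [cl_sign]. *)
Definition gam_prod (s : seq 'I_n) B : 'M[C]_N := \big[mulmx/1%:M]_(j <- s | j \in B) gam j.

Definition gam_sign (i : 'I_n) (s : seq 'I_n) B : R :=
  \prod_(b <- s | b \in B) (if (b <= i)%N then -1 else 1).

Lemma gam_prod_notin (i : 'I_n) s B : i \notin s -> gam_prod s (symdiff [set i]%SET B) = gam_prod s B.
Proof.
move=> is_; rewrite /gam_prod big_seq_cond [RHS]big_seq_cond; apply: eq_bigl => j.
case: (boolP (j \in s)) => //= js; rewrite in_symdiff finset.in_set1.
by case: eqP js => // ->; rewrite (negPf is_).
Qed.

Lemma gam_sign_above (i : 'I_n) s B : all (fun j : 'I_n => (i < j)%N) s -> gam_sign i s B = 1.
Proof.
move=> /allP h; rewrite /gam_sign big_seq_cond big1 // => j /andP[/h ij _].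
by rewrite leqNgt ij.
Qed.

(** Moving [gam i] to its place in the increasing product costs a sign for each smaller factor; if
    [gam i] already occurs, its square contributes one more. *)
Lemma gam_mul_prod i s B : sorted (fun a b : 'I_n => (a < b)%N) s -> i \in s ->
  gam i *m gam_prod s B = (gam_sign i s B)%:RC *: gam_prod s (symdiff [set i]%SET B).
Proof.
elim: s => // a s IH /=; rewrite path_sortedE; last by move=> x y z; apply: ltn_trans.
move=> /andP[as_ ss]; rewrite inE => /orP[/eqP ia|is_].
  rewrite -{}ia in as_ *.
  have nis : i \notin s by apply/negP => /(allP as_); rewrite ltnn.
  rewrite /gam_prod /gam_sign !big_cons in_symdiff finset.in_set1 eqxx addTb.
  rewrite -/(gam_sign i s B) gam_sign_above //.
  rewrite -/(gam_prod s _) -/(gam_prod s _) gam_prod_notin //.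
  case: (i \in B) => /=; last by rewrite scale1r.
  by rewrite leqnn mulr1 mulmxA gam_sq mul_scalar_mx rmorphN rmorph1.
have ai : (a < i)%N := allP as_ _ is_.
have anei : a != i by apply/eqP => ai'; rewrite ai' ltnn in ai.
rewrite /gam_prod /gam_sign !big_cons in_symdiff finset.in_set1 (negPf anei) addFb.
rewrite -/(gam_sign i s B) -/(gam_prod s _) -/(gam_prod s _) (ltnW ai).
case: (a \in B) => /=; last exact: IH.
rewrite mulmxA gam_anti 1?eq_sym // mulNmx -mulmxA IH // -scalemxAr -scaleNr.
by rewrite mulN1r rmorphN.
Qed.

Lemma kappa_basis B : kap (cl_basis R B) = gam_prod (index_enum 'I_n) B.
Proof.
rewrite /kappa (bigD1 B) //= big1 => [|A AB].
  by rewrite ffunE eqxx /re_scale rmorph1 scale1r addr0.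
by rewrite ffunE (negPf AB) /re_scale rmorph0 scale0r.
Qed.

Lemma kappaD X Y : kap (X + Y) = kap X + kap Y.
Proof.
rewrite /kappa -big_split; apply: eq_bigr => A _ /=.
by rewrite ffunE /re_scale rmorphD scalerDl.
Qed.

Lemma kappaZ a X : kap (a *: X) = a%:RC *: kap X.
Proof.
rewrite /kappa scaler_sumr; apply: eq_bigr => A _ /=.
by rewrite ffunE /re_scale scalerA -rmorphM.
Qed.

Lemma kappa0 : kap 0 = 0.
Proof. by rewrite -(scale0r (0 : clifford R n)) kappaZ rmorph0 scale0r. Qed.

Lemma kappa_sum (I : Type) (s : seq I) (P : pred I) (E : I -> clifford R n) :
  kap (\sum_(i <- s | P i) E i) = \sum_(i <- s | P i) kap (E i).
Proof. by apply: (big_morph kap kappaD kappa0). Qed.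

Lemma cl_expand X : X = \sum_A X A *: cl_basis R A.
Proof.
apply/ffunP => B; rewrite sum_ffunE (bigD1 B) //= big1 => [|A AB].
  by rewrite !ffunE eqxx addr0; apply: esym; apply: mulr1.
by rewrite !ffunE eq_sym (negPf AB); apply: mulr0.
Qed.

Lemma clZE a X A : (a *: X) A = a * X A.
Proof. exact: ffunE. Qed.

Lemma cl_scalerAl a X Y : (a *: X) * Y = a *: (X * Y).
Proof.
apply/ffunP => D; rewrite clZE [LHS]ffunE [(X * Y) D]ffunE mulr_sumr.
by apply: eq_bigr => E _; rewrite clZE; ring.
Qed.

Lemma cl_scalerAr a X Y : X * (a *: Y) = a *: (X * Y).
Proof.
apply/ffunP => D; rewrite clZE [LHS]ffunE [(X * Y) D]ffunE mulr_sumr.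
by apply: eq_bigr => E _; rewrite clZE; ring.
Qed.

(** [kappa] is given on a basis, so its multiplicativity is a statement about signs. Left
    multiplication by generators is the case to treat, since spin elements are products of
    vectors. *)
Lemma kappa_gen i X : kap (cl_basis R [set i]%SET * X) = gam i *m kap X.
Proof.
rewrite [X]cl_expand mulr_sumr !kappa_sum mulmx_sumr; apply: eq_bigr => B _.
rewrite cl_scalerAr.
rewrite !kappaZ -scalemxAr; congr (_ *: _).
rewrite cl_basisM kappaZ !kappa_basis gam_mul_prod.
- by rewrite /cl_sign big_set1 /gam_sign.
- have -> : index_enum 'I_n = enum 'I_n by rewrite enumT.
  rewrite -[sorted _ _]/(sorted (relpre (@nat_of_ord n) ltn) _) -sorted_map.
  by rewrite val_enum_ord iota_ltn_sorted.
- exact: mem_index_enum.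
Qed.

Lemma kappa_vecM x X : kap (cl_vec x * X) = kv x *m kap X.
Proof.
rewrite /cl_vec mulr_suml kappa_sum /kappa_vec mulmx_suml; apply: eq_bigr => i _.
by rewrite cl_scalerAl kappaZ kappa_gen -scalemxAl.
Qed.

Lemma kappa1 : kap 1 = 1%:M.
Proof.
rewrite -[1]/(cl_basis R finset.set0) kappa_basis /gam_prod big_pred0 // => j.
exact: finset.in_set0.
Qed.

Lemma kappa_clvec x : kap (cl_vec x) = kv x.
Proof. by rewrite -[cl_vec x]mulr1 kappa_vecM kappa1 mulmx1. Qed.

Lemma kappa_prodM (s : seq 'cV[R]_n) X :
  kap (\prod_(x <- s) cl_vec x * X) = kap (\prod_(x <- s) cl_vec x) *m kap X.
Proof.
elim: s X => [|x s IH] X; first by rewrite big_nil mul1r kappa1 mul1mx.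
by rewrite big_cons -mulrA !kappa_vecM IH mulmxA.
Qed.

Lemma adj_kappa_vec x : adj (kv x) = - kv x.
Proof.
apply/matrixP => a b; rewrite !mxE !summxE rmorph_sum -sumrN; apply: eq_bigr => i _.
case: hgam => _ /(_ i)/matrixP/(_ a b); rewrite !mxE => h.
by rewrite rmorphM /= h mulrN; congr (- (_ * _)); apply: conjc_real.
Qed.

Lemma kappa_vec_anti x y : kv x *m kv y + kv y *m kv x = (- 2 * ((x^T *m y) 0 0)%:RC)%:M.
Proof.
rewrite /kappa_vec !mulmx_suml.
under eq_bigr => i _ do rewrite mulmx_sumr.
under [X in _ + X]eq_bigr => i _ do rewrite mulmx_sumr.
rewrite [X in _ + X]exchange_big -big_split /=.
have -> : (- 2 * ((x^T *m y) 0 0)%:RC)%:M =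
   \sum_i (- 2 * ((x i 0)%:RC * (y i 0)%:RC))%:M :> 'M[C]_N.
  rewrite mxE rmorph_sum mulr_sumr raddf_sum; apply: eq_bigr => i _.
  by rewrite mxE rmorphM.
apply: eq_bigr => i _; rewrite -big_split (bigD1 i) //= big1 => [|j ji].
  rewrite addr0 -!scalemxAl -!scalemxAr !scalerA [(y i 0)%:RC * _]mulrC -scalerDr.
  by rewrite gamC eqxx scale_scalar_mx mulrC.
rewrite -!scalemxAl -!scalemxAr !scalerA [(y j 0)%:RC * _]mulrC -scalerDr.
rewrite gamC eq_sym (negPf ji) scale_scalar_mx mulr0.
by apply/matrixP => a b; rewrite !mxE mul0rn.
Qed.

(** A unit vector acts by a skew-Hermitian matrix of square -1. *)
Lemma kappa_vec_unit x : x^T *m x = 1%:M -> adj (kv x) *m kv x = 1%:M.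
Proof.
move=> x1; have := kappa_vec_anti x x; rewrite x1 mxE eqxx rmorph1 mulr1 -mulr2n => h.
rewrite adj_kappa_vec mulNmx; apply: (@scalerI _ _ (2 : C)); first by rewrite pnatr_eq0.
rewrite scaler_nat mulNrn h; apply/matrixP => a b; rewrite !mxE.
by case: (a == b); rewrite ?mulr1n ?mulr0n; ring.
Qed.

Lemma kappa_spin_unitary g : spin g -> adj (kap g) *m kap g = 1%:M.
Proof.
case=> s [_ s1 ->]; elim: s s1 => [|x s IH] s1; first by rewrite big_nil kappa1 adj1 mulmx1.
rewrite big_cons kappa_vecM adj_mul -mulmxA (mulmxA (adj (kv x))) kappa_vec_unit ?mul1mx.
  by apply: IH => y ys; apply: s1; rewrite inE ys orbT.
by apply: s1; rewrite inE eqxx.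
Qed.

Lemma cl_vec_set1 x i : cl_vec x [set i]%SET = x i 0.
Proof.
rewrite /cl_vec sum_ffunE (bigD1 i) //= big1 => [|j ji].
  by rewrite !ffunE eqxx addr0; apply: mulr1.
rewrite !ffunE (_ : _ == _ = false); first exact: mulr0.
by apply/eqP => /finset.set1_inj ij; rewrite ij eqxx in ji.
Qed.

Lemma cl_vec_linear : linear (@cl_vec R n).
Proof.
move=> a x y; rewrite /cl_vec scaler_sumr -big_split; apply: eq_bigr => i _ /=.
by rewrite !mxE scalerDl scalerA.
Qed.

Lemma cl_vec_anti x y :
  cl_vec x * cl_vec y + cl_vec y * cl_vec x = (- 2 * (x^T *m y) 0 0) *: (1 : clifford R n).
Proof.
rewrite /cl_vec !mulr_suml.
under eq_bigr => i _ do rewrite mulr_sumr.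
under [X in _ + X]eq_bigr => i _ do rewrite mulr_sumr.
rewrite [X in _ + X]exchange_big -big_split /=.
rewrite mxE mulr_sumr scaler_suml; apply: eq_bigr => i _.
have E j : x i 0 *: cl_basis R [set i]%SET * (y j 0 *: cl_basis R [set j]%SET) +
  y j 0 *: cl_basis R [set j]%SET * (x i 0 *: cl_basis R [set i]%SET) =
  (x i 0 * y j 0) *: (if i == j then - 2 else 0 : clifford R n).
  rewrite !cl_scalerAl !cl_scalerAr !scalerA [y j 0 * _]mulrC -scalerDr.
  by rewrite cl_generators.
rewrite -big_split (bigD1 i) //= big1 => [|j ji].
  rewrite addr0 E eqxx mxE [- 2 * _]mulrC -[RHS]scalerA; congr (_ *: _).
  by rewrite scaleNr scaler_nat.
by rewrite E eq_sym (negPf ji) scaler0.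
Qed.

(** The Clifford relation gives [x y x = - 2 <x, y> x + |x|^2 y]; for a unit vector [x] this is the
    reflection in the hyperplane orthogonal to [x]. *)
Lemma cl_vec_conj x y : exists z, cl_vec x * cl_vec y * cl_vec x = cl_vec z.
Proof.
have := cl_vec_anti x x; rewrite -mulr2n => e2.
have e3 : cl_vec x * cl_vec x = (- (x^T *m x) 0 0) *: (1 : clifford R n).
  apply: (@scalerI _ _ (2 : R)); first by rewrite pnatr_eq0.
  by rewrite scaler_nat e2 scalerA mulrN mulNr.
exists ((- 2 * (x^T *m y) 0 0) *: x + (x^T *m x) 0 0 *: y).
have -> : cl_vec x * cl_vec y =
    (- 2 * (x^T *m y) 0 0) *: (1 : clifford R n) - cl_vec y * cl_vec x.
  by rewrite -cl_vec_anti addrK.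
rewrite mulrBl -mulrA e3 cl_scalerAl mul1r cl_scalerAr mulr1 scaleNr opprK.
by rewrite cl_vec_linear (linZ cl_vec_linear).
Qed.

End SpinGroup.

(** * Reversal, the covering of SO(n), and equivariance of Clifford multiplication *)

Section SpinCover.
Variables (R : realType) (n : nat).
Local Notation C := R[i].
Variables (gam : 'I_n -> 'M[C]_(2 ^ n./2)) (hgam : clifford_rep gam).
Implicit Types (x y : 'cV[R]_n) (B : {set 'I_n}) (X Y : clifford R n).
Local Notation kap := (kappa gam).
Local Notation kv := (kappa_vec gam).

Lemma cl_rev_linear : linear (@cl_rev R n).
Proof.
move=> a X Y; apply/ffunP => A; rewrite [RHS]ffunE [LHS]ffunE [(a *: X + Y) A]ffunE !clZE.
by rewrite ![cl_rev _ A]ffunE; ring.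
Qed.

Lemma cl_rev_basis B : cl_rev (cl_basis R B) = (-1) ^+ 'C(#|B|, 2) *: cl_basis R B.
Proof.
apply/ffunP => A; rewrite clZE !ffunE; case: eqP => [->//|_]; by rewrite !mulr0.
Qed.

(** Exchanging e_i with e_B costs a sign for each element of [B] other than [i], and
    ['C(k.+1, 2) + 'C(k, 2)] has the parity of [k]. This is why the signs in [cl_rev] reverse
    products. *)
Lemma cl_sign_swap (i : 'I_n) B :
  cl_sign R [set i]%SET B * cl_sign R B [set i]%SET =
  (-1) ^+ 'C(#|symdiff [set i]%SET B|, 2) * (-1) ^+ 'C(#|B|, 2).
Proof.
have -> : cl_sign R [set i]%SET B * cl_sign R B [set i]%SET = (-1) ^+ #|B :\ i|.
  rewrite /cl_sign big_set1; under [X in _ * X]eq_bigr => a _ do rewrite big_set1.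
  rewrite -big_split /= -prodr_const.
  rewrite (big_setID [set i]%SET) /= [X in X * _]big1 ?mul1r => [|a].
    apply: eq_bigr => a; rewrite !inE => /andP[ai _].
    case: (ltngtP a i) => [_|_|/val_inj e]; rewrite ?mulr1 ?mul1r //.
    by rewrite e eqxx in ai.
  by rewrite !inE => /andP[_ /eqP ->]; rewrite leqnn mulrNN mulr1.
have bin2S k : ('C(k.+1, 2) + 'C(k, 2))%N = (k + 'C(k, 2).*2)%N.
  by rewrite binS bin1 -addnn; ring.
have E k : (-1) ^+ 'C(k.+1, 2) * (-1) ^+ 'C(k, 2) = (-1) ^+ k :> R.
  by rewrite -exprD bin2S exprD -mul2n exprM sqrrN !expr1n mulr1.
have [iB|iB] := boolP (i \in B).
  have -> : symdiff [set i]%SET B = B :\ i.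
    apply/finset.setP => j; rewrite in_symdiff !inE.
    by have [->|] := eqVneq j i; rewrite ?iB // addFb.
  have cB : #|B| = #|B :\ i|.+1 by rewrite (cardsD1 i) iB.
  by rewrite cB -E mulrC.
have -> : symdiff [set i]%SET B = i |: B.
  apply/finset.setP => j; rewrite in_symdiff !inE.
  by have [->|] := eqVneq j i; rewrite ?(negPf iB).
rewrite cardsU1 iB E; congr (_ ^+ _); apply: eq_card => j; rewrite !inE.
by have [->|] := eqVneq j i; rewrite ?(negPf iB).
Qed.

Lemma cl_rev_gen i X :
  cl_rev (cl_basis R [set i]%SET * X) = cl_rev X * cl_basis R [set i]%SET.
Proof.
rewrite {1}[X]cl_expand [in RHS](cl_expand X) mulr_sumr !(lin_sum cl_rev_linear) mulr_suml.
apply: eq_bigr => B _; rewrite cl_scalerAr !(linZ cl_rev_linear) cl_scalerAl; congr (_ *: _).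
rewrite cl_basisM (linZ cl_rev_linear) !cl_rev_basis cl_scalerAl cl_basisM !scalerA.
have -> : symdiff B [set i]%SET = symdiff [set i]%SET B.
  by apply/finset.setP => j; rewrite !in_symdiff addbC.
congr (_ *: _); set s1 := cl_sign R _ B; set s2 := cl_sign R B _.
have h : s1 * s2 = _ := cl_sign_swap i B.
have q2 : s2 * s2 = 1 := cl_sign_sq _ B _.
have -> : s1 = s1 * s2 * s2 by rewrite -mulrA q2 mulr1.
rewrite h; set a := (-1) ^+ 'C(#|symdiff _ _|, 2); set b := (-1) ^+ _.
have -> : a * b * s2 * a = a * a * (b * s2) by ring.
by rewrite /a -expr2 -exprM mulnC exprM sqrrN !expr1n mul1r.
Qed.

Lemma cl_rev_vecM x X : cl_rev (cl_vec x * X) = cl_rev X * cl_vec x.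
Proof.
rewrite /cl_vec mulr_suml (lin_sum cl_rev_linear) mulr_sumr; apply: eq_bigr => i _.
by rewrite cl_scalerAl (linZ cl_rev_linear) cl_rev_gen cl_scalerAr.
Qed.

Lemma cl_rev1 : cl_rev 1 = 1 :> clifford R n.
Proof. by rewrite -[1]/(cl_basis R finset.set0) cl_rev_basis cards0 scale1r. Qed.

Lemma cl_rev_prod (s : seq 'cV[R]_n) :
  cl_rev (\prod_(x <- s) cl_vec x) = \prod_(x <- rev s) cl_vec x.
Proof.
elim: s => [|x s IH]; first by rewrite !big_nil cl_rev1.
by rewrite big_cons cl_rev_vecM IH rev_cons -cats1 big_cat big_seq1.
Qed.

(** The product is a palindrome around [y]; it is built from the middle outwards by
    [cl_vec_conj]. *)
Lemma cl_prod_conj (s : seq 'cV[R]_n) y : exists z,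
  (\prod_(x <- s) cl_vec x) * cl_vec y * cl_rev (\prod_(x <- s) cl_vec x) = cl_vec z.
Proof.
elim: s => [|x s [z zE]]; first by exists y; rewrite big_nil cl_rev1 mul1r mulr1.
have [w wE] := cl_vec_conj x z; exists w.
by rewrite big_cons cl_rev_vecM -wE -zE !mulrA.
Qed.

(** The adjoint also reverses products, with one sign per vector. A spin element has an even number
    of vectors, so its reversal acts as the adjoint. *)
Lemma kappa_rev (s : seq 'cV[R]_n) : kap (cl_rev (\prod_(x <- s) cl_vec x)) =
  (-1) ^+ size s *: adj (kap (\prod_(x <- s) cl_vec x)).
Proof.
elim: s => [|x s IH]; first by rewrite big_nil cl_rev1 kappa1 adj1 scale1r.
have h := kappa_prodM hgam (rev s) (cl_vec x); rewrite -cl_rev_prod in h.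
rewrite big_cons cl_rev_vecM h IH (kappa_clvec hgam).
rewrite (kappa_vecM hgam) adj_mul adj_kappa_vec // mulmxN -scalemxAl /= exprS mulN1r.
by rewrite scaleNr scalerN opprK.
Qed.

(** [spin_cover] records only the coefficients on the vectors e_i; nothing is lost because the
    conjugate of a vector is a vector. *)
Lemma spin_cover_vec g y : spin g ->
  g * cl_vec y * cl_rev g = cl_vec (spin_cover g *m y).
Proof.
case=> s [_ _ gE]; have [z zE] := cl_prod_conj s y; rewrite -gE in zE.
rewrite zE; congr cl_vec; apply/matrixP => i j; rewrite ord1 -cl_vec_set1 -zE.
rewrite /cl_vec mulr_sumr mulr_suml sum_ffunE mxE; apply: eq_bigr => k _.
by rewrite cl_scalerAr cl_scalerAl clZE [spin_cover _ _ _]mxE mulrC.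
Qed.

Lemma kappa_spin_unitary_r g : spin g -> kap g *m adj (kap g) = 1%:M.
Proof. by move=> hg; apply: mulmx1C; apply: kappa_spin_unitary. Qed.

Lemma kappa_cover g y : spin g -> kap g *m kv y = kv (spin_cover g *m y) *m kap g.
Proof.
move=> hg; have [s [es _ gE]] := hg.
have := congr1 kap (spin_cover_vec y hg); rewrite (kappa_clvec hgam) => <-.
rewrite gE -mulrA (kappa_prodM hgam) (kappa_vecM hgam) kappa_rev -signr_odd (negPf es) scale1r.
by rewrite -gE -!mulmxA kappa_spin_unitary // mulmx1.
Qed.

(** Orthogonality is read off the matrices: conjugation by the unitary [kap g] fixes the scalar
    matrix [kv x *m kv y + kv y *m kv x], which encodes the scalar product. *)
Lemma spin_cover_inner g x y : spin g ->
  (spin_cover g *m x)^T *m (spin_cover g *m y) = x^T *m y.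
Proof.
move=> hg; apply/matrixP => i j; rewrite !ord1.
set a := LHS; set b := RHS.
have comm (K X Y X' Y' : 'M[C]_(2 ^ n./2)) : K *m X = X' *m K -> K *m Y = Y' *m K ->
    (X' *m Y' + Y' *m X') *m K = K *m (X *m Y + Y *m X).
  by move=> kx ky; rewrite mulmxDl mulmxDr -!mulmxA -kx -ky !mulmxA kx ky.
have e : (- 2 * real_complex R a)%:M = (- 2 * real_complex R b)%:M :> 'M[C]_(2 ^ n./2).
  rewrite -[LHS]mulmx1 -[RHS]mulmx1 -(kappa_spin_unitary_r hg).
  rewrite [LHS]mulmxA [RHS]mulmxA; congr (_ *m _).
  rewrite -[RHS]scalar_mxC -!(kappa_vec_anti hgam).
  exact: comm (kappa_cover x hg) (kappa_cover y hg).
(* The matrices have positive size, so a scalar matrix determines its scalar. *)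
have i0 : 'I_(2 ^ n./2) by exists 0%N; rewrite expn_gt0.
have := congr1 (fun A : 'M[C]_(2 ^ n./2) => A i0 i0) e; rewrite !mxE eqxx !mulr1n.
move/mulfI => h; apply: (fmorph_inj (real_complex R)); apply: h.
by rewrite oppr_eq0 pnatr_eq0.
Qed.

End SpinCover.

(** * Equivariance and unitarity of the action on twisted spinors *)

Section SpinAction.
Variables (R : realType) (n r m : nat).
Local Notation C := R[i].
Variables (gn : 'I_n -> 'M[C]_(2 ^ n./2)) (gr : 'I_r -> 'M[C]_(2 ^ r./2)).
Hypotheses (hgn : clifford_rep gn) (hgr : clifford_rep gr).
Implicit Types (g : clifford R n * clifford R r) (psi chi : spinor R n r m).

Lemma spin_act_tensor g psi :
  spin_act gn gr g psi = act_base (kappa gn g.1) (act_tensor (fun=> kappa gr g.2) psi).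
Proof. by []. Qed.

Lemma spin_act_linear g : linear (spin_act gn gr g : spinor R n r m -> _).
Proof.
by move=> a psi chi; rewrite !spin_act_tensor act_tensor_linear act_base_linear_r.
Qed.

Lemma spin_act_clmul g x psi : spin2 g ->
  spin_act gn gr g (clmul gn x psi) = clmul gn (spin_cover g.1 *m x) (spin_act gn gr g psi).
Proof.
move=> [h1 _]; rewrite !spin_act_tensor /clmul -act_base_tensor !act_baseM.
by rewrite kappa_cover.
Qed.

Lemma spin_act_tw g y z psi : spin2 g ->
  spin_act gn gr g (tw_mul gr y z psi) =
  tw_mul gr (spin_cover g.2 *m y) (spin_cover g.2 *m z) (spin_act gn gr g psi).
Proof.
move=> [_ h2]; rewrite /tw_mul (lin_sum (spin_act_linear g)); apply: eq_bigr => j _.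
rewrite /spin_act -act_base_slot; congr act_base; apply: act_slots_slot.
by rewrite mulmxA kappa_cover // -!mulmxA kappa_cover.
Qed.

Lemma spin_act_wedge g x y psi : spin2 g ->
  spin_act gn gr g (wedge_mul gn x y psi) =
  wedge_mul gn (spin_cover g.1 *m x) (spin_cover g.1 *m y) (spin_act gn gr g psi).
Proof.
move=> h; rewrite /wedge_mul (linD (spin_act_linear g)) /re_scale (linZ (spin_act_linear g)).
by rewrite (spin_act_clmul x _ h) (spin_act_clmul y _ h) (spin_cover_inner hgn x y h.1).
Qed.

Lemma spin_act_herm g psi chi : spin2 g ->
  herm (spin_act gn gr g psi) (spin_act gn gr g chi) = herm psi chi.
Proof.
move=> [h1 h2]; rewrite !spin_act_tensor herm_base act_baseM kappa_spin_unitary //.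
rewrite act_base_scalar scale1r herm_tensor act_tensorM; congr (herm _ _).
rewrite (@eq_act_tensor _ _ _ _ _ (fun=> 1%:M)) ?act_tensor1 // => j.
exact: kappa_spin_unitary.
Qed.

End SpinAction.

Section SpinorFields.
Variables (R : realType) (n r m : nat) (M : manifold R n) (gM : M -> 'M[R]_n).
Variables (F : vbundle M r) (gF : M -> 'M[R]_r).
Variables (gn : 'I_n -> 'M[R[i]]_(2 ^ n./2)) (gr : 'I_r -> 'M[R[i]]_(2 ^ r./2)).
Hypotheses (hgn : clifford_rep gn) (hgr : clifford_rep gr).
Variables (kd : spin_kind) (P : spin_bundle gM F gF kd) (phi : P -> spinor R n r m).
Hypothesis hphi : spinor_field gn gr phi.

Lemma spinor_norm2_fibre u v : sp_proj u = sp_proj v -> norm2 (phi u) = norm2 (phi v).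
Proof.
move=> /sp_orbit[g hg ->]; case: hphi => /(_ u g hg) -> _.
by rewrite /norm2 spin_act_herm.
Qed.

(** Replacing [u] by [sp_act u g] changes the spinor by the inverse of [kappa g], and the
    coordinates of vectors by the inverse of [spin_cover g]; equivariance and unitarity of
    [spin_act] absorb both. *)
Lemma eta_form_fibre u v f k l : sp_proj u = sp_proj v ->
  eta_form gn gr phi u f k l = eta_form gn gr phi v f k l.
Proof.
move=> /sp_orbit[g hg ->]; case: hphi => /(_ u g hg) pu _.
have [fM fF] := sp_frame_equivariant u hg.
have [pM pF] := sp_frame_positive u.
have [qM qF] := sp_frame_positive (sp_act u g).
have cov d (A B : 'M[R]_d) (x : 'cV[R]_d) : 0 < \det A -> 0 < \det (A *m B) ->
    invmx A *m x = B *m (invmx (A *m B) *m x).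
  move=> dA dAB; have uA : A \in unitmx by rewrite unitmxE unitfE gt_eqF.
  have uAB : A *m B \in unitmx by rewrite unitmxE unitfE gt_eqF.
  apply: (can_inj (mulKmx uA)); rewrite mulKVmx // !mulmxA.
  by rewrite mulmxV // mul1mx.
rewrite fM in qM; rewrite fF in qF.
apply/matrixP => a b; rewrite !mxE fM fF pu.
rewrite !(cov _ _ _ _ pM qM) !(cov _ _ _ _ pF qF).
by rewrite -spin_act_tw // -spin_act_wedge // spin_act_herm.
Qed.

End SpinorFields.

(** * The Ricci identity at a point *)

Section PointwiseIdentity.
Variables (R : realType) (n r m : nat).
Local Notation C := R[i].
Variables (gn : 'I_n -> 'M[C]_(2 ^ n./2)) (gr : 'I_r -> 'M[C]_(2 ^ r./2)).
Hypotheses (hgn : clifford_rep gn) (hgr : clifford_rep gr).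
Implicit Types (psi chi : spinor R n r m).
Local Notation "x %:RC" := (real_complex R x) (at level 2, format "x %:RC").

Lemma conj_real (x : R) : Num.conj x%:RC = x%:RC.
Proof. exact: conjc_real. Qed.

Lemma Re_real_mul (x : R) (z : C) : complex.Re (x%:RC * z) = x * complex.Re z.
Proof. by case: z => a b; rewrite /= mul0r subr0. Qed.

Lemma complexReD (z w : C) : complex.Re (z + w) = complex.Re z + complex.Re w.
Proof. by case: z; case: w. Qed.

Lemma complexRe_sum (I : Type) (s : seq I) (F : I -> C) :
  complex.Re (\sum_(i <- s) F i) = \sum_(i <- s) complex.Re (F i).
Proof. by apply: (big_morph (@complex.Re R) complexReD). Qed.

Lemma complexRe_conj (z : C) : complex.Re (Num.conj z) = complex.Re z.
Proof. by case: z. Qed.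

Lemma complexReN (z : C) : complex.Re (- z) = - complex.Re z.
Proof. by case: z. Qed.

Lemma adj_gam d (g : 'I_d -> 'M[C]_(2 ^ d./2)) i : clifford_rep g -> adj (g i) = - g i.
Proof. by case=> _; apply. Qed.

Lemma adj_linear_real N a (A B : 'M[C]_N) : adj (a%:RC *: A + B) = a%:RC *: adj A + adj B.
Proof. by apply/matrixP => i j; rewrite !mxE rmorphD rmorphM /= conj_real. Qed.

Lemma adjD N (A B : 'M[C]_N) : adj (A + B) = adj A + adj B.
Proof. by apply/matrixP => i j; rewrite !mxE rmorphD. Qed.

Lemma adj0 N : adj (0 : 'M[C]_N) = 0.
Proof. by apply/matrixP => i j; rewrite !mxE rmorph0. Qed.

Lemma adj_spin_mx d (g : 'I_d -> 'M[C]_(2 ^ d./2)) (w : 'I_d -> 'I_d -> R) :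
  clifford_rep g -> (forall a b, w b a = - w a b) ->
  adj (spin_mx g (fun a b => (w a b)%:RC)) = - spin_mx g (fun a b => (w a b)%:RC).
Proof.
move=> hg sw; rewrite /spin_mx [X in adj X]exchange_big /= (big_morph _ (@adjD _) (@adj0 _)) -sumrN.
apply: eq_bigr => a _; rewrite (big_morph _ (@adjD _) (@adj0 _)) -sumrN.
apply: eq_bigr => b _.
have -> : (w b a)%:RC / 4 = (w b a / 4)%:RC.
  by rewrite rmorphM fmorphV (rmorph_nat (real_complex R) 4).
have -> : (w a b)%:RC / 4 = (w a b / 4)%:RC.
  by rewrite rmorphM fmorphV (rmorph_nat (real_complex R) 4).
rewrite -[X in adj X]addr0 adj_linear_real adj0 addr0 adj_mul !adj_gam // mulNmx mulmxN opprK.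
by rewrite (sw a b) mulNr rmorphN scaleNr.
Qed.

Lemma herm_conn_act A Q psi chi :
  herm (conn_act A Q psi) chi = herm psi (conn_act (adj A) (adj Q) chi).
Proof.
rewrite /conn_act (linD (V := C^o) (@herm_linear _ _ _ _ chi)) herm_base herm_twist.
rewrite [RHS]hermC (linD (V := C^o) (@herm_linear _ _ _ _ psi)) rmorphD /=.
by rewrite -!hermC.
Qed.

Lemma Re_hermZ a psi chi : complex.Re (herm (a%:RC *: psi) chi) = a * complex.Re (herm psi chi).
Proof. by rewrite (linZ (V := C^o) (@herm_linear _ _ _ _ chi)); apply: Re_real_mul. Qed.

Lemma hermNr psi chi : herm psi (- chi) = - herm psi chi.
Proof. by rewrite hermC (linN (V := C^o) (@herm_linear _ _ _ _ psi)) rmorphN /= -hermC. Qed.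

Definition wedge_mx x y : 'M[C]_(2 ^ n./2) := gn x *m gn y + ((x == y)%:R)%:M.

(** The components of eta^phi in the frames carried by a point of the spin bundle; they make sense
    for [k = l] too, which permits sums over all pairs. *)
Definition eta_comp psi k l x y : R :=
  complex.Re (herm (act_base (wedge_mx x y) (twist (gr k *m gr l) psi)) psi).

Lemma wedge_mxC x y : wedge_mx y x = - wedge_mx x y.
Proof.
apply/eqP; rewrite -addr_eq0 /wedge_mx addrACA [y == x]eq_sym.
case: hgn => -> _; rewrite [y == x]eq_sym; case: (x == y).
  by apply/eqP/matrixP => i j; rewrite !mxE; case: (i == j); rewrite ?mulr1n ?mulr0n; ring.
by apply/eqP/matrixP => i j; rewrite !mxE; case: (i == j); rewrite ?mulr1n ?mulr0n; ring.
Qed.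

Lemma adj_wedge_mx x y : adj (wedge_mx x y) = - wedge_mx x y.
Proof.
rewrite -wedge_mxC /wedge_mx adjD adj_mul !adj_gam // mulNmx mulmxN opprK [y == x]eq_sym.
congr (_ + _); apply/matrixP => i j; rewrite !mxE [j == i]eq_sym.
by case: (x == y); case: (i == j); rewrite ?mulr1n ?mulr0n ?rmorph1 ?rmorph0.
Qed.

Lemma eta_comp_skew_form psi k l x y : eta_comp psi k l y x = - eta_comp psi k l x y.
Proof.
rewrite /eta_comp wedge_mxC (linN (@act_base_linear_l _ _ _ _ _)).
by rewrite (linN (V := C^o) (@herm_linear _ _ _ _ psi)) complexReN.
Qed.

(** By the Clifford relation for [gr], the sum of the two components is a real multiple of the real
    part of <wedge psi, psi>, which vanishes since [wedge_mx] is skew-Hermitian. In particular the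
    components with [k = l] are zero. *)
Lemma eta_comp_skew psi k l x y : eta_comp psi l k x y = - eta_comp psi k l x y.
Proof.
apply/eqP; rewrite -addr_eq0 /eta_comp -complexReD -(linD (V := C^o) (@herm_linear _ _ _ _ psi)).
rewrite -(linD (@act_base_linear_r _ _ _ _ _)) -(linD (@twist_linear_l _ _ _ _ psi)).
case: hgr => -> _.
have tw_scalar a : twist a%:M psi = m%:R *: (a *: psi) :> spinor R n r m.
  rewrite /twist (eq_bigr (fun=> a *: psi)) => [|j _].
    by rewrite sumr_const card_ord scaler_nat.
  apply/ffunP => -[s t]; rewrite ffunE (bigD1 (t j)) //= big1 => [|b /negPf bt].
    rewrite mxE eqxx addr0 [RHS]ffunE; congr (_ * psi (_, _)).
    by apply/ffunP => i; rewrite ffunE; case: eqP => // ->.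
  by rewrite mxE eq_sym bt mul0r.
rewrite tw_scalar scalerA.
have -> : m%:R * (if l == k then - 2 else 0) = (m%:R * (if l == k then - 2 else 0))%:RC.
  by case: eqP => _; rewrite ?mulr0 ?rmorph0 // rmorphM rmorphN !(rmorph_nat (real_complex R)).
rewrite (linZ (@act_base_linear_r _ _ _ _ _)) (linZ (V := C^o) (@herm_linear _ _ _ _ psi)).
rewrite [_ *: herm _ _]/(_ * _) Re_real_mul; apply/eqP.
set h := complex.Re _; suff -> : h = 0 by rewrite mulr0.
have : h = - h.
  rewrite {1}/h herm_base adj_wedge_mx (linN (@act_base_linear_l _ _ _ _ _)) hermC complexRe_conj.
  by rewrite (linN (V := C^o) (@herm_linear _ _ _ _ psi)) complexReN.
by move/eqP; rewrite -subr_eq0 opprK -mulr2n mulrn_eq0 => /eqP.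
Qed.

(** Polarisation: the [gn] being skew-Hermitian, twice the left-hand side is minus the expectation
    of the anticommutator of [gn a] and [gn z], a scalar matrix. *)
Lemma Re_herm_gam psi a z :
  complex.Re (herm (act_base (gn a) psi) (act_base (gn z) psi)) = (a == z)%:R * norm2 psi.
Proof.
have E x y : herm (act_base (gn x) psi) (act_base (gn y) psi) =
             - herm (act_base (gn y *m gn x) psi) psi.
  by rewrite -act_baseM [in RHS]herm_base adj_gam // (linN (@act_base_linear_l _ _ _ _ _)) hermNr opprK.
set h := complex.Re _.
have h2 : h + h = - complex.Re (herm (act_base (gn z *m gn a + gn a *m gn z) psi) psi).
  rewrite {1}/h E complexReN /h -[herm (act_base (gn a) psi) _]conjCK -hermC E complexRe_conj complexReN.
  rewrite (linD (@act_base_linear_l _ _ _ _ _)) (linD (V := C^o) (@herm_linear _ _ _ _ _)) complexReD.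
  by rewrite opprD.
case: hgn h2 => -> _; rewrite act_base_scalar (linZ (V := C^o) (@herm_linear _ _ _ _ _)).
rewrite eq_sym [_ *: herm _ _]/(_ * _).
have -> : (if a == z then - 2 else 0 : C) = (if a == z then - 2 else 0 : R)%:RC.
  by case: eqP => _; rewrite ?rmorphN ?(rmorph_nat (real_complex R) 2) ?rmorph0.
rewrite Re_real_mul -/(norm2 psi).
by case: (a == z) => /= h2; rewrite ?mul1r ?mul0r; lra.
Qed.

Variables (psi : spinor R n r m).
Variables (Om : 'I_n -> 'I_n -> 'I_n -> 'I_n -> R) (Th : 'I_n -> 'I_n -> 'I_r -> 'I_r -> R).
Hypothesis Om12 : forall x y a b, Om y x a b = - Om x y a b.
Hypothesis Om34 : forall x y a b, Om x y b a = - Om x y a b.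
Hypothesis Om_bianchi : forall x y a b, Om x y a b + Om y a x b + Om a x y b = 0.
Hypothesis Th34 : forall x y k l, Th x y l k = - Th x y k l.
Hypothesis curv0 : forall x y, conn_act (spin_mx gn (fun a b => (Om x y a b)%:RC))
  (spin_mx gr (fun k l => (Th x y k l)%:RC)) psi = 0.

(* Contracting the curvature identity with Clifford multiplication turns the
   Riemannian part into the Ricci tensor, by the Bianchi identity. *)
Lemma gam_contraction x : \sum_y gn y *m spin_mx gn (fun a b => (Om x y a b)%:RC) =
  - (2^-1 *: \sum_a (\sum_y Om y x a y)%:RC *: gn a).
Proof.
have pair := curvature_pair_symmetry Om12 Om34 Om_bianchi.
have gC : forall a b, gn a *m gn b + gn b *m gn a = (if a == b then - 2 else 0)%:M.
  by case: hgn.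
have := @cubic_contraction _ _ _ _ gC (fun y a b => (Om x y a b)%:RC).
have -> : \sum_y gn y *m spin_mx gn (fun a b => (Om x y a b)%:RC) =
  4^-1 *: \sum_y \sum_a \sum_b (Om x y a b)%:RC *: (gn y *m (gn a *m gn b)).
  rewrite scaler_sumr; apply: eq_bigr => y _; rewrite mulmx_sumr scaler_sumr.
  apply: eq_bigr => a _; rewrite mulmx_sumr scaler_sumr; apply: eq_bigr => b _.
  by rewrite -scalemxAr scalerA mulrC.
move=> ->.
- have -> : \sum_b (\sum_a (Om x a b a)%:RC) *: gn b = - \sum_a (\sum_y Om y x a y)%:RC *: gn a.
    rewrite -sumrN; apply: eq_bigr => a _; rewrite -scaleNr -rmorphN -sumrN rmorph_sum.
    by congr (_ *: _); apply: eq_bigr => y _; rewrite -Om12.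
  by rewrite !scalerN scalerA; congr (- (_ *: _)); field.
- by move=> a b c; rewrite -rmorphN -Om34.
(* The contraction needs the cyclic identity in the last three indices, Bianchi gives it in the
   first three; pair symmetry exchanges them. *)
- move=> a b c; rewrite -!rmorphD.
  rewrite (pair x a b c) (pair x b c a) (pair x c a b).
  rewrite (Om34 b c a x) (Om34 c a b x) (Om34 a b c x).
  have e : Om b c a x + Om c a b x + Om a b c x = 0 by rewrite addrC addrA Om_bianchi.
  by apply: etrans (rmorph0 (real_complex R)); congr (real_complex R); lra.
Qed.

(** The factor 1/2 is the 1/4 of [spin_mx] divided by the 1/2 of [gam_contraction]; it disappears
    when ordered pairs [k], [l] are replaced by [k < l]. *)
Lemma ricci_identity x z : (\sum_y Om y x z y) * norm2 psi =
  2^-1 * \sum_k \sum_l \sum_y Th x y k l * eta_comp psi k l y z.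
Proof.
have eS : \sum_a (\sum_y Om y x a y)%:RC *: act_base (gn a) psi =
          \sum_a act_base ((\sum_y Om y x a y)%:RC *: gn a) psi.
  by apply: eq_bigr => a _; rewrite (linZ (@act_base_linear_l _ _ _ _ psi)).
have e0 : - (2^-1 *: \sum_a (\sum_y Om y x a y)%:RC *: act_base (gn a) psi) +
   \sum_y act_base (gn y) (twist (spin_mx gr (fun k l => (Th x y k l)%:RC)) psi) = 0.
  have : \sum_y act_base (gn y) (conn_act (spin_mx gn (fun a b => (Om x y a b)%:RC))
     (spin_mx gr (fun k l => (Th x y k l)%:RC)) psi) = 0.
    by rewrite big1 // => y _; rewrite curv0 (lin0 (@act_base_linear_r _ _ _ _ _)).
  under eq_bigr => y _ do rewrite /conn_act (linD (@act_base_linear_r _ _ _ _ _)) act_baseM.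
  rewrite big_split /= -(lin_sum (@act_base_linear_l _ _ _ _ psi)) gam_contraction.
  rewrite (linN (@act_base_linear_l _ _ _ _ psi)) (linZ (@act_base_linear_l _ _ _ _ psi)).
  rewrite (lin_sum (@act_base_linear_l _ _ _ _ psi)) eS; exact.
have hl chi : linear (fun chi' => herm chi' chi : C^o) := @herm_linear _ _ _ _ chi.
have hy y : complex.Re (herm (act_base (gn y)
    (twist (spin_mx gr (fun k l => (Th x y k l)%:RC)) psi)) (act_base (gn z) psi)) =
    4^-1 * \sum_k \sum_l Th x y k l * eta_comp psi k l y z.
  set S := spin_mx gr _; set chi := twist S psi.
  (* The twisting operator is skew-Hermitian, so the scalar term that turns [gn z *m gn y] into
     [wedge_mx z y] does not affect the real part. *)
  have S0 : complex.Re (herm chi psi) = 0.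
    have hs : herm chi psi = - herm psi chi.
      rewrite [LHS]herm_twist (adj_spin_mx hgr (Th34 x y)).
      by rewrite [in LHS](linN (@twist_linear_l _ _ _ _ psi)) [LHS]hermNr.
    have := congr1 (@complex.Re R) hs; rewrite complexReN [herm psi chi]hermC complexRe_conj.
    by move/eqP; rewrite -subr_eq0 opprK -mulr2n mulrn_eq0 => /eqP.
  have -> : herm (act_base (gn y) chi) (act_base (gn z) psi) =
            - herm (act_base (gn z) (act_base (gn y) chi)) psi.
    by rewrite [in RHS]herm_base adj_gam // (linN (@act_base_linear_l _ _ _ _ psi)) hermNr opprK.
  have -> : act_base (gn z) (act_base (gn y) chi) =
            act_base (wedge_mx z y) chi - ((z == y)%:R : R)%:RC *: chi.
    rewrite act_baseM -act_base_scalar -(linB (@act_base_linear_l _ _ _ _ chi)).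
    by rewrite /wedge_mx (rmorph_nat (real_complex R)) addrK.
  rewrite (linB (hl _)) complexReN complexReD complexReN Re_hermZ S0 mulr0 subr0.
  rewrite wedge_mxC (linN (@act_base_linear_l _ _ _ _ chi)) (linN (hl _)) complexReN opprK.
  rewrite /chi /S /spin_mx (lin_sum (@twist_linear_l _ _ _ _ psi)).
  rewrite (lin_sum (@act_base_linear_r _ _ _ _ _)) (lin_sum (hl _)) complexRe_sum mulr_sumr.
  apply: eq_bigr => k _; rewrite (lin_sum (@twist_linear_l _ _ _ _ psi)).
  rewrite (lin_sum (@act_base_linear_r _ _ _ _ _)) (lin_sum (hl _)) complexRe_sum mulr_sumr.
  apply: eq_bigr => l _; rewrite (linZ (@twist_linear_l _ _ _ _ psi)).
  rewrite (linZ (@act_base_linear_r _ _ _ _ _)).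
  rewrite (_ : _ / 4 = (4^-1 * Th x y k l)%:RC); last first.
    by rewrite mulrC rmorphM fmorphV (rmorph_nat (real_complex R) 4).
  by rewrite Re_hermZ mulrA.
have h1 : complex.Re (herm (2^-1 *: \sum_a (\sum_y Om y x a y)%:RC *: act_base (gn a) psi)
    (act_base (gn z) psi)) = 2^-1 * ((\sum_y Om y x z y) * norm2 psi).
  have -> : (2^-1 : C) = (2^-1)%:RC by rewrite fmorphV (rmorph_nat (real_complex R) 2).
  rewrite Re_hermZ (lin_sum (hl _)) complexRe_sum.
  congr (_ * _); rewrite (bigD1 z) //= [X in _ + X]big1 => [|a /negPf az].
    by rewrite addr0 Re_hermZ Re_herm_gam eqxx mul1r.
  by rewrite Re_hermZ Re_herm_gam az mul0r mulr0.
have := congr1 (fun chi => complex.Re (herm chi (act_base (gn z) psi))) e0.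
rewrite (linD (hl _)) (linN (hl _)) (lin_sum (hl _)) (lin0 (hl _)) complexReD complexReN h1 complexRe_sum.
rewrite (eq_bigr _ (fun y _ => hy y)) -mulr_sumr.
have -> : \sum_y \sum_k \sum_l Th x y k l * eta_comp psi k l y z =
          \sum_k \sum_l \sum_y Th x y k l * eta_comp psi k l y z.
  by rewrite exchange_big; apply: eq_bigr => k _; rewrite exchange_big.
have halves (a b : R) : - (2^-1 * a) + 4^-1 * b = 0 -> a = 2^-1 * b by lra.
exact: halves.
Qed.

End PointwiseIdentity.

(** * Constancy of the norm *)

Section LocallyConstant.
Variables (R : realType) (n : nat) (M : manifold R n).

Lemma coord_der_eq0_near (c : chart M) (W : set M) (f : M -> R) p0 :
  open W -> W p0 -> W `<=` cdom c -> smooth_fun W f ->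
  (forall i q, W q -> coord_der c i f q = 0) -> \forall q \near p0, f q = f p0.
Proof.
move=> oW Wp Wc hf f0; have cp := Wc _ Wp; pose h := f \o cparam c.
have oV := @open_chart_image _ _ M W c oW.
have Vp : (ccoord c @` (W `&` cdom c)) (ccoord c p0) by apply: chart_image.
have /nbhs_ballP[e e0 eV] : nbhs (ccoord c p0) (ccoord c @` (W `&` cdom c)).
  by apply: open_nbhs_nbhs.
have dh y : ball (ccoord c p0) e y -> differentiable h y.
  by move=> /eV Vy; apply: smooth_on_differentiable (hf c) Vy.
have hE : forall y, ball (ccoord c p0) e y -> h y = h (ccoord c p0).
  apply: (derive_eq0_ball e0) => // y v ye; rewrite derive_partial; last exact: dh.
  apply: big1 => a _; have [Wy cy yE] := chart_imageP (eV _ ye).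
  by have := f0 a _ Wy; rewrite /coord_der yE => ->; rewrite mulr0.
have nb : \forall q \near p0, ball (ccoord c p0) e (ccoord c q).
  have cc := Defs.coord_continuous cp.
  exact: (cc _ (nbhsx_ballx (ccoord c p0) e e0)).
have nW : \forall q \near p0, W q by apply: open_nbhs_nbhs.
near=> q; have Wq : W q by near: q.
have qe : ball (ccoord c p0) e (ccoord c q) by near: q.
by have := hE _ qe; rewrite /h /= !coordK //; apply: Wc.
Unshelve. all: by end_near. Qed.

(** Level sets are open, and so are their complements. *)
Lemma connected_constant (f : M -> R) : connected [set: M] ->
  (forall p, \forall q \near p, f q = f p) -> forall p q, f q = f p.
Proof.
move=> cM hf p q; pose B := [set x | f x = f p].
suff BT : B = [set: M] by rewrite -[f q = f p]/(B q) BT.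
have oB : open B.
  rewrite openE => x Bx; apply: filterS (hf x) => y /= yx.
  by rewrite /B /= yx.
have cB : closed B.
  rewrite -openC openE => x Bx; apply: filterS (hf x) => y /= yx.
  by rewrite /B /= yx.
apply: cM; first by exists p.
- by exists B; rewrite ?setTI.
- by exists B; rewrite ?setTI.
Qed.

End LocallyConstant.

Section ParallelNorm.
Variables (R : realType) (n r m : nat) (M : manifold R n) (gM : M -> 'M[R]_n).
Variables (F : vbundle M r) (gF : M -> 'M[R]_r).
Hypotheses (hgM : bundle_metric (tangent M) gM) (hgF : bundle_metric F gF).
Variables (gn : 'I_n -> 'M[R[i]]_(2 ^ n./2)) (gr : 'I_r -> 'M[R[i]]_(2 ^ r./2)).
Hypotheses (hgn : clifford_rep gn) (hgr : clifford_rep gr).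
Variables (LC : covder M n) (DF : covder M r).
Hypotheses (hLC : metric_connection (tangent M) gM LC) (hDF : metric_connection F gF DF).
Hypothesis hF : framed_bundle F.
Variables (kd : spin_kind) (P : spin_bundle gM F gF kd) (phi : P -> spinor R n r m).
Hypotheses (hphi : spinor_field gn gr phi) (hpar : parallel gn gr LC DF phi).

Lemma norm2E (psi : spinor R n r m) :
  norm2 psi = \sum_s (complex.Re (psi s) ^+ 2 + complex.Im (psi s) ^+ 2).
Proof.
by rewrite /norm2 complexRe_sum; apply: eq_bigr => s _; case: (psi s) => a b /=; ring.
Qed.

Lemma norm2_eq0 (psi : spinor R n r m) : (norm2 psi == 0) = (psi == 0).
Proof.
rewrite norm2E psumr_eq0 => [|s _]; last by rewrite addr_ge0 // sqr_ge0.
apply/allP/eqP => [h|-> s _]; last by rewrite ffunE /= expr0n addr0.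
apply/ffunP => s; rewrite ffunE; have := h s (mem_index_enum s).
rewrite paddr_eq0 ?sqr_ge0 // !sqrf_eq0 => /andP[/eqP h1 /eqP h2].
by apply/eqP; rewrite eq_complex h1 h2 /= !eqxx.
Qed.

Lemma norm2_gt0 (psi : spinor R n r m) : psi != 0 -> 0 < norm2 psi.
Proof.
move=> psi0; rewrite lt0r norm2_eq0 psi0 norm2E sumr_ge0 // => s _.
by rewrite addr_ge0 // sqr_ge0.
Qed.

Let frame_j j p0 : orthonormal_frame (tangent M) gM
  (sp_dom j `&` cdom (chart_at p0)) (sp_frameM (s := P) \o sp_sec j).
Proof. by apply: frame_sub (sp_frame_smooth j).1 => q []. Qed.
Let frameF_j j p0 : orthonormal_frame F gF
  (sp_dom j `&` cdom (chart_at p0)) (sp_frameF (s := P) \o sp_sec j).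
Proof. by apply: frame_sub (sp_frame_smooth j).2 => q []. Qed.

Lemma parallel_norm_near j p0 : sp_dom j p0 ->
  \forall q \near p0, norm2 (phi (sp_sec j q)) = norm2 (phi (sp_sec (s := P) j p0)).
Proof.
move=> jp0; pose c := chart_at p0; pose W := sp_dom j `&` cdom c.
have oW : open W.
  by apply: openI; [exact: (@sp_open _ _ _ _ _ _ _ _ P j)|exact: cdom_open].
have Wc : W `<=` cdom c by move=> q [].
have Wp : W p0 by split => //; apply: chart_at_dom.
pose psi q := phi (sp_sec j q).
have hs : spinor_smooth W psi := parallel_smooth hphi j p0.
pose f s q := complex.Re (psi q s) * complex.Re (psi q s)
            + complex.Im (psi q s) * complex.Im (psi q s).
have hfs s : smooth_fun W (f s).
  by have [h1 h2] := hs s; apply: smooth_funD => //; apply: smooth_funM.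
have hsum : smooth_fun W (fun q => \sum_s f s q) by apply: smooth_fun_sum.
have nE q : norm2 (psi q) = \sum_s f s q by rewrite norm2E.
apply: (@filterS _ (nbhs p0) _ (fun q => \sum_s f s q = \sum_s f s p0)).
  by move=> q; rewrite -!nE.
apply: (coord_der_eq0_near oW Wp Wc hsum) => i q Wq.
rewrite (coord_der_sum oW (index_enum _) i Wq (Wc _ Wq) hfs).
have -> : \sum_s coord_der c i (f s) q = 2 * complex.Re (herm (spinor_der c i psi q) (psi q)).
  rewrite /herm complexRe_sum mulr_sumr; apply: eq_bigr => s _.
  have [h1 h2] := hs s; rewrite spinor_derE.
  rewrite (coord_derD i Wq (Wc _ Wq) (smooth_funM oW h1 h1) (smooth_funM oW h2 h2)).
  rewrite (coord_derM i Wq (Wc _ Wq) h1 h1) (coord_derM i Wq (Wc _ Wq) h2 h2).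
  by rewrite /cder; case: (psi q s) => a b /=; ring.
rewrite (parallel_der hgM hgF hgn hgr hLC hDF hF hphi hpar i Wq).
set A := spin_mx gn _; set B := spin_mx gr _.
have hA : adj A = - A.
  apply: (adj_spin_mx hgn) => a b.
  exact: (conn_coef_skew (@framed_tangent _ _ M) oW Wc hgM hLC (frame_j j p0)).
have hB : adj B = - B.
  apply: (adj_spin_mx hgr) => a b.
  exact: (conn_coef_skew hF oW Wc hgF hDF (frameF_j j p0)).
have hskew : herm (conn_act A B (psi q)) (psi q) = - herm (psi q) (conn_act A B (psi q)).
  by rewrite herm_conn_act hA hB conn_actN hermNr.
rewrite (linN (V := R[i]^o) (@herm_linear _ _ _ _ _)) complexReN.
rewrite (hermC (conn_act A B (psi q)) (psi q)) in hskew.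
have := congr1 (@complex.Re R) hskew; rewrite complexReN complexRe_conj.
by move/eqP; rewrite -subr_eq0 opprK -mulr2n mulrn_eq0 => /eqP /= ->; rewrite oppr0 mulr0.
Qed.

Lemma parallel_norm_constant u v : connected [set: M] -> norm2 (phi u) = norm2 (phi v).
Proof.
move=> cM.
(* A trivialisation is chosen at each point so that the norm descends to a function on [M]; by
   [spinor_norm2_fibre] its values do not depend on the choice. *)
pose jj p := projT1 (cid (sp_cover P p)).
have jjp p : sp_dom (jj p) p := projT2 (cid (sp_cover P p)).
pose nu p := norm2 (phi (sp_sec (jj p) p)).
have nuE x : norm2 (phi x) = nu (sp_proj x).
  by apply: (spinor_norm2_fibre hgn hgr hphi); rewrite sp_secK.
rewrite !nuE; apply: (connected_constant cM) => p.
have nj : \forall q \near p, sp_dom (jj p) q.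
  by apply: open_nbhs_nbhs; split => //; apply: sp_open.
have nn := parallel_norm_near (jjp p).
near=> q; have jq : sp_dom (jj p) q by near: q.
transitivity (norm2 (phi (sp_sec (jj p) q))); last by near: q.
by rewrite nuE sp_secK.
Unshelve. all: by end_near. Qed.

End ParallelNorm.

(** * The Ricci endomorphism *)

Section FrameChange.
Variables (R : realType).
Local Notation "x %:RC" := (real_complex R x) (at level 2, format "x %:RC").

Lemma mx_sandwich d (X B : 'M[R]_d) a b :
  (X^T *m B *m X) a b = \sum_x \sum_y X x a * X y b * B x y.
Proof.
rewrite -mulmxA mxE; apply: eq_bigr => x _; rewrite !mxE mulr_sumr.
by apply: eq_bigr => y _; ring.
Qed.

(** Invariance of the trace form [\tr (A^T *m B)] under orthogonal conjugation. *)
Lemma orthogonal_contraction d (O : 'M[R]_d) (A B : 'I_d -> 'I_d -> R) :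
  O *m O^T = 1%:M ->
  \sum_k \sum_l (\sum_a \sum_b O a k * O b l * A a b) * (\sum_a \sum_b O a k * O b l * B a b) =
  \sum_a \sum_b A a b * B a b.
Proof.
move=> OO; pose mA : 'M[R]_d := \matrix_(a, b) A a b; pose mB : 'M[R]_d := \matrix_(a, b) B a b.
have E (X : 'I_d -> 'I_d -> R) k l :
    \sum_a \sum_b O a k * O b l * X a b = (O^T *m (\matrix_(a, b) X a b) *m O) k l.
  rewrite mx_sandwich; apply: eq_bigr => a _; apply: eq_bigr => b _.
  by rewrite mxE.
have tE (X Y : 'M[R]_d) : \sum_k \sum_l X k l * Y k l = \tr (X^T *m Y).
  rewrite exchange_big /mxtrace; apply: eq_bigr => l _; rewrite mxE.
  by apply: eq_bigr => k _; rewrite mxE.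
transitivity (\tr ((O^T *m mA *m O)^T *m (O^T *m mB *m O))).
  by rewrite -tE; apply: eq_bigr => k _; apply: eq_bigr => l _; rewrite !E.
transitivity (\tr (mA^T *m mB)).
  rewrite !trmx_mul trmxK -!mulmxA (mulmxA O O^T) OO mul1mx mxtrace_mulC.
  by rewrite -!mulmxA OO mulmx1.
by rewrite -tE; apply: eq_bigr => a _; apply: eq_bigr => b _; rewrite !mxE.
Qed.

Section OrthonormalBasis.
Variables (d : nat) (E g : 'M[R]_d).
Hypothesis Eg : E^T *m g *m E = 1%:M.

Lemma frame_unit : E \in unitmx.
Proof. by have [_] := mulmx1_unit Eg. Qed.

Lemma invmx_metric : invmx g = E *m E^T.
Proof.
have h : (E *m E^T) *m g = 1%:M by rewrite -mulmxA; apply: mulmx1C.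
have [_ ug] := mulmx1_unit h.
by rewrite -[LHS]mul1mx -h mulmxK.
Qed.

Lemma invmx_frame : invmx E = E^T *m g.
Proof. by rewrite -[RHS](mulmxK frame_unit) Eg mul1mx. Qed.

(** In an orthonormal frame [sharp] is a mere transposition: a form with frame matrix [B] yields the
    endomorphism with frame matrix [B^T]. *)
Lemma raise_index (B : 'M[R]_d) :
  invmx g *m ((invmx E)^T *m B *m invmx E)^T = E *m B^T *m invmx E.
Proof.
rewrite invmx_metric !trmx_mul trmxK !mulmxA; congr (_ *m _ *m _).
by rewrite -mulmxA -trmx_mul mulVmx ?frame_unit // trmx1 mulmx1.
Qed.

Lemma lower_frame (A : 'M[R]_d) : A = (invmx E)^T *m (E^T *m A *m E) *m invmx E.
Proof.
rewrite !mulmxA -trmx_mul mulmxV ?frame_unit // trmx1 mul1mx.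
by rewrite mulmxK ?frame_unit.
Qed.

End OrthonormalBasis.

(** [E *m E^T] and [f *m f^T] are both the inverse of [g]. *)
Lemma frame_change_orthogonal d (E f g : 'M[R]_d) :
  E^T *m g *m E = 1%:M -> f^T *m g *m f = 1%:M ->
  (invmx E *m f) *m (invmx E *m f)^T = 1%:M.
Proof.
move=> Eg fg; have uE := frame_unit Eg.
rewrite trmx_mul -mulmxA (mulmxA f) -(invmx_metric fg) (invmx_metric Eg).
by rewrite -mulmxA -trmx_mul mulVmx // trmx1 mulmx1 mulVmx.
Qed.


Variables (n r m : nat).
Variables (gn : 'I_n -> 'M[R[i]]_(2 ^ n./2)) (gr : 'I_r -> 'M[R[i]]_(2 ^ r./2)).
Implicit Types (psi : spinor R n r m).

Lemma kappa_vec_mul d (g : 'I_d -> 'M[R[i]]_(2 ^ d./2)) (x y : 'cV[R]_d) :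
  kappa_vec g x *m kappa_vec g y = \sum_a \sum_b (x a 0 * y b 0)%:RC *: (g a *m g b).
Proof.
rewrite /kappa_vec mulmx_suml; apply: eq_bigr => a _; rewrite mulmx_sumr.
apply: eq_bigr => b _; rewrite /re_scale -scalemxAl -scalemxAr scalerA.
by rewrite rmorphM.
Qed.

Lemma wedge_mul_comp (x y : 'cV[R]_n) psi :
  wedge_mul gn x y psi =
  \sum_a \sum_b (x a 0 * y b 0)%:RC *: act_base (wedge_mx gn a b) psi.
Proof.
have la := @act_base_linear_l R n r m; have lb := la psi.
rewrite /wedge_mul /clmul act_baseM kappa_vec_mul /re_scale -act_base_scalar -(linD lb).
have -> : ((x^T *m y) 0 0)%:RC%:M =
    \sum_a \sum_b (x a 0 * y b 0)%:RC *: ((a == b)%:R%:M : 'M[R[i]]_(2 ^ n./2)).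
  rewrite mxE rmorph_sum raddf_sum; apply: eq_bigr => a _ /=.
  rewrite (bigD1 a) //= big1 => [|b /negPf ba].
    by rewrite addr0 eqxx scale_scalar_mx mulr1 mxE.
  by rewrite eq_sym ba scale_scalar_mx mulr0; apply/matrixP => i j; rewrite !mxE mul0rn.
rewrite -big_split (lin_sum lb); apply: eq_bigr => a _ /=.
rewrite -big_split (lin_sum lb); apply: eq_bigr => b _ /=.
by rewrite -scalerDr (linZ lb).
Qed.

Lemma tw_mul_comp (y z : 'cV[R]_r) psi :
  tw_mul gr y z psi = \sum_k \sum_l (y k 0 * z l 0)%:RC *: twist (gr k *m gr l) psi.
Proof.
have lt := @twist_linear_l R n r m psi.
rewrite -[LHS]/(twist _ psi) kappa_vec_mul (lin_sum lt); apply: eq_bigr => k _.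
by rewrite (lin_sum lt); apply: eq_bigr => l _; rewrite (linZ lt).
Qed.

Lemma wedge_tw_comp psi (x y : 'cV[R]_n) (z w : 'cV[R]_r) :
  complex.Re (herm (wedge_mul gn x y (tw_mul gr z w psi)) psi) =
  \sum_a \sum_b x a 0 * y b 0 * \sum_k \sum_l z k 0 * w l 0 * eta_comp gn gr psi k l a b.
Proof.
have hl : linear (fun chi => herm chi psi : R[i]^o) := @herm_linear _ _ _ _ psi.
rewrite wedge_mul_comp (lin_sum hl) complexRe_sum; apply: eq_bigr => a _.
rewrite (lin_sum hl) complexRe_sum; apply: eq_bigr => b _; rewrite Re_hermZ; congr (_ * _).
have lr := @act_base_linear_r R n r m (wedge_mx gn a b).
rewrite tw_mul_comp (lin_sum lr) (lin_sum hl) complexRe_sum; apply: eq_bigr => k _.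
rewrite (lin_sum lr) (lin_sum hl) complexRe_sum; apply: eq_bigr => l _.
by rewrite (linZ lr) Re_hermZ.
Qed.

Variables (M : manifold R n) (gM : M -> 'M[R]_n) (F : vbundle M r) (gF : M -> 'M[R]_r).
Variables (kd : spin_kind) (P : spin_bundle gM F gF kd) (phi : P -> spinor R n r m).

Definition eta_mx psi (O : 'M[R]_r) k l : 'M[R]_n :=
  \matrix_(x, y) \sum_a \sum_b O a k * O b l * eta_comp gn gr psi a b x y.

(** Separates the two changes of frame: the one of [F] mixes the indices [k], [l], the one of the
    tangent space mixes the arguments of the form. *)
Lemma eta_formE u (f : 'M[R]_r) k l :
  eta_form gn gr phi u f k l =
  (invmx (sp_frameM u))^T *m eta_mx (phi u) (invmx (sp_frameF u) *m f) k l
    *m invmx (sp_frameM u).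
Proof.
apply/matrixP => a b; rewrite mxE wedge_tw_comp mx_sandwich.
apply: eq_bigr => x _; apply: eq_bigr => y _; rewrite -!colE ![col _ _ _ _]mxE mxE.
congr (_ * _); apply: eq_bigr => z _; apply: eq_bigr => w _.
by rewrite !(colE _ f) !mulmxA -!colE ![col _ _ _ _]mxE.
Qed.

End FrameChange.

(** * From the pointwise identity to the Ricci endomorphism in an arbitrary frame of [F] *)

Section RicciDecomposition.
Variables (R : realType) (n r m : nat) (M : manifold R n) (gM : M -> 'M[R]_n).
Variables (F : vbundle M r) (gF : M -> 'M[R]_r).
Hypotheses (hgM : bundle_metric (tangent M) gM) (hgF : bundle_metric F gF).
Variables (gn : 'I_n -> 'M[R[i]]_(2 ^ n./2)) (gr : 'I_r -> 'M[R[i]]_(2 ^ r./2)).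
Hypotheses (hgn : clifford_rep gn) (hgr : clifford_rep gr).
Variables (LC : covder M n) (DF : covder M r).
Hypotheses (hLC : levi_civita gM LC) (hDF : metric_connection F gF DF).
Hypothesis hF : framed_bundle F.
Variables (kd : spin_kind) (P : spin_bundle gM F gF kd) (phi : P -> spinor R n r m).
Hypotheses (hphi : spinor_field gn gr phi) (hpar : parallel gn gr LC DF phi).
Local Notation "x %:RC" := (real_complex R x) (at level 2, format "x %:RC").

Let hmM : metric_connection (tangent M) gM LC. Proof. by case: hLC. Qed.
Let hcF : is_connection F DF. Proof. by case: hDF. Qed.
Let hT := framed_tangent M.

Variables (j : sp_triv P) (p : M).
Hypothesis jp : sp_dom j p.
Let c := chart_at p.
Let W := sp_dom j `&` cdom c.
Let oW : open W.
Proof. by apply: openI; [exact: (@sp_open _ _ _ _ _ _ _ _ P j)|exact: cdom_open]. Qed.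
Let Wc : W `<=` cdom c. Proof. by move=> q []. Qed.
Let Wp : W p. Proof. by split => //; apply: chart_at_dom. Qed.
Let e := sp_frameM (s := P) \o sp_sec (s := P) j.
Let f0 := sp_frameF (s := P) \o sp_sec (s := P) j.
Let psi := phi (sp_sec j p).
Let he : orthonormal_frame (tangent M) gM W e.
Proof. by apply: frame_sub (sp_frame_smooth j).1 => q []. Qed.
Let hf0 : orthonormal_frame F gF W f0.
Proof. by apply: frame_sub (sp_frame_smooth j).2 => q []. Qed.
Let Ep : (e p)^T *m gM p *m e p = 1%:M. Proof. by case: he => _; apply. Qed.
Let Fp : (f0 p)^T *m gF p *m f0 p = 1%:M. Proof. by case: hf0 => _; apply. Qed.

Let Om := frame_curv gM LC p e.

(** Theta in the frames of the trivialisation, both for [M] and for [F]; the frame of [F] given in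
    the theorem enters through [O]. *)
Definition frame_Theta x y k l : R :=
  \sum_i \sum_i' e p i x * e p i' y * frame_curvF DF (P := P) j p i i' k l.

Lemma frame_Theta_skew x y k l : frame_Theta x y l k = - frame_Theta x y k l.
Proof.
rewrite /frame_Theta -sumrN; apply: eq_bigr => i _; rewrite -sumrN; apply: eq_bigr => i' _.
rewrite -mulrN; congr (_ * _).
exact: (curvature_form_skew hF hcF oW Wc hgF hDF hf0).
Qed.

(** The identity of [parallel_curvature] is bilinear in the two directions, so it passes from
    coordinate fields to the frame. *)
Lemma frame_curvature_spinor x y :
  conn_act (spin_mx gn (fun a b => (Om x y a b)%:RC))
           (spin_mx gr (fun k l => (frame_Theta x y k l)%:RC)) psi = 0.
Proof.
have spin_sum d N (g : 'I_d -> 'M[R[i]]_N) (h : 'I_n -> 'I_n -> R)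
    (K : 'I_n -> 'I_n -> 'I_d -> 'I_d -> R) :
  spin_mx g (fun a b => (\sum_i \sum_i' h i i' * K i i' a b)%:RC) =
  \sum_i \sum_i' (h i i')%:RC *: spin_mx g (fun a b => (K i i' a b)%:RC).
  under [RHS]eq_bigr => i _ do under eq_bigr => i' _ do rewrite -spin_mxZ.
  apply/esym; under eq_bigr => i _ do rewrite exchange_big.
  rewrite exchange_big; apply: eq_bigr => a _ /=.
  under eq_bigr => i _ do rewrite exchange_big.
  rewrite exchange_big; apply: eq_bigr => b _ /=.
  under eq_bigr => i _ do rewrite -scaler_suml.
  rewrite -scaler_suml; congr (_ *: _); rewrite rmorph_sum mulr_suml; apply: eq_bigr => i _.
  by rewrite rmorph_sum mulr_suml; apply: eq_bigr => i' _; rewrite rmorphM.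
have lb := @act_base_linear_l R n r m psi; have lt := @twist_linear_l R n r m psi.
rewrite [X in conn_act X _ _](spin_sum _ _ gn (fun i i' => e p i x * e p i' y)
  (fun i i' a b => frame_curvM LC (P := P) j p i i' a b)).
rewrite [X in conn_act _ X _](spin_sum _ _ gr (fun i i' => e p i x * e p i' y)
  (fun i i' a b => frame_curvF DF (P := P) j p i i' a b)).
rewrite /conn_act (lin_sum lb) (lin_sum lt) -big_split big1 // => i _ /=.
rewrite (lin_sum lb) (lin_sum lt) -big_split big1 // => i' _ /=.
rewrite (linZ lb) (linZ lt) -scalerDr -/(conn_act _ _ _).
by rewrite (parallel_curvature hgM hgF hgn hgr hmM hDF hF hphi hpar jp) scaler0.
Qed.

Variables (U : set M) (f : M -> 'M[R]_r).
Hypotheses (oU : open U) (hf : orthonormal_frame F gF U f) (Up : U p).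
Let O := invmx (f0 p) *m f p.

(** By tensoriality the sections of [f] may be replaced by their expansions in [f0], on the common
    domain of the two frames, with coefficients taken at [p] only. *)
Lemma Theta_form_frame k l : (e p)^T *m Theta_form gF DF f k l p *m e p =
  \matrix_(x, y) \sum_a \sum_b O a k * O b l * frame_Theta x y a b.
Proof.
pose W' := W `&` U; have oW' : open W' by apply: openI.
have W'c : W' `<=` cdom c by move=> q [/Wc].
have W'p : W' p by [].
have hf0' : orthonormal_frame F gF W' f0 by apply: frame_sub hf0 => q [].
have hs a : smooth_sec F W' (fun q => col a (f q)).
  by case: hf => h _; apply: smooth_sec_sub (h a) => q [].
have OE a b : inner gF p (col b (f p)) (col a (f0 p)) = O a b.
  rewrite (innerC hgF) /inner tr_col (colE b) mulmxA -!row_mul -colE /O (invmx_frame Fp).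
  by rewrite !mxE.
have key i i' : Theta_form gF DF f k l p i i' =
    \sum_a \sum_b O a k * O b l * frame_curvF DF (P := P) j p i i' a b.
  rewrite mxE curv_coord_fields; last exact: chart_at_dom.
  rewrite (coord_curv_tensor hF hcF oW' W'c hgF hf0' i i' (hs k) W'p).
  rewrite (inner_suml hgF); apply: eq_bigr => a _; rewrite innerZl OE.
  rewrite (frame_coordinates hgF hf0' (col l (f p)) W'p) inner_sumr mulr_sumr.
  by apply: eq_bigr => b _; rewrite innerZr OE mulrA.
apply/matrixP => x y; rewrite mx_sandwich mxE.
under eq_bigr => i _ do under eq_bigr => i' _ do rewrite key mulr_sumr.
under eq_bigr => i _ do rewrite exchange_big.
rewrite exchange_big; apply: eq_bigr => a _ /=.
under eq_bigr => i _ do under eq_bigr => i' _ do rewrite mulr_sumr.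
under eq_bigr => i _ do rewrite exchange_big.
rewrite exchange_big; apply: eq_bigr => b _ /=.
rewrite mulr_sumr; apply: eq_bigr => i _; rewrite mulr_sumr; apply: eq_bigr => i' _.
by ring.
Qed.

Let ricE := (e p)^T *m ricci_form LC p *m e p.
Let thE k l : 'M[R]_n := \matrix_(x, y) \sum_a \sum_b O a k * O b l * frame_Theta x y a b.
Let etaE k l : 'M[R]_n := eta_mx gn gr psi O k l.

(** Both [thE] and [etaE] are skew in [k], [l], so the sum over [k < l] is half the full sum, which
    the orthogonal matrix [O] carries to the frame of the trivialisation. *)
Lemma ricci_frame_decomposition : psi != 0 ->
  ricE = (norm2 psi)^-1 *: \sum_(k < r) \sum_(l < r | (k < l)%N) thE k l *m etaE k l.
Proof.
move=> psi0; have N0 := lt0r_neq0 (norm2_gt0 psi0).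
have OO : O *m O^T = 1%:M.
  by apply: (frame_change_orthogonal Fp); case: hf => _; apply.
have skO (B : 'I_r -> 'I_r -> R) k l : (forall a b, B b a = - B a b) ->
    \sum_a \sum_b O a l * O b k * B a b = - \sum_a \sum_b O a k * O b l * B a b.
  move=> sB; rewrite exchange_big -sumrN; apply: eq_bigr => a _; rewrite -sumrN.
  by apply: eq_bigr => b _; rewrite sB; ring.
have thS k l : thE l k = - thE k l.
  apply/matrixP => x y; rewrite !mxE; apply: skO => a b; exact: frame_Theta_skew.
have etaS k l : etaE l k = - etaE k l.
  apply/matrixP => x y; rewrite !mxE; apply: skO => a b; exact: eta_comp_skew.
have th0 k : thE k k = 0.
  apply/matrixP => x y; have /matrixP/(_ x y) := thS k k; rewrite [RHS]mxE => /eqP.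
  by rewrite -subr_eq0 opprK -mulr2n mulrn_eq0 => /eqP ->; rewrite mxE.
have two0 : (2 : R) != 0 by rewrite pnatr_eq0.
have S2 : \sum_k \sum_l thE k l *m etaE k l =
    (\sum_(k < r) \sum_(l < r | (k < l)%N) thE k l *m etaE k l) *+ 2.
  apply: (sum_lt_sym (F := fun k l => thE k l *m etaE k l)) => [k l|k].
    by rewrite thS etaS mulNmx mulmxN opprK.
  by rewrite th0 mul0mx.
apply: (scalerI N0); rewrite scalerA divff // scale1r.
apply: (scalerI two0); rewrite [RHS]scaler_nat -S2.
apply/matrixP => x z; rewrite summxE.
have -> : (2 *: (norm2 psi *: ricE)) x z = 2 * (ricE x z * norm2 psi).
  by rewrite mxE [X in 2 * X]mxE [norm2 psi * _]mulrC.
have hE : ricE x z = \sum_y Om y x z y by rewrite /ricE (ricci_frame hgM hLC oW Wc Wp he).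
have ric_id := @ricci_identity R n r m gn gr hgn hgr psi Om frame_Theta
  (frame_curv_skew12 gM LC p e) (frame_curv_skew34 hgM hLC oW Wc Wp he)
  (frame_curv_bianchi hgM hLC oW Wc Wp he) frame_Theta_skew frame_curvature_spinor x z.
rewrite hE ric_id mulrA divff // mul1r.
under [RHS]eq_bigr => k _ do rewrite summxE.
have -> : \sum_k \sum_l \sum_y frame_Theta x y k l * eta_comp gn gr psi k l y z =
   \sum_y \sum_k \sum_l frame_Theta x y k l * eta_comp gn gr psi k l y z.
  by rewrite [RHS]exchange_big; apply: eq_bigr => k _; rewrite [RHS]exchange_big.
have -> : \sum_k \sum_l (thE k l *m etaE k l) x z =
          \sum_y \sum_k \sum_l thE k l x y * etaE k l y z.
  rewrite [RHS]exchange_big; apply: eq_bigr => k _; rewrite [RHS]exchange_big.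
  by apply: eq_bigr => l _; rewrite mxE.
apply: eq_bigr => y _; rewrite -(orthogonal_contraction _ _ OO).
by apply: eq_bigr => k _; apply: eq_bigr => l _; rewrite !mxE.
Qed.

Lemma Theta_form_skew k l : (Theta_form gF DF f k l p)^T = - Theta_form gF DF f k l p.
Proof.
apply/matrixP => i i'; rewrite !mxE !curv_coord_fields; try exact: chart_at_dom.
by rewrite coord_curvN -scaleN1r innerZl mulN1r.
Qed.

Lemma Ric_decomposition u : sp_proj u = p -> phi u != 0 ->
  let eta_hat k l := sharp gM p (eta_form gn gr phi u (f p) k l) in
  let Theta_hat k l := sharp gM p (Theta_form gF DF f k l p) in
  Ric gM LC p = (norm2 (phi u))^-1 *:
    (\sum_(k < r) \sum_(l < r | (k < l)%N) eta_hat k l *m Theta_hat k l) /\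
  Ric gM LC p = (norm2 (phi u))^-1 *:
    (\sum_(k < r) \sum_(l < r | (k < l)%N) Theta_hat k l *m eta_hat k l).
Proof.
move=> up phi0 eta_hat Theta_hat; have uv : sp_proj u = sp_proj (sp_sec j p) by rewrite sp_secK.
have Nu : norm2 (phi u) = norm2 psi := spinor_norm2_fibre hgn hgr hphi uv.
have psi0 : psi != 0 by rewrite -norm2_eq0 -Nu norm2_eq0.
have uE := frame_unit Ep.
have etaH k l : eta_hat k l = e p *m (etaE k l)^T *m invmx (e p).
  by rewrite /eta_hat (eta_form_fibre hgn hgr hphi _ _ _ uv) eta_formE /sharp (raise_index Ep).
have thH k l : Theta_hat k l = e p *m (thE k l)^T *m invmx (e p).
  by rewrite /Theta_hat (lower_frame Ep (Theta_form _ _ _ _ _ _)) Theta_form_frame /sharp (raise_index Ep).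
have ricH : Ric gM LC p = e p *m ricE^T *m invmx (e p).
  by rewrite /Ric (lower_frame Ep (ricci_form _ _)) /sharp (raise_index Ep).
have etaT k l : (etaE k l)^T = - etaE k l.
  apply/matrixP => x y; rewrite !mxE -sumrN; apply: eq_bigr => a _; rewrite -sumrN.
  by apply: eq_bigr => b _; rewrite eta_comp_skew_form // mulrN.
have thT k l : (thE k l)^T = - thE k l.
  by rewrite /thE -Theta_form_frame !trmx_mul trmxK Theta_form_skew mulNmx mulmxN mulmxA.
have conj (A B : 'M[R]_n) : e p *m A *m invmx (e p) *m (e p *m B *m invmx (e p)) =
    e p *m (A *m B) *m invmx (e p).
  by rewrite -!mulmxA (mulmxA (invmx _)) mulVmx // mul1mx.
have conjS (G : 'I_r -> 'I_r -> 'M[R]_n) :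
  \sum_(k < r) \sum_(l < r | (k < l)%N) e p *m G k l *m invmx (e p) =
  e p *m (\sum_(k < r) \sum_(l < r | (k < l)%N) G k l) *m invmx (e p).
  rewrite mulmx_sumr mulmx_suml; apply: eq_bigr => k _.
  by rewrite mulmx_sumr mulmx_suml.
have ricS : ricE^T = ricE := ricci_frame_sym hgM hLC oW Wc Wp he.
rewrite ricH Nu; split.
  (* As [sharp] transposes frame matrices, [eta_hat *m Theta_hat] is the conjugate of
     [(thE *m etaE)^T], which fits [ricE^T] directly. *)
  rewrite (eq_bigr (fun k : 'I_r => \sum_(l < r | (k < l)%N)
    e p *m (thE k l *m etaE k l)^T *m invmx (e p))) => [|k _]; last first.
    by apply: eq_bigr => l _; rewrite etaH thH conj trmx_mul.
  rewrite conjS scalemxAl scalemxAr; congr (_ *m _ *m _).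
  rewrite (ricci_frame_decomposition psi0) linearZ; congr (_ *: _).
  by rewrite raddf_sum; apply: eq_bigr => k _; rewrite raddf_sum.
(* In the other order the two transposes amount to two signs, which cancel, and the symmetry of
   [ricE] is used instead. *)
rewrite (eq_bigr (fun k : 'I_r => \sum_(l < r | (k < l)%N)
    e p *m (thE k l *m etaE k l) *m invmx (e p))) => [|k _]; last first.
  apply: eq_bigr => l _; rewrite etaH thH conj; congr (_ *m _ *m _).
  by rewrite etaT thT mulNmx mulmxN opprK.
by rewrite conjS scalemxAl scalemxAr ricS (ricci_frame_decomposition psi0).
Qed.

End RicciDecomposition.

(** The origin of the minus sign in the second formula for the scalar curvature: a skew form yields
    an endomorphism that is skew for the metric. *)
Lemma metric_adjoint_sharp (R : realType) (n : nat) (M : manifold R n) (gM : M -> 'M[R]_n)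
    (p : M) (B : 'M[R]_n) : bundle_metric (tangent M) gM -> gM p \in unitmx -> B^T = - B ->
  metric_adjoint gM p (sharp gM p B) = - sharp gM p B.
Proof.
case=> sg _ _ ug BT; rewrite /metric_adjoint /sharp trmx_mul trmxK trmx_inv sg.
by rewrite BT mulmxN opprK -mulmxA mulmxKV.
Qed.

Theorem theorem3p1 (R : realType) (n r m : nat) (hn : (0 < n)%N)
  (hr : (2 <= r)%N)
  (gn : 'I_n -> 'M[R[i]]_(2 ^ n./2)) (hgn : clifford_rep gn)
  (gr : 'I_r -> 'M[R[i]]_(2 ^ r./2)) (hgr : clifford_rep gr)
  (M : manifold R n) (hM : connected [set: M])
  (gM : M -> 'M[R]_n) (hgM : bundle_metric (tangent M) gM)
  (LC : covder M n) (hLC : levi_civita gM LC)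
  (F : vbundle M r) (hF : oriented_bundle F)
  (gF : M -> 'M[R]_r) (hgF : bundle_metric F gF)
  (DF : covder M r) (hDF : metric_connection F gF DF)
  (P : spin_bundle gM F gF SpinTwisted)
  (S : spinor_structure P m)
  (phi : spinor_bundle S -> spinor R n r m)
  (hphi : spinor_field gn gr phi)
  (hphi0 : exists u, phi u != 0)
  (hpar : parallel gn gr LC DF phi) :
  [/\ (exists2 c : R, 0 < c &
        forall u, Num.sqrt (norm2 (phi u)) = c) /\
      (forall u, phi u != 0),
      forall (U : set M) (f : M -> 'M[R]_r), open U ->
        orthonormal_frame F gF U f ->
        forall u : spinor_bundle S, U (sp_proj u) ->
        let p := sp_proj u in
        let eta_hat k l := sharp gM p (eta_form gn gr phi u (f p) k l) in
        let Theta_hat k l := sharp gM p (Theta_form gF DF f k l p) in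
        Ric gM LC p = (norm2 (phi u))^-1 *:
          (\sum_(k < r) \sum_(l < r | (k < l)%N) eta_hat k l *m Theta_hat k l) /\
        Ric gM LC p = (norm2 (phi u))^-1 *:
          (\sum_(k < r) \sum_(l < r | (k < l)%N) Theta_hat k l *m eta_hat k l),
      forall (U : set M) (f : M -> 'M[R]_r), open U ->
        orthonormal_frame F gF U f ->
        forall u : spinor_bundle S, U (sp_proj u) ->
        let p := sp_proj u in
        let eta_hat k l := sharp gM p (eta_form gn gr phi u (f p) k l) in
        let Theta_hat k l := sharp gM p (Theta_form gF DF f k l p) in
        scalar_curvature gM LC p = (norm2 (phi u))^-1 *
          (\sum_(k < r) \sum_(l < r | (k < l)%N) \tr (Theta_hat k l *m eta_hat k l)) /\
        scalar_curvature gM LC p = - (norm2 (phi u))^-1 *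
          (\sum_(k < r) \sum_(l < r | (k < l)%N)
             \tr (eta_hat k l *m metric_adjoint gM p (Theta_hat k l))),
      flat F DF -> forall p, Ric gM LC p = 0
    & (forall (U : set M) (f : M -> 'M[R]_r), open U ->
         orthonormal_frame F gF U f ->
         forall u : spinor_bundle S, U (sp_proj u) ->
         forall k l : 'I_r, (k < l)%N ->
           eta_form gn gr phi u (f (sp_proj u)) k l = 0) ->
      forall p, Ric gM LC p = 0].
Proof.
have hFr := framed_oriented hF.
have [hmM _] := hLC.
have phi0 u : phi u != 0.
  have [u0 pu0] := hphi0; rewrite -norm2_eq0.
  by rewrite (parallel_norm_constant hgM hgF hgn hgr hmM hDF hFr hphi hpar u u0 hM) norm2_eq0.
have Rdec : forall (U : set M) (f : M -> 'M[R]_r), open U -> orthonormal_frame F gF U f ->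
    forall u : spinor_bundle S, U (sp_proj u) -> let p := sp_proj u in
    let eta_hat k l := sharp gM p (eta_form gn gr phi u (f p) k l) in
    let Theta_hat k l := sharp gM p (Theta_form gF DF f k l p) in
    Ric gM LC p = (norm2 (phi u))^-1 *:
      (\sum_(k < r) \sum_(l < r | (k < l)%N) eta_hat k l *m Theta_hat k l) /\
    Ric gM LC p = (norm2 (phi u))^-1 *:
      (\sum_(k < r) \sum_(l < r | (k < l)%N) Theta_hat k l *m eta_hat k l).
  move=> U f oU hf u Uu p; have [j jp] := sp_cover (spinor_bundle S) p.
  exact: (Ric_decomposition hgM hgF hgn hgr hLC hDF hFr hphi hpar jp oU hf Uu (erefl p) (phi0 u)).
(* Ricci-flatness mentions no frame of [F]; the frame of a trivialisation around [p] is used to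
   apply the decomposition. *)
have local_frame p : exists u : spinor_bundle S, exists U : set M,
    exists f : M -> 'M[R]_r, [/\ sp_proj u = p, open U, U p & orthonormal_frame F gF U f].
  have [j jp] := sp_cover (spinor_bundle S) p.
  exists (sp_sec j p), (sp_dom j), (sp_frameF (s := spinor_bundle S) \o sp_sec j).
  split => //; [exact: sp_secK|exact: sp_open|exact: (sp_frame_smooth j).2].
have trS (u : spinor_bundle S) (G : 'I_r -> 'I_r -> 'M[R]_n) :
    \tr ((norm2 (phi u))^-1 *: \sum_(k < r) \sum_(l < r | (k < l)%N) G k l) =
    (norm2 (phi u))^-1 * \sum_(k < r) \sum_(l < r | (k < l)%N) \tr (G k l).
  rewrite mxtraceZ raddf_sum; congr (_ * _); apply: eq_bigr => k _.
  by rewrite raddf_sum.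
split.
- split; last exact: phi0.
  have [u0 _] := hphi0; exists (Num.sqrt (norm2 (phi u0))).
    by rewrite sqrtr_gt0 norm2_gt0.
  move=> u; congr Num.sqrt.
  exact: (parallel_norm_constant hgM hgF hgn hgr hmM hDF hFr hphi hpar u u0 hM).
- exact: Rdec.
- move=> U f oU hf u Uu p eta_hat Theta_hat.
  have [R1 R2] := Rdec U f oU hf u Uu.
  split; first by rewrite /scalar_curvature R2 trS.
  rewrite /scalar_curvature R1 trS mulNr -mulrN; congr (_ * _).
  rewrite -sumrN; apply: eq_bigr => k _; rewrite -sumrN; apply: eq_bigr => l _.
  have ug : gM p \in unitmx.
    have [j jp] := sp_cover (spinor_bundle S) p.
    have [_ /(_ p jp) Ep] := (sp_frame_smooth j).1.
    by have [] := mulmx1_unit Ep; rewrite unitmx_mul => /andP[].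
  rewrite (metric_adjoint_sharp hgM ug); last exact: Theta_form_skew.
  by rewrite mulmxN raddfN opprK.
- move=> hflat p; have [u [U [f [up oU Up hf]]]] := local_frame p.
  subst p; have [-> _] := Rdec U f oU hf u Up.
  rewrite big1 ?scaler0 // => k _; rewrite big1 // => l _.
  have -> : Theta_form gF DF f k l (sp_proj u) = 0.
    apply/matrixP => a b; rewrite !mxE.
    (* [Theta_form] is evaluated on coordinate fields, whose smoothness is available on the chart
       domain, so flatness is applied on this smaller set. *)
    pose V := U `&` cdom (chart_at (sp_proj u)).
    have oV : open V by apply: openI => //; apply: cdom_open.
    have hX a' := coord_field_smooth (p0 := sp_proj u) a' oV (fun q Vq => Vq.2).
    rewrite (hflat V oV _ _ _ (hX a) (hX b)); first by rewrite /inner trmx0 !mul0mx mxE.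
      by case: hf => h _; apply: smooth_sec_sub (h k) => q [].
    by split => //; apply: chart_at_dom.
  by rewrite /sharp trmx0 !mulmx0.
- move=> eta0 p; have [u [U [f [up oU Up hf]]]] := local_frame p.
  subst p; have [-> _] := Rdec U f oU hf u Up.
  rewrite big1 ?scaler0 // => k _; rewrite big1 // => l kl.
  by rewrite (eta0 U f oU hf u Up k l kl) /sharp trmx0 mulmx0 mul0mx.
Qed.
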